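(* Let $n\ge3$, $1\le k\le n/2$, and let $F_1,F_2$ be Minkowski norms on $\mathbb{R}^n$ invariant under the standard block diagonal action of $SO(k)\times SO(n-k)$. Let $\Phi$ be a local Hessian isometry from $F_1$ to $F_2$ defined on a connected $SO(k)\times SO(n-k)$-invariant conic open set $C$ disjoint from $V'=\mathrm{span}(e_1,\dots,e_k)$ (and, if $k>1$, also from $V''=\mathrm{span}(e_{k+1},\dots,e_n)$), with image disjoint from the same set(s), and mapping orbits into orbits. Then $\Phi=\Phi_1\circ\Phi_2$, where $\Phi_1$ is an invertible linear map of $\mathbb{R}^n$ (a linear isometry from some Minkowski norm $F_3=F_2\circ\Phi_1$ to $F_2$) and $\Phi_2$ is a local Hessian isometry from $F_1$ to $F_3$ on $C$ which in spherical coordinates has the form $(r,t,\xi)\mapsto(\rho(r,t),\theta(t),\xi)$ if $k=1$, resp. $(r,t,\xi',\xi'')\mapsto(\rho(r,t),\theta(t),\xi',\xi'')$ if $k>1$ (i.e. it fixes all $\xi$-, resp. $\xi'$- and $\xi''$-coordinates); in particular $\Phi_2$ is equivariant with respect to $O(n-1)$ (if $k=1$), resp. $O(k)\times O(n-k)$ (if $k>1$).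
   Context: A Minkowski norm on $\mathbb{R}^n$ is a continuous function $F:\mathbb{R}^n\to\mathbb{R}_{\ge 0}$, smooth and positive on $\mathbb{R}^n\setminus\{0\}$, positively $1$-homogeneous, such that the Hessian of $E=\tfrac12F^2$ is positive definite on $\mathbb{R}^n\setminus\{0\}$; its Hessian metric is $g=\mathrm{d}^2E$. The standard block diagonal action is by $\mathrm{diag}(A',A'')$, $A'\in SO(k)$, $A''\in SO(n-k)$; for $k=1$, $O(n-1)$ acts by $\mathrm{diag}(1,A)$, and for $k>1$, $O(k)\times O(n-k)$ acts by $\mathrm{diag}(A',A'')$. Spherical coordinates: for $k=1$, $(r,\theta,\xi)$ with $x_1=r\cos\theta$, $(x_2,\dots,x_n)^T=r\sin\theta\,\xi$, $\theta\in(0,\pi)$, $\xi$ in the unit sphere of $\mathbb{R}^{n-1}$; for $k>1$, $(r,\theta,\xi',\xi'')$ with $(x_1,\dots,x_k)^T=r\cos\theta\,\xi'$, $(x_{k+1},\dots,x_n)^T=r\sin\theta\,\xi''$, $\theta\in(0,\pi/2)$, $\xi',\xi''$ in the unit spheres of $\mathbb{R}^k,\mathbb{R}^{n-k}$; $t$ denotes the $\theta$-coordinate on the domain side. A conic set is one of the form $\{\lambda y\mid y\in U,\lambda>0\}$. A local Hessian isometry is a positively $1$-homogeneous diffeomorphism between conic open sets pulling back one Hessian metric to the other. *)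

(* Defs.v *)
(* R^n is modelled as row vectors
   'rV[R]_(k + m) with n = k + m, so that the block splitting x = (x', x'')
   with x' in R^k, x'' in R^(n-k) is row_mx (lsubmx x) (rsubmx x). *)
From HB Require Import structures.
From mathcomp Require Import all_boot all_order all_algebra.
From mathcomp Require Import all_classical all_reals all_analysis.
Set Implicit Arguments. Unset Strict Implicit. Unset Printing Implicit Defensive.
Import Order.TTheory GRing.Theory Num.Theory.
Import numFieldNormedType.Exports.
Local Open Scope classical_set_scope.
Local Open Scope ring_scope.

Section Defs.
Variable R : realType.

Section Smooth.
Variables (V W : normedModType R).

Fixpoint iderive (f : V -> W) (vs : seq V) : V -> W :=
  match vs with
  | [::] => f
  | v :: vs' => fun x => derive (iderive f vs') x v
  end.

Definition smooth_on (U : set V) (f : V -> W) : Prop :=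
  forall vs : seq V, forall x, U x ->
    {for x, continuous (iderive f vs)} /\ (forall v, derivable (iderive f vs) x v).

End Smooth.

Definition diffeo_on (V : normedModType R) (U : set V) (f : V -> V) : Prop :=
  smooth_on (W:=V) U f /\
  exists g : V -> V, smooth_on (W:=V) (f @` U) g /\
    (forall x, U x -> g (f x) = x) /\ (forall y, (f @` U) y -> f (g y) = y).

Section Rn.
Variables k m : nat.
Local Notation V := 'rV[R]_(k + m).

Definition enorm n (x : 'rV[R]_n) : R := Num.sqrt (\sum_i (x 0 i) ^+ 2).

Definition energy (F : V -> R) : V -> R := fun x => (F x) ^+ 2 / 2.
Definition hess_metric (F : V -> R) (x u v : V) : R :=
  derive (fun y => derive (energy F) y v) x u.

Definition minkowski_norm (F : V -> R) : Prop :=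
  continuous F /\
  (forall x, 0 <= F x) /\
  smooth_on (~` [set 0]) F /\
  (forall x, x != 0 -> 0 < F x) /\
  (forall (l : R) x, 0 < l -> F (l *: x) = l * F x) /\
  (forall x v, x != 0 -> v != 0 -> 0 < hess_metric F x v v).

Definition conic (C : set V) : Prop :=
  forall (l : R) x, 0 < l -> C x -> C (l *: x).

Definition local_hessian_isometry (F1 F2 : V -> R) (C : set V) (Phi : V -> V)
  : Prop :=
  open C /\ conic C /\ open (Phi @` C) /\ conic (Phi @` C) /\
  (forall (l : R) x, 0 < l -> C x -> Phi (l *: x) = l *: Phi x) /\
  diffeo_on C Phi /\
  (forall x u v, C x ->
     hess_metric F2 (Phi x) (derive Phi x u) (derive Phi x v)
     = hess_metric F1 x u v).

Definition SOmx p (A : 'M[R]_p) : Prop := A *m A^T = 1%:M /\ \det A = 1.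
Definition block_SO (g : 'M[R]_(k + m)) : Prop :=
  exists (A : 'M[R]_k) (B : 'M[R]_m), SOmx A /\ SOmx B /\ g = block_mx A 0 0 B.
Definition G_invariant_fun (F : V -> R) : Prop :=
  forall g x, block_SO g -> F (x *m g) = F x.
Definition G_invariant_set (C : set V) : Prop :=
  forall g x, block_SO g -> C x -> C (x *m g).
Definition maps_orbits_into_orbits (C : set V) (Phi : V -> V) : Prop :=
  forall g x, block_SO g -> C x ->
    exists h, block_SO h /\ Phi (x *m g) = Phi x *m h.

Definition Vprime : set V := [set x | rsubmx x = 0].
Definition Vsecond : set V := [set x | lsubmx x = 0].

Definition sph_t (x : V) : R :=
  if k == 1%N then acos ((\sum_i lsubmx x 0 i) / enorm x) (* = acos (x_1/r) as k = 1 *)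
  else acos (enorm (lsubmx x) / enorm x).

(* Phi2 has, in spherical coordinates, the form
   (r,t,xi) |-> (rho(r,t), theta(t), xi)          if k = 1
   (r,t,xi',xi'') |-> (rho(r,t), theta(t), xi', xi'')  if k > 1 *)
Definition spherical_form (C : set V) (Phi2 : V -> V) : Prop :=
  exists (rho : R -> R -> R) (theta : R -> R),
    forall x, C x ->
      let r := enorm x in let t := sph_t x in
      0 < rho r t /\
      (if k == 1%N then 0 < theta t < pi else 0 < theta t < pi / 2) /\
      Phi2 x = rho r t *: row_mx
        (if k == 1%N then cos (theta t) *: const_mx 1
         else (cos (theta t) / enorm (lsubmx x)) *: lsubmx x)
        ((sin (theta t) / enorm (rsubmx x)) *: rsubmx x).
End Rn.
End Defs.

(* Main.v *)
(* On an orbit the Hessian metric of an invariant Minkowski norm restricts to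
   alpha <u',w'> + beta <u'',w''>, with alpha and beta constant on the orbit, and the
   orthogonal complement of the orbit is the span of (x',0) and (0,x''). Hence the Koszul
   identity shows that Phi maps the great circles of an orbit to curves with radial
   acceleration in each factor. On a flat torus through x the map is linear on angles, given by an
   integer matrix M which is invertible over the integers (injectivity) and has orthogonal columns
   for the target metric, so M is monomial: Phi preserves or exchanges the two factors, and on
   one orbit it is linear and conformal on each of them. Since the derivative of Phi along
   (x',0) is radial, the directions of Phi' and Phi'' do not depend on |x'|/|x''|, so
   connectedness makes the orthogonal factor P the same on all orbits. *)
Require Import Defs.
From HB Require Import structures.
From mathcomp Require Import all_boot all_order all_algebra.
From mathcomp Require Import all_classical all_reals all_analysis.
From mathcomp Require Import ring lra zify.
Set Implicit Arguments. Unset Strict Implicit. Unset Printing Implicit Defensive.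
Import Order.TTheory GRing.Theory Num.Theory.
Import numFieldNormedType.Exports.
Local Open Scope classical_set_scope.
Local Open Scope ring_scope.

(** * Directional derivatives: first-order estimates and symmetry of second derivatives *)

Section Calculus.
Context {R : realType} {V : normedModType R}.
Implicit Types (f : V -> R) (x u v w : V).

(** No connection or curvature is defined. The tangent space of an orbit at [x] consists of the
    [x A] with [A] block-skew, and [Phi] is differentiated only along the fields [y A]; the
    second-order expression [Z A B] stands in for the covariant derivative. Curvature could not
    separate the factors: for k = 2 one of them is a circle, and for k = m = 2 the orbits are flat
    tori. Periodicity is what separates them. A torus curve with integer speeds (i, j) closes after
    time 2 pi, and so does its image, so the angular speed of the image in each block is an integer.
    Its square is a quadratic form in (i, j) all of whose values are squares; such a form is the
    square of an integral linear form, whose coefficients are a row of M. For k = 1 the group SO(1)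
    is trivial, an orbit is a single sphere, and x_1 is constant on it with any sign, possibly 0.
    Hence the guards [k != 1] throughout. In the hypothesis on orbits the element [h] depends on the
    point, so no equivariance is given in advance: only the norms of both blocks of Phi (for k = 1,
    the first coordinate itself) are known to be constant on orbits. *)

Lemma is_derive_line f x v (t : R) : derivable f (x + t *: v) v ->
  is_derive t 1 (fun s => f (x + s *: v)) ('D_v f (x + t *: v)).
Proof.
move=> df.
have E : (fun h : R => h^-1 *: (((fun s : R => f (x + s *: v)) \o shift t) (h *: 1)
      - f (x + t *: v)))
  = (fun h : R => h^-1 *: ((f \o shift (x + t *: v)) (h *: v) - f (x + t *: v))).
  apply/funext => h /=; congr (_ *: (f _ - _)).
  by rewrite scalerDl addrCA /GRing.scale /= mulr1.
split; first by rewrite /derivable E.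
by rewrite /derive E.
Qed.

Lemma MVT_line f x v : (forall s : R, 0 <= s <= 1 -> derivable f (x + s *: v) v) ->
  exists2 s : R, 0 <= s <= 1 & f (x + v) - f x = 'D_v f (x + s *: v).
Proof.
move=> df.
have d (s : R) : s \in `]0, 1[%R -> is_derive s 1 (fun s => f (x + s *: v))
    ('D_v f (x + s *: v)).
  by rewrite in_itv /= => /andP[? ?]; apply: is_derive_line; apply: df; rewrite !ltW.
have c : {within `[0, 1], continuous (fun s : R => f (x + s *: v))}.
  apply: derivable_within_continuous => s; rewrite in_itv /= => /df ?.
  exact: (@ex_derive _ _ _ _ _ _ _ (is_derive_line _)).
have [s] := MVT_segment ler01 d c.
rewrite in_itv /= => s01; rewrite scale1r scale0r addr0 subr0 mulr1 => e.
by exists s.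
Qed.

(** Homogeneity in the direction holds for a bare directional derivative, by the chain rule on a
    line. Additivity does not, and will require the continuity in [C1_on]. *)
Lemma is_deriveZv f x v (c : R) : derivable f x v ->
  is_derive x (c *: v) f (c * 'D_v f x).
Proof.
move=> df.
have [->|c0] := eqVneq c 0.
  by rewrite scale0r mul0r; apply: is_derive0.
have d0 : derivable f (x + 0 *: v) v by rewrite scale0r addr0.
have h := is_derive_line d0; rewrite scale0r addr0 in h.
have dl : is_derive (0:R) 1 (fun s : R => s * c) c.
  rewrite (_ : (fun s : R => s * c) = (@id R * cst c :> (R -> R)))//.
  by apply: is_derive_eq; rewrite /= scaler0 add0r /GRing.scale /= mulr1.
have h2 : is_derive ((fun s : R => s * c) 0) 1 (fun s => f (x + s *: v)) ('D_v f x).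
  by rewrite /= mul0r.
have := @is_derive1_comp _ _ (fun s : R => s * c) 0 _ _ h2 dl.
have -> : ((fun s => f (x + s *: v)) \o (fun s : R => s * c)) = (fun s => f (x + s *: (c *: v))).
  by apply/funext => s /=; rewrite scalerA.
move=> [h3 h4].
have E : (fun h : R => h^-1 *: (((fun s : R => f (x + s *: (c *: v))) \o shift 0) (h *: 1)
      - f (x + 0 *: (c *: v))))
  = (fun h : R => h^-1 *: ((f \o shift x) (h *: (c *: v)) - f x)).
  apply/funext => h' /=; rewrite scale0r !addr0; congr (_ *: (f _ - _)).
  by rewrite addrC /GRing.scale /= mulr1.
rewrite mulrC; split; first by rewrite /derivable -E.
by rewrite /derive -E.
Qed.

(** This is the regularity that [smooth_on] yields directly; no Frechet differentiability is built
    in. *)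
Definition C1_on (U : set V) (f : V -> R) :=
  forall x, U x -> forall v, derivable f x v /\ {for x, continuous ('D_v f)}.

(** The mean value theorem on the segment from [z] to [z + h v]. The derivative is frozen at [x]
    while the base point [z] moves, so that increments along several directions can be added up. *)
Lemma C1_estimate (U : set V) f x v (e : R) : open U -> C1_on U f -> U x -> 0 < e ->
  exists2 d : R, 0 < d & forall z (h : R), `|z - x| < d -> `|z + h *: v - x| < d ->
   U z /\ `|f (z + h *: v) - f z - h * 'D_v f x| <= e * `|h|.
Proof.
move=> oU c1 Ux e0.
have [_ cv] := c1 x Ux v.
have nU : nbhs x U by apply: open_nbhs_nbhs.
have nD : \forall y \near x, `|'D_v f x - 'D_v f y| < e.
  by move/cvgrPdist_lt: cv; apply.
have [d /= d0 hd] : nbhs_ball x (U `&` [set y | `|'D_v f x - 'D_v f y| < e]).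
  by apply/nbhs_ballP; apply: filterI.
have bd y : `|y - x| < d -> ball x d y by rewrite distrC -ball_normE.
exists d => // z h zx zhx; split; first by case: (hd z (bd z zx)).
have seg (s : R) : 0 <= s <= 1 -> `|z + s *: (h *: v) - x| < d.
  move=> /andP[s0 s1].
  have -> : z + s *: (h *: v) - x = (1 - s) *: (z - x) + s *: (z + h *: v - x).
    rewrite [z + h *: v - x]addrAC [s *: (_ + h *: v)]scalerDr addrA -scalerDl subrK scale1r.
    by rewrite addrAC.
  apply: le_lt_trans (ler_normD _ _) _; rewrite !normrZ.
  rewrite (ger0_norm s0) ger0_norm ?subr_ge0//.
  move: zx zhx; set a := `|z - x|; set b := `|_ + _ - x| => zx zhx.
  have ab : Num.max a b < d by rewrite gt_max zx.
  have am : a <= Num.max a b by rewrite le_max lexx.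
  have bm : b <= Num.max a b by rewrite le_max lexx orbT.
  by apply: le_lt_trans ab; nra.
have Us (s : R) : 0 <= s <= 1 -> (U `&` [set y | `|'D_v f x - 'D_v f y| < e]) (z + s *: (h *: v)).
  by move=> /seg /bd /hd.
have [s s01 ->] : exists2 s : R, 0 <= s <= 1 & f (z + h *: v) - f z = h * 'D_v f (z + s *: (h *: v)).
  have [s /Us[Us' _]|s s01 ->] := @MVT_line f z (h *: v).
    by have [] := is_deriveZv h (c1 _ Us' v).1.
  exists s => //; have [Us' _] := Us _ s01.
  by have [_ ->] := is_deriveZv h (c1 _ Us' v).1.
rewrite -mulrBr normrM mulrC ler_wpM2r// distrC.
by have [_ /ltW] := Us _ s01.
Qed.

(** The increment is made one [v i] at a time, each step being controlled by [C1_estimate] at a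
    shifted base point. *)
Lemma C1_continuous_sum (U : set V) f x n (v : 'I_n -> V) (e : R) :
  open U -> C1_on U f -> U x -> 0 < e ->
  exists2 d : R, 0 < d & forall c : 'I_n -> R, (forall i, `|c i| < d) ->
   `|f (x + \sum_i c i *: v i) - f x - \sum_i c i * 'D_(v i) f x| <= e * \sum_i `|c i|.
Proof.
move=> oU c1 Ux e0; elim: n v => [|n IH] v.
  exists 1 => // c _; rewrite !big_ord0 addr0 subrr subr0 normr0 mulr0 //.
have [d1 d10 h1] := IH (fun i => v (widen_ord (leqnSn n) i)).
have [d2 d20 h2] := C1_estimate (v ord_max) oU c1 Ux e0.
pose M := \sum_i `|v i|.
have M0 : 0 <= M by apply: sumr_ge0.
have M1 : 0 < M + 1 by lra.
(* The second bound keeps the partial sums within [d2] of [x]; [M + 1] stays positive when all the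
   [v i] vanish. *)
exists (Num.min d1 (d2 / (M + 1))).
  by rewrite lt_min d10 divr_gt0.
move=> c hc.
have hc1 i : `|c i| < d1 by have := hc i; rewrite lt_min => /andP[].
have hc2 i : `|c i| < d2 / (M + 1) by have := hc i; rewrite lt_min => /andP[].
have S : \sum_i `|c i *: v i| < d2.
  have [n0|] := ltP 0 M; last first.
    move=> Ml; have Mz : M = 0 by apply/eqP; rewrite eq_le Ml.
    rewrite big1// => i _.
    have : `|v i| = 0 by apply: (psumr_eq0P _ Mz).
    by rewrite normrZ => ->; rewrite mulr0.
  apply: (@le_lt_trans _ _ (d2 / (M + 1) * M)).
    rewrite mulr_sumr; apply: ler_sum => i _; rewrite normrZ ler_wpM2r// ltW//.
  by rewrite mulrAC ltr_pdivrMr// ltr_pM2l// ltrDl.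
pose z := x + \sum_(i < n) c (widen_ord (leqnSn n) i) *: v (widen_ord (leqnSn n) i).
have hz : `|z - x| < d2.
  rewrite /z addrAC subrr add0r; apply: le_lt_trans S.
  apply: le_trans (ler_norm_sum _ _ _) _.
  by rewrite [leRHS]big_ord_recr /= lerDl.
have hz2 : `|z + c ord_max *: v ord_max - x| < d2.
  have -> : z + c ord_max *: v ord_max - x = \sum_i c i *: v i.
    by rewrite big_ord_recr /= /z addrAC [x + _]addrC addrK.
  by apply: le_lt_trans S; apply: ler_norm_sum.
have [_ {}h2] := h2 z (c ord_max) hz hz2.
have {}h1 := h1 (fun i => c (widen_ord (leqnSn n) i)) (fun i => hc1 _).
rewrite !big_ord_recr /= addrA -/z mulrDr.
apply: le_trans (lerD h1 h2).
apply: le_trans (ler_normD _ _); rewrite -/z.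
by rewrite le_eqVlt; apply/orP; left; apply/eqP; congr (`| _ |); ring.
Qed.

Lemma sqr_approx_unique (A B : R) (G : R -> R) :
  (forall e : R, 0 < e -> exists2 d : R, 0 < d & forall h, `|h| < d ->
    `|G h - h * h * A| <= e * (h * h)) ->
  (forall e : R, 0 < e -> exists2 d : R, 0 < d & forall h, `|h| < d ->
    `|G h - h * h * B| <= e * (h * h)) -> A = B.
Proof.
move=> hA hB.
apply/eqP; rewrite -subr_eq0 -normr_le0; apply/ler_addgt0Pl => e e0; rewrite addr0.
have e20 : 0 < e / 2 by rewrite divr_gt0.
have [d1 d10 h1] := hA _ e20; have [d2 d20 h2] := hB _ e20.
have m0 : 0 < Num.min d1 d2 by rewrite lt_min d10.
have [h h0] : exists2 h : R, 0 < h & `|h| < Num.min d1 d2.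
  exists (Num.min d1 d2 / 2); first by rewrite divr_gt0.
  by rewrite gtr0_norm ?divr_gt0// ltr_pdivrMr// ltr_pMr// ltr1n.
rewrite lt_min => /andP[/h1 {}h1 /h2 {}h2].
rewrite -(ler_pM2l (_ : 0 < h * h)) ?mulr_gt0//.
have -> : h * h * `|A - B| = `|h * h * A - h * h * B|.
  by rewrite -mulrBr normrM ger0_norm// mulr_ge0// ltW.
have -> : h * h * e = e / 2 * (h * h) + e / 2 * (h * h) by field.
apply: le_trans (lerD h2 h1); apply: le_trans (ler_normB _ _).
by rewrite le_eqVlt; apply/orP; left; apply/eqP; congr (`| _ |); ring.
Qed.

(** The second difference of [f] with steps [h u] and [h v] is symmetric in [u] and [v]; divided by
    [h^2] it tends to either iterated derivative. *)
Lemma C1_schwarz (U : set V) f x u v : open U -> C1_on U f ->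
  C1_on U ('D_u f) -> C1_on U ('D_v f) -> U x ->
  'D_u ('D_v f) x = 'D_v ('D_u f) x.
Proof.
(* One order of differentiation: the mean value theorem along [a] for [y |-> f (y + h b) - f y],
   then the first-order estimate for ['D_a f] along [b]. *)
have half (a b : V) (e : R) : open U -> C1_on U f -> C1_on U ('D_a f) -> U x ->
  0 < e ->
  exists2 d : R, 0 < d & forall h : R, `|h| < d ->
  `|f (x + h *: a + h *: b) - f (x + h *: a) - f (x + h *: b) + f x
     - h * h * 'D_b ('D_a f) x| <= e * (h * h).
  move=> oU c1 ca Ux e0.
  have [d d0 hd] := C1_estimate b oU ca Ux e0.
  have M0 : 0 < `|a| + `|b| + 1 by rewrite ltr_wpDl// addr_ge0.
  exists (d / (`|a| + `|b| + 1)); first exact: divr_gt0.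
  move=> h; rewrite ltr_pdivlMr// => hh.
  pose g (y : V) := f (y + h *: b) - f y.
  have near (s : R) (j : bool) : 0 <= s <= 1 -> `|x + s *: (h *: a) + (if j then h *: b else 0) - x| < d.
    move=> /andP[s0 s1]; rewrite -(addrA x) [x + _]addrC addrK.
    apply: le_lt_trans (ler_normD _ _) _; rewrite !normrZ (ger0_norm s0).
    apply: le_lt_trans hh.
    have -> : `|h| * (`|a| + `|b| + 1) = `|h| * `|a| + `|h| * `|b| + `|h| by ring.
    have p1 : 0 <= `|h| * `|a| by rewrite mulr_ge0.
    have p2 : 0 <= `|h| * `|b| by rewrite mulr_ge0.
    have p3 : 0 <= `|h| by [].
    have : `|if j then h *: b else 0| <= `|h| * `|b| by case: (j); rewrite ?normrZ ?normr0.
    by nra.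
  have Uj (s : R) j : 0 <= s <= 1 -> U (x + s *: (h *: a) + (if j then h *: b else 0)).
    move=> s01; have zd := near s j s01.
    have [|//] := hd _ 0 zd; rewrite scale0r addr0//.
  have dg (s : R) : 0 <= s <= 1 -> is_derive (x + s *: (h *: a)) (h *: a) g
    (h * ('D_a f (x + s *: (h *: a) + h *: b) - 'D_a f (x + s *: (h *: a)))).
    move=> s01.
    have U1 := Uj s true s01; have U0 := Uj s false s01; rewrite /= addr0 in U1 U0.
    rewrite mulrBr; apply: is_deriveB; last exact: is_deriveZv (c1 _ U0 a).1.
    have [p q] := is_deriveZv h (c1 _ U1 a).1.
    have E : (fun h0 : R => h0^-1 *: (((fun y => f (y + h *: b)) \o shift (x + s *: (h *: a))) (h0 *: (h *: a)) - f (x + s *: (h *: a) + h *: b)))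
      = (fun h0 : R => h0^-1 *: ((f \o shift (x + s *: (h *: a) + h *: b)) (h0 *: (h *: a)) - f (x + s *: (h *: a) + h *: b))).
      by apply/funext => h0 /=; rewrite !addrA.
    by split; rewrite ?/derivable ?/derive E.
  have [s s01 e1] : exists2 s : R, 0 <= s <= 1 & g (x + h *: a) - g x = 'D_(h *: a) g (x + s *: (h *: a)).
    by apply: MVT_line => s /dg[].
  have -> : f (x + h *: a + h *: b) - f (x + h *: a) - f (x + h *: b) + f x = g (x + h *: a) - g x.
    by rewrite /g; ring.
  rewrite e1 (@derive_val _ _ _ _ _ _ _ (dg s s01)).
  have n1 := near s true s01; have n0 := near s false s01; rewrite /= addr0 in n1 n0.
  have [_] := hd _ h n0 n1.
  rewrite -mulrA -mulrBr normrM => /(ler_wpM2l (normr_ge0 h)) => /le_trans; apply.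
  by rewrite mulrCA -normrM ger0_norm// -expr2 sqr_ge0.
move=> oU c1 cu cv Ux.
apply: (sqr_approx_unique (G := fun h => f (x + h *: u + h *: v) - f (x + h *: u)
    - f (x + h *: v) + f x)) => e e0.
  have [d d0 hd] := half v u _ oU c1 cv Ux e0; exists d => // h /hd.
  by rewrite [x + h *: v + h *: u]addrAC [_ - f (x + h *: v) - f _]addrAC.
by have [d d0 hd] := half u v _ oU c1 cu Ux e0; exists d.
Qed.

End Calculus.

Section CalculusRn.
Context {R : realType} {n : nat}.
Implicit Types (f : 'rV[R]_n -> R) (x : 'rV[R]_n).

Lemma C1_differentiable (U : set 'rV[R]_n) f x : open U -> C1_on U f -> U x ->
  differentiable f x.
Proof.
move=> oU c1 Ux.
pose L (v : 'rV[R]_n) := \sum_i v 0 i * 'D_(delta_mx 0 i) f x.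
have Llin : linear L.
  move=> a u v; rewrite /L scaler_sumr -big_split /=; apply: eq_bigr => i _.
  by rewrite !mxE mulrDl /GRing.scale /= mulrA.
pose Lm := GRing.isLinear.Build _ _ _ _ L Llin.
pose Ll : {linear 'rV[R]_n -> R} := HB.pack L Lm.
have cL : continuous (Ll : 'rV[R]_n -> R).
  move=> y; apply: differentiable_continuous.
  have -> : (Ll : 'rV[R]_n -> R) =
      \sum_(i < n) ((fun v : 'rV[R]_n => v 0 i) * cst ('D_(delta_mx 0 i) f x)).
    by apply/funext => v; rewrite fct_sumE.
  apply: differentiable_sum => i; apply: differentiableM => //.
  exact: differentiable_coord.
have D := @diff_unique R 'rV[R]_n R f Ll x cL.
suff key : f \o shift x = cst (f x) + Ll +o_ (0 : 'rV[R]_n) id.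
  by apply/diff_locallyP; rewrite (D key).
apply/eqaddoP => _/posnumP[e].
have n1 : 0 < n%:R + 1 :> R by rewrite ltr_wpDl.
(* The norm of a row vector is its largest coordinate in absolute value, so the [n] coordinate
   increments sum to at most [n |v|]; [n + 1] also covers [n = 0]. *)
have e'0 : 0 < e%:num / (n%:R + 1) by rewrite divr_gt0.
have [d d0 hd] := C1_continuous_sum (fun i : 'I_n => delta_mx 0 i) oU c1 Ux e'0.
have N : nbhs (0 : 'rV[R]_n) [set v : 'rV[R]_n | `|v| < d].
  by apply/nbhs_ballP; exists d => //= v; rewrite -ball_normE /= sub0r normrN.
move: N; apply: filterS => v vd.
have cv i : `|v 0 i| <= `|v| by rewrite [leRHS]mx_normrE; apply: (le_bigmax _ (fun ij => `|v ij.1 ij.2|) (0, i)).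
have {hd} := hd (fun i => v 0 i) (fun i => le_lt_trans (cv i) vd).
rewrite -row_sum_delta => hd.
rewrite -![(_ + _ : _ -> _) _]/(_ + _) -![(- _ : _ -> _) _]/(- _) /=.
rewrite -![(_ + _ : _ -> _) _]/(_ + _) /cst opprD addrA [v + x]addrC.
apply: le_trans hd _.
rewrite mulrAC ler_pdivrMr// -mulrA ler_wpM2l// mulrDr mulr1.
apply: (@le_trans _ _ (\sum_(i < n) `|v|)); first exact: ler_sum.
by rewrite sumr_const card_ord mulr_natr lerDl.
Qed.

End CalculusRn.

(** * Euclidean geometry of row vectors and rotations in a plane *)

Section Dot.
Context {R : realType}.

Definition dot n (u v : 'rV[R]_n) : R := \sum_i u 0 i * v 0 i.

Section DotTheory.
Variable n : nat.
Implicit Types u v w e f : 'rV[R]_n.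

Lemma dotC u v : dot u v = dot v u.
Proof. by apply: eq_bigr => i _; rewrite mulrC. Qed.

Lemma dotDl u v w : dot (u + v) w = dot u w + dot v w.
Proof. by rewrite -big_split; apply: eq_bigr => i _; rewrite mxE mulrDl. Qed.

Lemma dotZl a u v : dot (a *: u) v = a * dot u v.
Proof. by rewrite mulr_sumr; apply: eq_bigr => i _; rewrite mxE mulrA. Qed.

Lemma dotDr u v w : dot u (v + w) = dot u v + dot u w.
Proof. by rewrite !(dotC u) dotDl. Qed.

Lemma dotZr a u v : dot u (a *: v) = a * dot u v.
Proof. by rewrite !(dotC u) dotZl. Qed.

Lemma dotNl u v : dot (- u) v = - dot u v.
Proof. by rewrite -scaleN1r dotZl mulN1r. Qed.

Lemma dotNr u v : dot u (- v) = - dot u v.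
Proof. by rewrite !(dotC u) dotNl. Qed.

Lemma dot0l u : dot 0 u = 0.
Proof. by rewrite -(scale0r 0) dotZl mul0r. Qed.

Lemma dot0r u : dot u 0 = 0.
Proof. by rewrite dotC dot0l. Qed.

Definition dotE := (dotDl, dotDr, dotNl, dotNr, dotZl, dotZr, dot0l, dot0r).

Lemma dot_ge0 u : 0 <= dot u u.
Proof. by apply: sumr_ge0 => i _; rewrite -expr2 sqr_ge0. Qed.

Lemma dot_eq0 u : (dot u u == 0) = (u == 0).
Proof.
apply/eqP/eqP => [h|->]; last exact: dot0l.
apply/rowP => i; rewrite mxE.
have p j : true -> 0 <= u 0 j * u 0 j by rewrite -expr2 sqr_ge0.
have /eqP : u 0 i * u 0 i = 0 by apply: (psumr_eq0P p h).
by rewrite mulf_eq0 orbb => /eqP.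
Qed.

Lemma dot_gt0 u : u != 0 -> 0 < dot u u.
Proof. by move=> u0; rewrite lt_neqAle eq_sym dot_eq0 u0 dot_ge0. Qed.

Lemma dot_outer v e f : v *m (e^T *m f) = dot v e *: f.
Proof.
rewrite mulmxA (_ : v *m e^T = (dot v e)%:M) ?mul_scalar_mx//.
apply/matrixP => i j; rewrite !ord1 !mxE eqxx mulr1n.
by apply: eq_bigr => l _; rewrite mxE.
Qed.

Lemma dot_delta u i : dot u (delta_mx 0 i) = u 0 i.
Proof.
rewrite /dot (bigD1 i)//= big1 ?addr0; first by rewrite mxE !eqxx mulr1.
by move=> j ji; rewrite mxE (negbTE ji) andbF mulr0.
Qed.

Lemma cauchy_schwarz u v : dot u v ^+ 2 <= dot u u * dot v v.
Proof.
have [->|v0] := eqVneq v 0; first by rewrite !dot0r mulr0 expr0n.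
have := dot_ge0 (dot v v *: u - dot u v *: v).
have := dot_gt0 v0; rewrite !dotE (dotC v u).
set a := dot u u; set b := dot u v; set c := dot v v => c0.
have -> : c * (c * a - b * b) + (c * - (b * b) - b * - (b * c)) = c * (a * c - b ^+ 2)
  by ring.
by rewrite pmulr_rge0// subr_ge0.
Qed.

Lemma enormE u : enorm u = Num.sqrt (dot u u).
Proof. by congr Num.sqrt; apply: eq_bigr => i _; rewrite expr2. Qed.

Lemma enorm_sqr u : enorm u ^+ 2 = dot u u.
Proof. by rewrite enormE sqr_sqrtr// dot_ge0. Qed.

Lemma enorm_gt0 u : u != 0 -> 0 < enorm u.
Proof. by move=> u0; rewrite enormE sqrtr_gt0 dot_gt0. Qed.

Lemma enormZ a u : 0 <= a -> enorm (a *: u) = a * enorm u.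
Proof.
by move=> a0; rewrite !enormE !dotE mulrA -expr2 sqrtrM ?sqr_ge0// sqrtr_sqr ger0_norm.
Qed.

End DotTheory.

Lemma dot_mulmx n p (u : 'rV[R]_n) v (A : 'M[R]_(n, p)) : dot (u *m A) v = dot u (v *m A^T).
Proof.
have E q (a b : 'rV[R]_q) : dot a b = (a *m b^T) 0 0.
  by rewrite mxE; apply: eq_bigr => i _; rewrite mxE.
by rewrite !E trmx_mul trmxK mulmxA.
Qed.

Lemma dot_row_mx p q (a c : 'rV[R]_p) (b d : 'rV[R]_q) :
  dot (row_mx a b) (row_mx c d) = dot a c + dot b d.
Proof.
rewrite /dot big_split_ord /=; congr (_ + _); apply: eq_bigr => i _.
  by rewrite !row_mxEl.
by rewrite !row_mxEr.
Qed.

Lemma dot_conformal p q (L : 'M[R]_(p, q)) c :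
  (forall u, dot (u *m L) (u *m L) = c * dot u u) -> L *m L^T = c%:M.
Proof.
move=> h.
have pol u v : dot (u *m L) (v *m L) = c * dot u v.
  have := h (u + v); rewrite mulmxDl !dotE !h (dotC (v *m L)) (dotC v) => e.
  by lra.
apply/row_matrixP => i; apply/rowP => j.
rewrite !rowE -[LHS]dot_delta -[RHS]dot_delta mulmxA dot_mulmx trmxK pol.
by rewrite mul_mx_scalar dotZl.
Qed.

(** [f] is [e] turned by a right angle, so that [cos s e + sin s f] is the great circle through [e]
    with velocity [f]. *)
Definition cpair n (e f : 'rV[R]_n) := dot f f = dot e e /\ dot e f = 0.

Lemma exists_cpair n (e : 'rV[R]_n) : (1 < n)%N -> exists f, cpair e f.
Proof.
move=> n1.
have [e0|e0] := eqVneq e 0.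
  by exists 0; rewrite /cpair e0 dot0l.
have : kermx e^T != 0.
  rewrite -mxrank_eq0 mxrank_ker -lt0n subn_gt0.
  by apply: leq_ltn_trans n1; apply: rank_leq_col.
case/rowV0Pn => f /sub_kermxP fe f0.
have ef : dot e f = 0.
  rewrite dotC; have := congr1 (fun M : 'M[R]_1 => M 0 0) fe; rewrite !mxE => <-.
  by apply: eq_bigr => i _; rewrite mxE.
exists ((enorm e / enorm f) *: f); split; last by rewrite dotZr ef mulr0.
rewrite !dotE -!enorm_sqr; field.
by rewrite gt_eqF// enorm_gt0.
Qed.

Lemma polar n (e y : 'rV[R]_n) : (1 < n)%N -> e != 0 -> dot y y = dot e e ->
  exists s f, cpair e f /\ y = cos s *: e + sin s *: f.
Proof.
move=> n1 e0 ye.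
have ee := dot_gt0 e0.
pose c := dot y e / dot e e.
have c1 : c ^+ 2 <= 1.
  rewrite expr_div_n ler_pdivrMr ?exprn_gt0// mul1r expr2 -[X in _ <= X * _]ye.
  exact: cauchy_schwarz.
have cb : -1 <= c <= 1 by apply/andP; split; nra.
have cosc : cos (acos c) = c by rewrite acosK.
pose z := y - c *: e.
have ez : dot e z = 0.
  by rewrite !dotE (dotC e y) /c; field; rewrite gt_eqF.
have zz : dot z z = (1 - c ^+ 2) * dot e e.
  rewrite !dotE ye (dotC e y).
  have -> : dot y e = c * dot e e by rewrite /c; field; rewrite gt_eqF.
  by ring.
have ss : sin (acos c) ^+ 2 = 1 - c ^+ 2 by rewrite sin2cos2 cosc.
exists (acos c).
(* If the sine vanishes, [y] is [e] or [-e] and no plane is singled out: any partner of [e]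
   serves. *)
have [s0|s0] := eqVneq (sin (acos c)) 0.
  have [f ef] := exists_cpair e n1; exists f; split=> //.
  rewrite s0 scale0r addr0 cosc; apply/eqP; rewrite -subr_eq0 -/z -dot_eq0 zz -ss s0.
  by rewrite expr0n mul0r.
exists ((sin (acos c))^-1 *: z); split; last first.
  by rewrite scalerA divff// scale1r cosc addrC subrK.
split; rewrite ?dotZl !dotZr ?ez ?mulr0//.
by rewrite zz -ss; field.
Qed.

Section Rotation.
Variables (n : nat) (e f : 'rV[R]_n).
Hypotheses (e0 : e != 0) (ef : cpair e f).
Let rho := dot e e.

(** The infinitesimal rotation of the plane of [e] and [f], acting on rows from the right: [e] goes
    to [f], [f] to [-e], and the orthogonal complement to 0. *)
Definition skew2 : 'M[R]_n := rho^-1 *: (e^T *m f - f^T *m e).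

Let rho0 : rho != 0.
Proof. by rewrite /rho gt_eqF// dot_gt0. Qed.

Lemma skew2_tr : skew2^T = - skew2.
Proof.
by rewrite /skew2 linearZ linearB /= !trmx_mul !trmxK -scalerN opprB.
Qed.

Lemma mul_skew2 v : v *m skew2 = rho^-1 *: (dot v e *: f - dot v f *: e).
Proof. by rewrite -scalemxAr mulmxBr !dot_outer. Qed.

Lemma mul_skew2_e : e *m skew2 = f.
Proof. by rewrite mul_skew2 ef.2 scale0r subr0 scalerA mulVf// scale1r. Qed.

Lemma mul_skew2_f : f *m skew2 = - e.
Proof.
by rewrite mul_skew2 dotC ef.2 scale0r sub0r ef.1 scalerN scalerA mulVf// scale1r.
Qed.

(** The exponential of [s skew2] in closed form. *)
Definition rotm (s : R) : 'M[R]_n :=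
  1%:M + ((cos s - 1) / rho) *: (e^T *m e + f^T *m f) + sin s *: skew2.

Lemma mul_rotm v s : v *m rotm s =
  v + ((cos s - 1) * dot v e / rho - sin s * dot v f / rho) *: e
    + ((cos s - 1) * dot v f / rho + sin s * dot v e / rho) *: f.
Proof.
rewrite /rotm !mulmxDr mulmx1 -[v *m (sin s *: _)]scalemxAr mul_skew2 -scalemxAr.
rewrite mulmxDr !dot_outer.
by apply/rowP => i; rewrite !mxE; ring.
Qed.

Lemma rotmD s t : rotm s *m rotm t = rotm (s + t).
Proof.
apply/row_matrixP => i; rewrite !rowE mulmxA; move: (delta_mx 0 i) => v.
rewrite [v *m rotm s]mul_rotm; set w := _ + _ *: f.
have we : dot w e = cos s * dot v e - sin s * dot v f.
  by rewrite /w !dotE [dot f e]dotC ef.2 -/rho; field.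
have wf : dot w f = cos s * dot v f + sin s * dot v e.
  by rewrite /w !dotE ef.2 ef.1 -/rho; field.
rewrite !mul_rotm we wf /w cosD sinD.
by apply/rowP => j; rewrite !mxE; field.
Qed.

Lemma rotm_tr s : (rotm s)^T = rotm (- s).
Proof.
rewrite /rotm !linearD /= tr_scalar_mx [(sin s *: _)^T]linearZ /= skew2_tr.
rewrite !linearZ /= !trmx_mul !trmxK.
by rewrite cosN sinN scalerN scaleNr.
Qed.

Lemma rotm0 : rotm 0 = 1%:M.
Proof. by rewrite /rotm cos0 sin0 subrr mul0r !scale0r !addr0. Qed.

(** The determinant is 1 because the rotation by [s] is the square of the rotation by [s / 2], and
    the determinant of an orthogonal matrix has square 1. *)
Lemma rotm_SO s : SOmx (rotm s).
Proof.
have orth t : rotm t *m (rotm t)^T = 1%:M by rewrite rotm_tr rotmD subrr rotm0.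
split=> //.
have -> : s = s / 2 + s / 2 by lra.
by rewrite -rotmD det_mulmx -[X in _ * X]det_tr -det_mulmx orth det1.
Qed.

Lemma rotm_e s : e *m rotm s = cos s *: e + sin s *: f.
Proof.
by rewrite mul_rotm ef.2 -/rho; apply/rowP => i; rewrite !mxE; field.
Qed.

End Rotation.

Lemma SOmx1 n : SOmx (1%:M : 'M[R]_n).
Proof. by split; rewrite ?det1// trmx1 mulmx1. Qed.

Lemma SO_transitive n (e y : 'rV[R]_n) : (1 < n)%N -> dot y y = dot e e ->
  exists2 A, SOmx A & y = e *m A.
Proof.
move=> n1 ye; have [e0|e0] := eqVneq e 0.
  exists 1%:M; first exact: SOmx1.
  by move/eqP: ye; rewrite e0 dot0l dot_eq0 => /eqP ->; rewrite mul0mx.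
have [s [f [ef ->]]] := polar n1 e0 ye.
by exists (rotm e f s); rewrite ?rotm_e//; apply: rotm_SO.
Qed.

End Dot.

(** * Torus curves and tangent vectors of an orbit *)

Section Curves.
Context {R : realType}.

Lemma is_derive_cosM (a l : R) : is_derive l 1 (fun l => cos (a * l)) (- (a * sin (a * l))).
Proof.
have h : is_derive l 1 (fun l : R => a * l) a.
  rewrite (_ : (fun l : R => a * l) = (a \*: @id R :> (R -> R)))//.
  by apply: is_derive_eq; rewrite /GRing.scale /= mulr1.
have := @is_derive1_comp R cos (fun l : R => a * l) l _ _ (is_derive_cos _) h.
by move=> h2; apply: (is_derive_eq h2); rewrite mulNr mulrC.
Qed.

Lemma is_derive_sinM (a l : R) : is_derive l 1 (fun l => sin (a * l)) (a * cos (a * l)).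
Proof.
have h : is_derive l 1 (fun l : R => a * l) a.
  rewrite (_ : (fun l : R => a * l) = (a \*: @id R :> (R -> R)))//.
  by apply: is_derive_eq; rewrite /GRing.scale /= mulr1.
have := @is_derive1_comp R sin (fun l : R => a * l) l _ _ (is_derive_sin _) h.
by move=> h2; apply: (is_derive_eq h2); rewrite mulrC.
Qed.

Lemma is_derive_scalev (W : normedModType R) (g : R -> R) (w : W) (t dg : R) :
  is_derive t 1 g dg -> is_derive t 1 (fun s => g s *: w) (dg *: w).
Proof.
move=> [d e].
have dif : differentiable g t by apply/derivable1_diffP.
split; first by apply: diff_derivable; apply: differentiableZl.
rewrite deriveE ?diffZl//; last exact: differentiableZl.
by rewrite -e deriveE.
Qed.

Lemma is_derive_chain n (h : 'rV[R]_n -> R) (g : R -> 'rV[R]_n) (t : R) dg :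
  is_derive t 1 g dg -> differentiable h (g t) ->
  is_derive t 1 (h \o g) ('D_dg h (g t)).
Proof.
move=> [d e] dh.
have dif : differentiable g t by apply/derivable1_diffP.
have dc : differentiable (h \o g) t by apply: differentiable_comp.
split; first exact: diff_derivable.
by rewrite deriveE// diff_comp//= -e [in RHS]deriveE// [in RHS]deriveE.
Qed.

Section TorusCurve.
Variables (k m : nat) (e1 e2 : 'rV[R]_k) (f1 f2 : 'rV[R]_m) (a b : R).

(** A curve in the torus spanned by one great circle in each block, with angular speeds [a] and [b].
    The alternatives [a = 0] and [b = 0] in the hypotheses below let one block stand still, as is
    necessary for [k = 1]. *)
Definition tcur (l : R) : 'rV[R]_(k + m) :=
  row_mx (cos (a * l) *: e1 + sin (a * l) *: e2) (cos (b * l) *: f1 + sin (b * l) *: f2).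

Definition tgen : 'M[R]_(k + m) :=
  block_mx (a *: skew2 e1 e2) 0 0 (b *: skew2 f1 f2).

Hypothesis ha : a = 0 \/ (e1 != 0 /\ cpair e1 e2).
Hypothesis hb : b = 0 \/ (f1 != 0 /\ cpair f1 f2).

Let mul1 n (e f : 'rV[R]_n) c (u v : R) : c = 0 \/ (e != 0 /\ cpair e f) ->
  (u *: e + v *: f) *m (c *: skew2 e f) = c *: (u *: f - v *: e).
Proof.
rewrite -scalemxAr; case=> [->|[e0 ef]]; first by rewrite !scale0r.
by rewrite mulmxDl -!scalemxAl mul_skew2_e// mul_skew2_f// scalerN.
Qed.

Lemma tcur_gen l : tcur l *m tgen =
  row_mx (a *: (cos (a * l) *: e2 - sin (a * l) *: e1))
         (b *: (cos (b * l) *: f2 - sin (b * l) *: f1)).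
Proof. by rewrite /tcur /tgen mul_row_block !mulmx0 addr0 add0r !mul1. Qed.

(** Each block moves uniformly on a circle, so the acceleration is radial in each block and hence
    orthogonal to the orbit. *)
Lemma tcur_gen2 l : tcur l *m tgen *m tgen =
  row_mx (- a ^+ 2 *: lsubmx (tcur l)) (- b ^+ 2 *: rsubmx (tcur l)).
Proof.
rewrite tcur_gen /tcur /tgen mul_row_block !mulmx0 addr0 add0r row_mxKl row_mxKr.
have E n (e f : 'rV[R]_n) c u v : c = 0 \/ (e != 0 /\ cpair e f) ->
   (c *: (u *: f - v *: e)) *m (c *: skew2 e f) = - c ^+ 2 *: (u *: e + v *: f).
  move=> h; rewrite -scalemxAl addrC -scaleNr mul1//.
  by apply/rowP => i; rewrite !mxE; ring.
by rewrite !E.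
Qed.

Lemma tcur_derive (l : R) : is_derive l 1 tcur (tcur l *m tgen).
Proof.
have E : tcur = (fun l => cos (a * l) *: row_mx e1 0) + (fun l => sin (a * l) *: row_mx e2 0)
  + (fun l => cos (b * l) *: row_mx 0 f1) + (fun l => sin (b * l) *: row_mx 0 f2).
  apply/funext => t; rewrite /tcur -![(_ + _ : _ -> _) _]/(_ + _).
  by rewrite !scale_row_mx !scaler0 !add_row_mx !addr0 !add0r.
rewrite tcur_gen E.
have c c' := is_derive_scalev _ (is_derive_cosM c' l).
have s c' := is_derive_scalev _ (is_derive_sinM c' l).
have h2 := is_deriveD (is_deriveD (is_deriveD (c _ (row_mx e1 0) a) (s _ (row_mx e2 0) a))
  (c _ (row_mx 0 f1) b)) (s _ (row_mx 0 f2) b).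
apply: (is_derive_eq h2); rewrite !scale_row_mx !scaler0 !add_row_mx !addr0 !add0r.
by congr row_mx; apply/rowP => i; rewrite !mxE; ring.
Qed.

Lemma tcur_orbit l : exists2 g, block_SO g & tcur l = tcur 0 *m g.
Proof.
have E n (e f : 'rV[R]_n) c : c = 0 \/ (e != 0 /\ cpair e f) ->
   exists2 A, SOmx A & cos (c * l) *: e + sin (c * l) *: f =
    (cos (c * 0) *: e + sin (c * 0) *: f) *m A.
  rewrite mulr0 cos0 sin0 scale0r addr0 scale1r.
  case=> [->|[e0 ef]].
    exists 1%:M; first exact: SOmx1.
    by rewrite mul0r cos0 sin0 scale0r addr0 scale1r mulmx1.
  by exists (rotm e f (c * l)); rewrite ?rotm_e//; apply: rotm_SO.
have [A sA eA] := E _ _ _ _ ha; have [B sB eB] := E _ _ _ _ hb.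
exists (block_mx A 0 0 B); first by exists A, B.
by rewrite /tcur eA eB mul_row_block !mulmx0 addr0 add0r.
Qed.

End TorusCurve.

Lemma tcur0 k m (e1 e2 : 'rV[R]_k) (f1 f2 : 'rV[R]_m) a b :
  tcur e1 e2 f1 f2 a b 0 = row_mx e1 f1.
Proof. by rewrite /tcur !mulr0 cos0 sin0 !scale0r !addr0 !scale1r. Qed.

Section Tangent.
Variables k m : nat.
Local Notation V := 'rV[R]_(k + m).

(* Tangency to the orbit of [x]: for [k = 1] the first coordinate is constant on orbits. *)
Definition tang (x w : V) : Prop :=
  (if k == 1%N then lsubmx w = 0 else dot (lsubmx x) (lsubmx w) = 0)
  /\ dot (rsubmx x) (rsubmx w) = 0.

(** For [k = 1] the first block may vanish: the orbit is a sphere in the second block all the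
    same. *)
Definition regular_pt (x : V) := (k != 1%N -> lsubmx x != 0) /\ rsubmx x != 0.

(** A tangent vector is the sum of its two blocks, each a multiple of the velocity of a circle
    inside the orbit, along which [h] is constant. *)
Lemma orbit_derive (h : V -> R) (x w : V) : regular_pt x ->
  differentiable h x -> (forall g, block_SO g -> h (x *m g) = h x) ->
  tang x w -> 'D_w h x = 0.
Proof.
move=> [x1 x2] dh inv [w1 w2].
have lin u v : 'D_(u + v) h x = 'D_u h x + 'D_v h x by rewrite !deriveE// linearD.
have linZ c v : 'D_(c *: v) h x = c * 'D_v h x by rewrite !deriveE// linearZ.
have along e2 f2 a b : a = 0 \/ (lsubmx x != 0 /\ cpair (lsubmx x) e2) ->
    b = 0 \/ (rsubmx x != 0 /\ cpair (rsubmx x) f2) ->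
    'D_(row_mx (a *: e2) (b *: f2)) h x = 0.
  move=> ha hb.
  have d := tcur_derive ha hb 0.
  have dh' : differentiable h (tcur (lsubmx x) e2 (rsubmx x) f2 a b 0).
    by rewrite tcur0 hsubmxK.
  have [_] := is_derive_chain d dh'.
  rewrite tcur_gen// !mulr0 cos0 sin0 !scale0r !subr0 !scale1r tcur0 hsubmxK => <-.
  rewrite (_ : _ \o _ = cst (h x)) ?derive_cst//.
  apply/funext => l /=; have [g bg ->] := tcur_orbit ha hb l.
  by rewrite tcur0 hsubmxK inv.
have normalize n (e v : 'rV[R]_n) : e != 0 -> dot e v = 0 ->
    exists c f, cpair e f /\ v = c *: f \/ v = 0.
  move=> e0 ev; have [->|v0] := eqVneq v 0; first by exists 0, 0; right.
  have ep := enorm_gt0 e0; have vp := enorm_gt0 v0.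
  exists (enorm v / enorm e), ((enorm e / enorm v) *: v); left; split.
    split; rewrite !dotE ?ev ?mulr0// -!enorm_sqr; field; lra.
  by rewrite scalerA (_ : _ * _ = 1) ?scale1r//; field; rewrite !gt_eqF.
rewrite -[w]hsubmxK -[row_mx _ _]addr0.
have -> : row_mx (lsubmx w) (rsubmx w) + 0 = row_mx (lsubmx w) 0 + row_mx 0 (rsubmx w).
  by rewrite addr0 add_row_mx addr0 add0r.
rewrite lin.
have -> : 'D_(row_mx 0 (rsubmx w)) h x = 0.
  have [c [f [[cf ->]|->]]] := normalize _ _ _ x2 w2; last by rewrite row_mx0 derive0.
  have := along 0 f 0 1 (or_introl erefl) (or_intror (conj x2 cf)).
  have -> : row_mx 0 (c *: f) = c *: row_mx (0 *: 0 : 'rV[R]_k) (1 *: f).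
    by rewrite scale_row_mx !scaler0 scale1r.
  by rewrite linZ => ->; rewrite mulr0.
rewrite addr0; case: ifP w1 => [_ ->|k1 w1]; first by rewrite row_mx0 derive0.
have {}x1 : lsubmx x != 0 by apply: x1; rewrite k1.
have [c [f [[cf ->]|->]]] := normalize _ _ _ x1 w1; last by rewrite row_mx0 derive0.
have := along f 0 1 0 (or_intror (conj x1 cf)) (or_introl erefl).
have -> : row_mx (c *: f) 0 = c *: row_mx (1 *: f) (0 *: 0 : 'rV[R]_m).
  by rewrite scale_row_mx !scaler0 scale1r.
by rewrite linZ => ->; rewrite mulr0.
Qed.

End Tangent.
End Curves.

Lemma near_eq_continuous (T U : topologicalType) (f g : T -> U) (x : T) :
  (\forall y \near x, f y = g y) -> {for x, continuous f} -> {for x, continuous g}.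
Proof.
move=> E c; have e := nbhs_singleton E.
change (g y @[y --> x] --> g x); rewrite -e; apply: cvg_trans c.
exact: near_eq_cvg.
Qed.

Section NormedCalculus.
Context {R : realType} {V : normedModType R}.
Implicit Types (f g : V -> R).

Lemma C1_onM (U : set V) f g : open U -> 
  (forall x, U x -> {for x, continuous f}) -> (forall x, U x -> {for x, continuous g}) ->
  C1_on U f -> C1_on U g -> C1_on U (f * g).
Proof.
move=> oU kf kg cf cg x Ux v.
have [df ccf] := cf x Ux v; have [dg ccg] := cg x Ux v.
split; first exact: (derivableM df dg).
have E : \forall y \near x, ((f * 'D_v g) + (g * 'D_v f)) y = 'D_v (f * g) y.
  have : nbhs x U by apply: open_nbhs_nbhs.
  apply: filterS => y Uy.
  by rewrite (deriveM (cf y Uy v).1 (cg y Uy v).1).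
have cfg : {for x, continuous ((f * 'D_v g) + (g * 'D_v f))}.
  exact: (@continuousD R _ _ _ _ _ (@continuousM R _ _ _ _ (kf x Ux) ccg) (@continuousM R _ _ _ _ (kg x Ux) ccf)).
exact: near_eq_continuous E cfg.
Qed.

Lemma cvg_line f (x u : V) : {for x, continuous f} ->
  f (x + h *: u) @[h --> (0:R)^'] --> f x.
Proof.
move=> c; have l : x + h *: u @[h --> (0:R)^'] --> x + (0:R) *: u.
  by apply: cvg_within_filter; apply: cvgD; [exact: cvg_cst|apply: cvgZr_tmp; exact: cvg_id].
rewrite scale0r addr0 in l.
exact: (cvg_comp _ _ l c).
Qed.

Lemma derive_factor (g q : V -> R) (x u : V) : g x = 0 -> {for x, continuous q} ->
  (\forall h \near (0:R)^', g (x + h *: u) = - (h * q (x + h *: u))) ->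
  'D_u g x = - q x.
Proof.
move=> g0 c E.
have c2 : - q (x + h *: u) @[h --> (0:R)^'] --> - q x.
  by apply: (@cvgN R); exact: cvg_line.
apply: cvg_lim => //; apply: cvg_trans c2; apply: near_eq_cvg.
have N0 : \forall h \near (0:R)^', h != 0 by exact: nbhs_dnbhs_neq.
apply: filterS2 E N0 => h e h0.
by rewrite /= g0 subr0 [_ + x]addrC e scalerN scalerA mulVf// scale1r.
Qed.

End NormedCalculus.

(** * The Hessian metric of an invariant norm along an orbit *)

Section HessianOnOrbits.
Context {R : realType} {k m : nat}.
Local Notation V := 'rV[R]_(k + m).
Implicit Types (x u w : V) (F : V -> R).

Lemma derive_mulmx n p (W : normedModType R) (P : 'M[R]_(n, p)) (f : 'rV[R]_p -> W) (x v : 'rV[R]_n) :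
  derive (fun y => f (y *m P)) x v = derive f (x *m P) (v *m P).
Proof.
rewrite /derive (_ : (fun h : R => _) = (fun h : R =>
  h^-1 *: ((f \o shift (x *m P)) (h *: (v *m P)) - f (x *m P))))//.
by apply/funext => h /=; rewrite mulmxDl scalemxAl.
Qed.

Lemma derivable_mulmx n p (W : normedModType R) (P : 'M[R]_(n, p)) (f : 'rV[R]_p -> W) (x v : 'rV[R]_n) :
  derivable f (x *m P) (v *m P) -> derivable (fun y => f (y *m P)) x v.
Proof.
rewrite /derivable => c; rewrite (_ : (fun h : R => _) = (fun h : R =>
  h^-1 *: ((f \o shift (x *m P)) (h *: (v *m P)) - f (x *m P))))//.
by apply/funext => h /=; rewrite mulmxDl scalemxAl.
Qed.

Lemma smooth_C1_on (U : set V) (f : V -> R) vs : smooth_on U f -> C1_on U (iderive f vs).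
Proof.
move=> sf x Ux v; split; first by have [_] := sf vs x Ux; apply.
by have [] := sf (v :: vs) x Ux.
Qed.

Lemma open_punctured : open (~` [set (0 : V)]).
Proof.
apply: closed_openC; apply: accessible_closed_set1; apply: hausdorff_accessible.
exact: norm_hausdorff.
Qed.

Lemma energy_C1 F : minkowski_norm F -> C1_on (~` [set 0]) (energy F).
Proof.
move=> [_ [_ [sF _]]].
have oU := open_punctured.
have c := smooth_C1_on [::] sF.
have -> : energy F = F * (cst (2^-1) * F).
  by apply/funext => y; rewrite /energy /= -![(_ * _ : _ -> _) _]/(_ * _) /cst expr2 -mulrA [_ * 2^-1]mulrC.
have cF y : (~` [set 0]) y -> {for y, continuous F} by move=> /(sF [::])[].
have c2 (r : R) : C1_on (~` [set (0 : V)]) (cst r).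
  move=> x Ux v; split=> //.
  rewrite (_ : 'D_v _ = cst 0); first exact: cst_continuous.
  by apply/funext => y; apply: derive_cst.
have cc y : (~` [set 0]) y -> {for y, continuous (cst (2^-1) : V -> R)}.
  by move=> _; apply: cst_continuous.
have c3 : C1_on (~` [set (0 : V)]) (cst 2^-1 * F).
  exact: (C1_onM oU cc cF (c2 _) c).
have cF2 y : (~` [set 0]) y -> {for y, continuous (cst 2^-1 * F : V -> R)}.
  by move=> Uy; apply: (@continuousM R _ _ _ _ (cc y Uy) (cF y Uy)).
exact: (C1_onM oU cF cF2 c c3).
Qed.

(** [alpha] and [beta] are the coefficients in [dE = alpha <x', .> + beta <x'', .>], found by
    evaluating [dE] on the radial vector of each block. For [k = 1] the formula is applied to
    vectors with zero first block. *)
Definition alpha F x : R :=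
  'D_(row_mx (lsubmx x) 0) (energy F) x / dot (lsubmx x) (lsubmx x).
Definition beta F x : R :=
  'D_(row_mx 0 (rsubmx x)) (energy F) x / dot (rsubmx x) (rsubmx x).

Lemma regular_neq0 x : regular_pt x -> x != 0.
Proof. by move=> [_]; apply: contra => /eqP ->; rewrite linear0. Qed.

Lemma near_regular x u : regular_pt x -> \forall h \near 0, regular_pt (x + h *: u).
Proof.
move=> [x1 x2].
have E n (e v : 'rV[R]_n) : e != 0 -> \forall h \near (0:R), e + h *: v != 0.
  move=> e0; have d := dot_gt0 e0.
  have c : dot e e + h * dot v e @[h --> (0:R)] --> dot e e.
    rewrite -[X in _ --> X]addr0 -[X in _ + X](mul0r (dot v e)).
    by apply: cvgD; [exact: cvg_cst|apply: cvgMl].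
  have c2 : \forall h \near (0:R), 0 < dot e e + h * dot v e.
    exact: (cvgr_gt (dot e e) c).
  move: c2; apply: filterS => h hp.
  apply/eqP => z; have : dot (e + h *: v) e = 0 by rewrite z dot0l.
  by rewrite !dotE => q; rewrite q ltxx in hp.
have h2 := E _ _ (rsubmx u) x2.
have [k1|k1] := eqVneq k 1%N.
  by move: h2; apply: filterS => h hh; split; [move=> /eqP|rewrite linearD linearZ].
have h1 := E _ _ (lsubmx u) (x1 k1).
apply: filterS2 h1 h2 => h ? ?.
by split; rewrite linearD linearZ.
Qed.

Lemma energy_inv F g x : G_invariant_fun F -> block_SO g -> energy F (x *m g) = energy F x.
Proof. by move=> iF bg; rewrite /energy iF. Qed.

Lemma energy_differentiable F x : minkowski_norm F -> x != 0 -> differentiable (energy F) x.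
Proof.
move=> mF x0; apply: (C1_differentiable _ (energy_C1 mF)); last by apply/eqP.
exact: open_punctured.
Qed.

Lemma energy_tang F x w : minkowski_norm F -> G_invariant_fun F -> regular_pt x ->
  tang x w -> 'D_w (energy F) x = 0.
Proof.
move=> mF iF rx; apply: orbit_derive => //.
  by apply: energy_differentiable => //; apply: regular_neq0.
by move=> g bg; apply: energy_inv.
Qed.

(** Once its radial parts in both blocks are removed, [z] is tangent to the orbit, where [dE]
    vanishes. *)
Lemma energy_derive F x z : minkowski_norm F -> G_invariant_fun F -> regular_pt x ->
  (k == 1%N -> lsubmx z = 0) ->
  'D_z (energy F) x = alpha F x * dot (lsubmx x) (lsubmx z) + beta F x * dot (rsubmx x) (rsubmx z).
Proof.
move=> mF iF rx z1.
have dE := energy_differentiable mF (regular_neq0 rx).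
have x2 : dot (rsubmx x) (rsubmx x) != 0 by rewrite dot_eq0 rx.2.
pose a := dot (lsubmx x) (lsubmx z) / dot (lsubmx x) (lsubmx x).
pose b := dot (rsubmx x) (rsubmx z) / dot (rsubmx x) (rsubmx x).
pose w := z - a *: row_mx (lsubmx x) 0 - b *: row_mx 0 (rsubmx x).
have ew : w = row_mx (lsubmx z - a *: lsubmx x) (rsubmx z - b *: rsubmx x).
  rewrite /w -{1}[z]hsubmxK !scale_row_mx !scaler0 !opp_row_mx !add_row_mx.
  by rewrite !oppr0 !addr0.
have tw : tang x w.
  rewrite /tang ew row_mxKl row_mxKr.
  split; last by rewrite !dotE /b; field.
  case: ifP => [k1|k1]; first by rewrite /a z1// dot0r mul0r scale0r subr0.
  have x1 : dot (lsubmx x) (lsubmx x) != 0 by rewrite dot_eq0 rx.1// k1.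
  by rewrite !dotE /a; field.
have ez : z = w + (a *: row_mx (lsubmx x) 0 + b *: row_mx 0 (rsubmx x)).
  by rewrite /w addrA addrAC subrK subrK.
have lin u v : 'D_(u + v) (energy F) x = 'D_u (energy F) x + 'D_v (energy F) x
  by rewrite !deriveE// linearD.
have linZ c v : 'D_(c *: v) (energy F) x = c * 'D_v (energy F) x
  by rewrite !deriveE// linearZ.
clearbody w; rewrite {1}ez lin (energy_tang mF iF rx tw) add0r lin !linZ /alpha /beta.
rewrite /a /b.
have [k1|k1] := eqVneq k 1%N.
  by rewrite z1 ?k1// dot0r mul0r mulr0 mul0r; field.
have x1 : dot (lsubmx x) (lsubmx x) != 0 by rewrite dot_eq0 rx.1.
by field; apply/andP.
Qed.

Lemma mul_block_diag x (A : 'M[R]_k) (B : 'M[R]_m) :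
  x *m block_mx A 0 0 B = row_mx (lsubmx x *m A) (rsubmx x *m B).
Proof. by rewrite -{1}[x]hsubmxK mul_row_block !mulmx0 addr0 add0r. Qed.

Definition block_skew (A : 'M[R]_(k + m)) := exists (A1 : 'M[R]_k) (A2 : 'M[R]_m),
  [/\ A = block_mx A1 0 0 A2, A1^T = - A1 & A2^T = - A2].

Lemma dot_skew n (A : 'M[R]_n) (u v : 'rV[R]_n) : A^T = - A ->
  dot u (v *m A) = - dot (u *m A) v.
Proof. by move=> h; rewrite [in RHS]dot_mulmx h mulmxN dotNr opprK. Qed.

Lemma skew_mx11 (A : 'M[R]_k) : k == 1%N -> A^T = - A -> A = 0.
Proof.
move=> /eqP k1 h; apply/matrixP => i j.
have ij : i = j by apply/val_inj; case: (i) (j) => [a ?] [b ?] /=; lia.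
have := congr1 (fun M : 'M[R]_k => M i j) h; rewrite !mxE ij => e.
by lra.
Qed.

Lemma tang_skew x A : block_skew A -> tang x (x *m A).
Proof.
move=> [A1 [A2 [-> s1 s2]]].
have d n (B : 'M[R]_n) (u : 'rV[R]_n) : B^T = - B -> dot u (u *m B) = 0.
  by move=> sB; have := dot_skew u u sB; rewrite dotC => e; lra.
rewrite /tang mul_block_diag row_mxKl row_mxKr.
rewrite !d//; split=> //; case: ifP => // k1.
by rewrite (skew_mx11 k1 s1) mulmx0.
Qed.

(** Every tangent vector thus extends to a field [y |-> y A] that is tangent to all orbits at
    once. *)
Lemma tang_exists_skew x w : regular_pt x -> tang x w ->
  exists2 A, block_skew A & w = x *m A.
Proof.
move=> [x1 x2] [w1 w2].
exists (block_mx (skew2 (lsubmx x) (lsubmx w)) 0 0 (skew2 (rsubmx x) (rsubmx w))).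
  by do 2!eexists; split; first reflexivity; apply: skew2_tr.
rewrite mul_block_diag.
have E n (e f : 'rV[R]_n) : e != 0 -> dot e f = 0 -> e *m skew2 e f = f.
  by move=> e0 ef; rewrite mul_skew2 ef scale0r subr0 scalerA mulVf ?scale1r// dot_eq0.
have -> : rsubmx x *m skew2 (rsubmx x) (rsubmx w) = rsubmx w by rewrite E.
rewrite -{1}[w]hsubmxK; congr row_mx.
case: ifP w1 => [_ ->|k1 ?]; last by rewrite E ?x1 ?k1.
by rewrite mul_skew2 !dot0r scaler0 scale0r subrr scaler0.
Qed.

(** Write [w = x A] with [A] block-skew. At regular [y] the derivative of the energy along [y A] is
    0; differentiating this along [u] at [x] gives [D_u D_w E = - D_(uA) E], and [energy_derive]
    computes the right side. As [u] is arbitrary, this covers both the metric of the orbit and its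
    orthogonal complement. *)
Lemma hess_tang F x u w : minkowski_norm F -> G_invariant_fun F -> regular_pt x ->
  tang x w -> hess_metric F x u w =
    alpha F x * dot (lsubmx u) (lsubmx w) + beta F x * dot (rsubmx u) (rsubmx w).
Proof.
move=> mF iF rx tw.
have [A sA wA] := tang_exists_skew rx tw.
have c : {for x, continuous ('D_(u *m A) (energy F))}.
  by have [] := energy_C1 mF (x := x) (elimN eqP (regular_neq0 rx)) (u *m A).
have E : \forall h \near (0:R)^', 'D_w (energy F) (x + h *: u) =
    - (h * 'D_(u *m A) (energy F) (x + h *: u)).
  have N : \forall h \near (0:R)^', regular_pt (x + h *: u).
    exact: cvg_within (near_regular u rx).
  move: N; apply: filterS => h rh.
  have dE := energy_differentiable mF (regular_neq0 rh).
  have -> : w = (x + h *: u) *m A - h *: (u *m A).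
    by rewrite mulmxDl -scalemxAl addrK.
  have -> : 'D_((x + h *: u) *m A - h *: (u *m A)) (energy F) (x + h *: u) =
     'D_((x + h *: u) *m A) (energy F) (x + h *: u) - h * 'D_(u *m A) (energy F) (x + h *: u).
    by rewrite !deriveE// linearB linearZ.
  by rewrite (energy_tang mF iF rh (tang_skew _ sA)) sub0r.
rewrite /hess_metric (@derive_factor _ _ ('D_w (energy F)) ('D_(u *m A) (energy F)) x u
  (energy_tang mF iF rx tw) c E).
have [A1 [A2 [eA s1 s2]]] := sA.
have uA : u *m A = row_mx (lsubmx u *m A1) (rsubmx u *m A2).
  by rewrite eA mul_block_diag.
have xA : w = row_mx (lsubmx x *m A1) (rsubmx x *m A2).
  by rewrite wA eA mul_block_diag.
rewrite energy_derive// uA; last first.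
  by move=> k1; rewrite row_mxKl (skew_mx11 k1 s1) mulmx0.
rewrite xA !row_mxKl !row_mxKr (dot_skew (lsubmx x) _ s1) (dot_skew (rsubmx x) _ s2).
by rewrite (dotC (lsubmx u)) (dotC (rsubmx u)); ring.
Qed.

Lemma alpha_inv F x g : G_invariant_fun F -> block_SO g -> alpha F (x *m g) = alpha F x.
Proof.
move=> iF bg; have [A [B [[oA _] [[oB _] eg]]]] := bg.
have E : lsubmx (x *m g) = lsubmx x *m A by rewrite eg mul_block_diag row_mxKl.
rewrite /alpha !E dot_mulmx -mulmxA oA mulmx1; congr (_ / _).
have -> : row_mx (lsubmx x *m A) 0 = row_mx (lsubmx x) 0 *m g.
  by rewrite eg mul_block_diag row_mxKl row_mxKr mul0mx.
rewrite -(derive_mulmx g (energy F)) (_ : (fun y => _) = energy F)//.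
by apply/funext => y; apply: energy_inv.
Qed.

Lemma beta_inv F x g : G_invariant_fun F -> block_SO g -> beta F (x *m g) = beta F x.
Proof.
move=> iF bg; have [A [B [[oA _] [[oB _] eg]]]] := bg.
have E : rsubmx (x *m g) = rsubmx x *m B by rewrite eg mul_block_diag row_mxKr.
rewrite /beta !E dot_mulmx -mulmxA oB mulmx1; congr (_ / _).
have -> : row_mx 0 (rsubmx x *m B) = row_mx 0 (rsubmx x) *m g.
  by rewrite eg mul_block_diag row_mxKl row_mxKr mul0mx.
rewrite -(derive_mulmx g (energy F)) (_ : (fun y => _) = energy F)//.
by apply/funext => y; apply: energy_inv.
Qed.

(** The Hessian metric on a tangent vector [(0, f)] is [beta |f|^2], and [1 < m] provides a nonzero
    [f]. *)
Lemma beta_gt0 F x : (1 < m)%N -> minkowski_norm F -> G_invariant_fun F -> regular_pt x ->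
  0 < beta F x.
Proof.
move=> m1 mF iF rx.
have [f cf] := exists_cpair (rsubmx x) m1.
have f0 : dot f f > 0 by rewrite cf.1 dot_gt0// rx.2.
have tw : tang x (row_mx 0 f).
  by rewrite /tang row_mxKl row_mxKr cf.2 dot0r; case: ifP.
have [_ [_ [_ [_ [_ pos]]]]] := mF.
have := pos x (row_mx 0 f) (regular_neq0 rx).
rewrite hess_tang// row_mxKl row_mxKr dot0r mulr0 add0r pmulr_lgt0//; apply.
apply/eqP => e; move: f0.
by rewrite -[f](row_mxKr (0 : 'rV_k)) e linear0 dot0l ltxx.
Qed.

Lemma alpha_gt0 F x : (1 < k)%N -> minkowski_norm F -> G_invariant_fun F -> regular_pt x ->
  0 < alpha F x.
Proof.
move=> k1 mF iF rx.
have kn : k != 1%N by rewrite gtn_eqF.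
have [f cf] := exists_cpair (lsubmx x) k1.
have f0 : dot f f > 0 by rewrite cf.1 dot_gt0// rx.1.
have tw : tang x (row_mx f 0).
  by rewrite /tang row_mxKl row_mxKr cf.2 dot0r (negbTE kn).
have [_ [_ [_ [_ [_ pos]]]]] := mF.
have := pos x (row_mx f 0) (regular_neq0 rx).
rewrite hess_tang// row_mxKl row_mxKr dot0r mulr0 addr0 pmulr_lgt0//; apply.
apply/eqP => e; move: f0.
by rewrite -[f](row_mxKl _ (0 : 'rV_m)) e linear0 dot0l ltxx.
Qed.

End HessianOnOrbits.

(** * Vector-valued maps and push-forwards of linear fields *)

Section VectorCalculus.
Context {R : realType} {n p : nat}.
Local Notation V := 'rV[R]_n.
Local Notation W := 'rV[R]_p.
Implicit Types (U : set V) (f g : V -> W) (x u v w : V).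

Lemma derive_coord f x v j : derivable f x v ->
  'D_v (fun y => f y 0 j) x = ('D_v f x) 0 j.
Proof. by move=> d; rewrite (derive_mx d) mxE. Qed.

Definition C1v U f := (forall x, U x -> forall v, derivable f x v) /\
  forall j, C1_on U (fun y => f y 0 j).

Lemma smooth_C1v U f vs : open U -> smooth_on U f -> C1v U (iderive f vs).
Proof.
move=> oU sf; have d x v : U x -> derivable (iderive f vs) x v.
  by move=> Ux; have [_] := sf vs x Ux; apply.
split=> [x Ux v|j x Ux v]; first exact: d.
have dx := d x v Ux; split; first exact: (derivable_mxP _ _ _).1.
have [c _] := sf (v :: vs) x Ux.
have c' : {for x, continuous (fun y => iderive f (v :: vs) y 0 j)}.
  exact: (cvg_comp _ _ c (@coord_continuous R 1 p 0 j _)).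
apply: near_eq_continuous c'.
have : nbhs x U by apply: open_nbhs_nbhs.
apply: filterS => y Uy; exact: esym (derive_coord j (d y v Uy)).
Qed.

Definition jac f x : 'M[R]_(n, p) := \matrix_(i, j) ('D_(delta_mx 0 i) f x) 0 j.

Lemma C1v_jac U f x u : open U -> C1v U f -> U x -> 'D_u f x = u *m jac f x.
Proof.
move=> oU [d c1] Ux; apply/rowP => j; rewrite -(derive_coord j (d x Ux u)).
have df := C1_differentiable oU (c1 j) Ux.
rewrite deriveE// {1}[u]row_sum_delta linear_sum mxE; apply: eq_bigr => i _.
by rewrite linearZ mxE -(derive_coord j (d x Ux (delta_mx 0 i))) deriveE.
Qed.

(** Differentiability is recorded coordinate by coordinate, so that the scalar product rule applies
    to [dot]. *)
Definition vdiff f x w (df : W) := forall j,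
  differentiable (fun y => f y 0 j) x /\ 'D_w (fun y => f y 0 j) x = df 0 j.

Lemma C1v_vdiff U f x w : open U -> C1v U f -> U x -> vdiff f x w ('D_w f x).
Proof.
move=> oU [d c1] Ux j; split; first exact: C1_differentiable oU (c1 j) Ux.
exact: derive_coord j (d x Ux w).
Qed.

Lemma C1_on_eq U (f g : V -> R) : open U -> (forall y, U y -> f y = g y) ->
  C1_on U f -> C1_on U g.
Proof.
move=> oU e c x Ux v; have [d cc] := c x Ux v.
have N y : U y -> \forall z \near y, f z = g z.
  move=> Uy; have : nbhs y U by apply: open_nbhs_nbhs.
  by apply: filterS.
split; first exact: (@near_eq_derivable _ _ _ f g x v (N x Ux) d).
apply: near_eq_continuous cc.
have : nbhs x U by apply: open_nbhs_nbhs.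
by apply: filterS => y Uy; exact: (@near_eq_derive _ _ _ f g y v (N y Uy)).
Qed.

Lemma smooth_schwarz U f x u v : open U -> smooth_on U f -> U x ->
  'D_u ('D_v f) x = 'D_v ('D_u f) x.
Proof.
move=> oU sf Ux.
have cs vs := smooth_C1v vs oU sf.
apply/rowP => j.
have c1 w : C1_on U ('D_w (fun y => f y 0 j)).
  apply: C1_on_eq oU _ ((cs [:: w]).2 j) => y Uy.
  exact: esym (derive_coord j ((cs [::]).1 y Uy w)).
have L a b : 'D_a ('D_b (fun y => f y 0 j)) x = ('D_a ('D_b f) x) 0 j.
  have d : derivable ('D_b f) x a by apply: (cs [:: b]).1.
  rewrite -(derive_coord j d); apply: near_eq_derive => //.
  have : nbhs x U by apply: open_nbhs_nbhs.
  apply: filterS => y Uy; exact: derive_coord j ((cs [::]).1 y Uy b).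
have S := C1_schwarz oU ((cs [::]).2 j) (c1 u) (c1 v) Ux.
exact: (etrans (esym (L u v)) (etrans S (L v u))).
Qed.

Lemma vdiff_dot f g x w df dg : vdiff f x w df -> vdiff g x w dg ->
  differentiable (fun y => dot (f y) (g y)) x /\
  'D_w (fun y => dot (f y) (g y)) x = dot df (g x) + dot (f x) dg.
Proof.
move=> hf hg.
have E : (fun y => dot (f y) (g y)) =
    \sum_(j < p) ((fun y => f y 0 j) * (fun y => g y 0 j)).
  by apply/funext => y; rewrite fct_sumE.
split.
  by rewrite E; apply: differentiable_sum => j; apply: differentiableM; [exact: (hf j).1|exact: (hg j).1].
rewrite E derive_sum; last first.
  by move=> j; apply: diff_derivable; apply: differentiableM; [exact: (hf j).1|exact: (hg j).1].
rewrite /dot -big_split; apply: eq_bigr => j _ /=.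
have [d1 e1] := hf j; have [d2 e2] := hg j.
rewrite (deriveM (diff_derivable d1) (diff_derivable d2)) e1 e2 /GRing.scale /=.
by rewrite addrC [df 0 j * _]mulrC.
Qed.

Lemma vdiff_mulmx (B : 'M[R]_(n, p)) x w : vdiff (fun y => y *m B) x w (w *m B).
Proof.
move=> j.
have E : (fun y : V => (y *m B) 0 j) = \sum_(i < n) ((fun y : V => y 0 i) * cst (B i j)).
  by apply/funext => y; rewrite fct_sumE mxE.
have d i : differentiable ((fun y : V => y 0 i) * cst (B i j)) x.
  by apply: differentiableM => //; apply: differentiable_coord.
have dif : differentiable (fun y : V => (y *m B) 0 j) x.
  by rewrite E; apply: differentiable_sum.
split=> //.
rewrite /derive (_ : (fun h : R => _) =
   (fun h : R => h^-1 *: (h * (w *m B) 0 j))); last first.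
  by apply/funext => h /=; rewrite mulmxDl -scalemxAl !mxE addrK.
apply: cvg_lim => //.
have N0 : \forall h \near (0:R)^', h != 0 by exact: nbhs_dnbhs_neq.
apply: cvg_near_cst; apply: filterS N0 => h h0.
by rewrite /GRing.scale /= mulrA mulVf// mul1r.
Qed.

End VectorCalculus.

Section Fields.
Context {R : realType} {n : nat}.
Local Notation V := 'rV[R]_n.
Variables (U : set V) (f : V -> V).
Hypotheses (oU : open U) (sf : smooth_on U f).
Implicit Types (x u v w : V) (B : 'M[R]_n).

(** The push-forward under [f] of the field [y |-> y B], as a function on the source. The Jacobian
    makes it a product to which the product rule applies. *)
Definition lfield B (y : V) : V := y *m B *m jac f y.

Lemma lfieldE B x : U x -> lfield B x = 'D_(x *m B) f x.
Proof. by move=> Ux; rewrite (C1v_jac _ oU (smooth_C1v [::] oU sf) Ux). Qed.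

(** Symmetry of second derivatives identifies the derivative of the Jacobian factor with a second
    derivative of [f] in which the direction [x B] is held fixed. *)
Lemma vdiff_lfield B x w : U x ->
  vdiff (lfield B) x w ('D_w ('D_(x *m B) f) x + 'D_(w *m B) f x).
Proof.
move=> Ux j.
have cs vs := smooth_C1v vs oU sf.
pose G (y : V) : V := \row_i ('D_(delta_mx 0 i) f y) 0 j.
have E : (fun y => lfield B y 0 j) = (fun y => dot (y *m B) (G y)).
  by apply/funext => y; rewrite mxE; apply: eq_bigr => i _; rewrite !mxE.
have hG : vdiff G x w (\row_i ('D_w ('D_(delta_mx 0 i) f) x) 0 j).
  move=> i; rewrite mxE.
  have -> : (fun y => G y 0 i) = (fun y => ('D_(delta_mx 0 i) f y) 0 j).
    by apply/funext => y; rewrite mxE.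
  exact: (C1v_vdiff w oU (cs [:: delta_mx 0 i]) Ux j).
rewrite E; have [d ->] := vdiff_dot (vdiff_mulmx B x w) hG; split=> //.
rewrite mxE addrC; congr (_ + _); last first.
  rewrite (smooth_schwarz w (x *m B) oU sf Ux).
  rewrite (C1v_jac (x *m B) oU (cs [:: w]) Ux) mxE.
  by apply: eq_bigr => i _; rewrite !mxE (smooth_schwarz w (delta_mx 0 i) oU sf Ux).
rewrite (C1v_jac (w *m B) oU (cs [::]) Ux) mxE.
by apply: eq_bigr => i _; rewrite !mxE.
Qed.

End Fields.

(** * Tangent and normal spaces of orbits *)

Section OrbitGeometry.
Context {R : realType} {k m : nat}.
Local Notation V := 'rV[R]_(k + m).
Implicit Types (x u v w y : V).

Lemma SO_dot n (A : 'M[R]_n) (u v : 'rV[R]_n) : SOmx A -> dot (u *m A) (v *m A) = dot u v.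
Proof. by move=> [oA _]; rewrite dot_mulmx -mulmxA oA mulmx1. Qed.

Lemma block_SO_dotl x g : block_SO g ->
  dot (lsubmx (x *m g)) (lsubmx (x *m g)) = dot (lsubmx x) (lsubmx x).
Proof. by move=> [A [B [sA [sB ->]]]]; rewrite mul_block_diag row_mxKl SO_dot. Qed.

Lemma block_SO_dotr x g : block_SO g ->
  dot (rsubmx (x *m g)) (rsubmx (x *m g)) = dot (rsubmx x) (rsubmx x).
Proof. by move=> [A [B [sA [sB ->]]]]; rewrite mul_block_diag row_mxKr SO_dot. Qed.

Lemma block_SO_l1 x g : k == 1%N -> block_SO g -> lsubmx (x *m g) = lsubmx x.
Proof.
move=> k1 [A [B [[_ dA] [sB ->]]]]; rewrite mul_block_diag row_mxKl.
suff -> : A = 1%:M by rewrite mulmx1.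
clear -k1 dA; move: A dA; rewrite (eqP k1) => A.
rewrite det_mx11 => e; apply/matrixP => i j; rewrite !ord1 e !mxE eqxx //.
Qed.

Definition oform (a b : R) u v := a * dot (lsubmx u) (lsubmx v) + b * dot (rsubmx u) (rsubmx v).

Lemma oformBl a b u v w : oform a b (u - v) w = oform a b u w - oform a b v w.
Proof. by rewrite /oform !linearB /= !dotE; ring. Qed.

Lemma oformC a b u v : oform a b u v = oform a b v u.
Proof. by rewrite /oform (dotC (lsubmx u)) (dotC (rsubmx u)). Qed.

(** In each block [v] is paired with its own component orthogonal to [y]; the result is a nonzero
    multiple of the squared length of that component, which therefore vanishes. *)
Lemma oform_radial a b y v : (k != 1%N -> a != 0) -> b != 0 -> regular_pt y ->
  (forall w, tang y w -> oform a b v w = 0) ->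
  (k != 1%N -> exists c, lsubmx v = c *: lsubmx y) /\ exists c, rsubmx v = c *: rsubmx y.
Proof.
move=> a0 b0 [y1 y2] h.
have E n (e z : 'rV[R]_n) : e != 0 -> let w := z - (dot z e / dot e e) *: e in
    dot e w = 0 /\ dot z w = dot w w.
  move=> e0 w; have ee : dot e e != 0 by rewrite dot_eq0.
  have ew : dot e w = 0 by rewrite /w !dotE (dotC e z); field.
  split=> //.
  have -> : dot w w = dot z w - dot z e / dot e e * dot e w by rewrite -dotZl -dotNl -dotDl.
  by rewrite ew mulr0 subr0.
have Z n (e z : 'rV[R]_n) : e != 0 -> dot z (z - (dot z e / dot e e) *: e) = 0 ->
    exists c, z = c *: e.
  move=> e0; have [_ ->] := E _ _ z e0; move/eqP; rewrite dot_eq0 subr_eq0 => /eqP e1.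
  by exists (dot z e / dot e e).
split=> [k1|].
  have [e1 _] := E _ _ (lsubmx v) (y1 k1).
  apply: Z; first exact: y1.
  have := h (row_mx (lsubmx v - (dot (lsubmx v) (lsubmx y) / dot (lsubmx y) (lsubmx y)) *: lsubmx y) 0).
  rewrite /tang /oform row_mxKl row_mxKr !dot0r mulr0 addr0 (negbTE k1) e1 => /(_ (conj erefl erefl))/eqP.
  by rewrite mulf_eq0 (negbTE (a0 k1)) => /eqP.
have [e1 _] := E _ _ (rsubmx v) y2.
apply: Z => //.
have := h (row_mx 0 (rsubmx v - (dot (rsubmx v) (rsubmx y) / dot (rsubmx y) (rsubmx y)) *: rsubmx y)).
rewrite /tang /oform row_mxKl row_mxKr !dot0r mulr0 add0r e1.
have t : (if k == 1%N then (0 : 'rV[R]_k) = 0 else (0 : R) = 0) by case: ifP.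
by move=> /(_ (conj t erefl))/eqP; rewrite mulf_eq0 (negbTE b0) => /eqP.
Qed.

(** The rows span the normal directions, so its kernel counts the dimension of the orbit. For
    [k = 1] the first row is a basis vector in place of [x'], which may be 0. *)
Definition normals x : 'M[R]_(1 + 1, k + m) :=
  col_mx (row_mx (if k == 1%N then const_mx 1 else lsubmx x) 0) (row_mx 0 (rsubmx x)).

Lemma normals_rank x : (0 < k)%N -> regular_pt x -> \rank (normals x) = 2%N.
Proof.
move=> k0 [x1 x2]; apply/eqP; change (row_free (normals x)).
rewrite -kermx_eq0; apply/rowV0P => v /sub_kermxP.
rewrite -[v]hsubmxK /normals mul_row_col !mul_mx_row !mulmx0 add_row_mx addr0 add0r.
rewrite -row_mx0 => /eq_row_mx[e1 e2].
have Z n (e : 'rV[R]_n) (a : 'M[R]_1) : e != 0 -> a *m e = 0 -> a = 0.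
  move=> e0; rewrite [a]mx11_scalar mul_scalar_mx => /eqP.
  by rewrite scaler_eq0 (negbTE e0) orbF => /eqP ->; rewrite -scalemx1 scale0r.
rewrite (Z _ _ _ x2 e2) (Z _ _ _ _ e1) ?row_mx0//.
case: ifP => [k1|k1]; last by rewrite x1// k1.
apply/eqP => /rowP/(_ (Ordinal k0)); rewrite !mxE => /eqP.
by rewrite oner_eq0.
Qed.

Lemma dot0P n (u v : 'rV[R]_n) : (u *m v^T = 0) <-> dot u v = 0.
Proof.
have E : u *m v^T = (dot u v)%:M.
  apply/matrixP => i j; rewrite !ord1 !mxE eqxx mulr1n.
  by apply: eq_bigr => l _; rewrite mxE.
rewrite E; split=> [/matrixP/(_ 0 0)|->]; first by rewrite !mxE eqxx mulr1n.
by rewrite -scalemx1 scale0r.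
Qed.

Lemma tang_normals x w : tang x w <-> w *m (normals x)^T = 0.
Proof.
rewrite /normals tr_col_mx !tr_row_mx !trmx0 -{2}[w]hsubmxK mul_mx_row !mul_row_col.
rewrite !mulmx0 addr0 add0r /tang; split.
  case=> h1 h2; rewrite -row_mx0; congr row_mx; last by apply/dot0P; rewrite dotC.
  by case: ifP h1 => [_ ->|_]; rewrite ?mul0mx// dotC => /dot0P.
rewrite -row_mx0 => /eq_row_mx[/dot0P h1 /dot0P h2]; split; last by rewrite dotC.
case: ifP h1 => [k1|_]; last by rewrite dotC.
rewrite /dot => h1; apply/rowP => i; rewrite [RHS]mxE -h1 (bigD1 i)//= big1 ?addr0.
  by rewrite [const_mx _ _ _]mxE mulr1.
move=> j ji.
by case/eqP: ji; apply/val_inj; move/eqP: k1; case: (i) (j) => [a ?] [b ?] /=; lia.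
Qed.

End OrbitGeometry.

(* The uniqueness argument for the Levi-Civita connection: a trilinear defect symmetric in
   its first two arguments and skew in its last two vanishes. *)
Lemma koszul_algebra (R : realType) (M : Type) (P : M -> Prop) (q p : M -> M -> M -> R) :
  (forall a b c, P a -> P b -> P c -> q a b c + q a c b = p a b c + p a c b) ->
  (forall a b c, P c -> q a b c - q b a c = p a b c - p b a c) ->
  forall a b c, P a -> P b -> P c -> q a b c = p a b c.
Proof.
move=> anti sym a b c ha hb hc.
have e1 := anti a b c ha hb hc; have e2 := sym a c b hb.
have e3 := anti c a b hc ha hb; have e4 := sym c b a ha.
have e5 := anti b c a hb hc ha; have e6 := sym b a c hc.
by lra.
Qed.

(** * The isometry along an orbit: tangent spaces and a Koszul identity *)

Section Isometry.
Context {R : realType} {k m : nat}.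
Local Notation V := 'rV[R]_(k + m).
Variables (F1 F2 : V -> R) (C : set V) (Phi : V -> V).
Hypotheses (k0 : (0 < k)%N) (m1 : (1 < m)%N).
Hypotheses (mF1 : minkowski_norm F1) (mF2 : minkowski_norm F2).
Hypotheses (iF1 : G_invariant_fun F1) (iF2 : G_invariant_fun F2).
Hypotheses (oC : open C) (CG : G_invariant_set C) (sPhi : smooth_on C Phi).
Hypothesis iso : forall x u v, C x ->
  hess_metric F2 (Phi x) ('D_u Phi x) ('D_v Phi x) = hess_metric F1 x u v.
Hypothesis orb : maps_orbits_into_orbits C Phi.
Hypotheses (regC : forall x, C x -> regular_pt x) (regI : forall x, C x -> regular_pt (Phi x)).
Implicit Types (x u v w y : V) (A B D : 'M[R]_(k + m)).

Let c1Phi : C1v C Phi := smooth_C1v [::] oC sPhi.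

Lemma PhiD x u v : C x -> 'D_(u + v) Phi x = 'D_u Phi x + 'D_v Phi x.
Proof.
by move=> Cx; rewrite (C1v_jac (u + v) oC c1Phi Cx) mulmxDl
  -(C1v_jac u oC c1Phi Cx) -(C1v_jac v oC c1Phi Cx).
Qed.

Lemma PhiZ x c u : C x -> 'D_(c *: u) Phi x = c *: 'D_u Phi x.
Proof.
by move=> Cx; rewrite (C1v_jac (c *: u) oC c1Phi Cx) -scalemxAl -(C1v_jac u oC c1Phi Cx).
Qed.

Lemma vdiff_dotl (f g : V -> V) x w df dg : vdiff f x w df -> vdiff g x w dg ->
  differentiable (fun y => dot (lsubmx (f y)) (lsubmx (g y))) x /\
  'D_w (fun y => dot (lsubmx (f y)) (lsubmx (g y))) x =
    dot (lsubmx df) (lsubmx (g x)) + dot (lsubmx (f x)) (lsubmx dg).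
Proof.
have L (h : V -> V) dh : vdiff h x w dh -> vdiff (fun y => lsubmx (h y)) x w (lsubmx dh).
  move=> hh j; rewrite mxE (_ : (fun y => lsubmx (h y) 0 j) = fun y => h y 0 (lshift m j)).
    exact: hh.
  by apply/funext => y; rewrite mxE.
by move=> /L hf /L hg; apply: vdiff_dot hf hg.
Qed.

Lemma vdiff_dotr (f g : V -> V) x w df dg : vdiff f x w df -> vdiff g x w dg ->
  differentiable (fun y => dot (rsubmx (f y)) (rsubmx (g y))) x /\
  'D_w (fun y => dot (rsubmx (f y)) (rsubmx (g y))) x =
    dot (rsubmx df) (rsubmx (g x)) + dot (rsubmx (f x)) (rsubmx dg).
Proof.
have L (h : V -> V) dh : vdiff h x w dh -> vdiff (fun y => rsubmx (h y)) x w (rsubmx dh).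
  move=> hh j; rewrite mxE (_ : (fun y => rsubmx (h y) 0 j) = fun y => h y 0 (rshift k j)).
    exact: hh.
  by apply/funext => y; rewrite mxE.
by move=> /L hf /L hg; apply: vdiff_dot hf hg.
Qed.

Lemma vdiff_oform (f g : V -> V) a b x w df dg : vdiff f x w df -> vdiff g x w dg ->
  differentiable (fun y => oform a b (f y) (g y)) x /\
  'D_w (fun y => oform a b (f y) (g y)) x = oform a b df (g x) + oform a b (f x) dg.
Proof.
move=> hf hg; have [dl el] := vdiff_dotl hf hg; have [dr er] := vdiff_dotr hf hg.
have E : (fun y => oform a b (f y) (g y)) =
  a *: (fun y => dot (lsubmx (f y)) (lsubmx (g y))) +
  b *: (fun y => dot (rsubmx (f y)) (rsubmx (g y))) by apply/funext.
have d1 := differentiableZ a dl; have d2 := differentiableZ b dr.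
rewrite E; split; first exact: differentiableD d1 d2.
rewrite (deriveD (diff_derivable d1) (diff_derivable d2)).
rewrite (deriveZ _ (diff_derivable dl)) (deriveZ _ (diff_derivable dr)) el er.
by rewrite /oform /GRing.scale /=; ring.
Qed.

(** The squared norms of the blocks of [Phi] (for [k = 1], the first coordinate) are constant on
    orbits, so [orbit_derive] applies to them. *)
Lemma Phi_tang x w : C x -> tang x w -> tang (Phi x) ('D_w Phi x).
Proof.
move=> Cx tw; have hv := C1v_vdiff w oC c1Phi Cx.
have [dr er] := vdiff_dotr hv hv.
split; last first.
  have := orbit_derive (regC Cx) dr _ tw.
  rewrite er dotC => cr.
  suff : dot (rsubmx (Phi x)) (rsubmx ('D_w Phi x)) + dot (rsubmx (Phi x)) (rsubmx ('D_w Phi x)) = 0 by move=> e; lra.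
  by apply: cr => g bg; have [h [bh ->]] := orb bg Cx; exact: block_SO_dotr.
case: ifP => k1.
  apply/rowP => j; rewrite !mxE.
  have [d <-] := hv (lshift m j).
  apply: orbit_derive (regC Cx) d _ tw => g bg.
  have [h [bh ->]] := orb bg Cx.
  by have /rowP/(_ j) := block_SO_l1 (Phi x) k1 bh; rewrite !mxE.
have [dl el] := vdiff_dotl hv hv.
have := orbit_derive (regC Cx) dl _ tw.
rewrite el dotC => cr.
suff : dot (lsubmx (Phi x)) (lsubmx ('D_w Phi x)) + dot (lsubmx (Phi x)) (lsubmx ('D_w Phi x)) = 0 by move=> e; lra.
by apply: cr => g bg; have [h [bh ->]] := orb bg Cx; exact: block_SO_dotl.
Qed.

(** The derivative is injective, since a vector in its kernel has length 0 for the metric of [F1];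
    and both tangent spaces have dimension [k + m - 2]. *)
Lemma Phi_tang_onto x w : C x -> tang (Phi x) w -> exists2 w0, tang x w0 & w = 'D_w0 Phi x.
Proof.
move=> Cx tw; pose J := jac Phi x.
have JE u : 'D_u Phi x = u *m J by apply: C1v_jac oC c1Phi Cx.
have fJ : row_free J.
  rewrite -kermx_eq0; apply/rowV0P => u /sub_kermxP; rewrite -JE => uJ.
  apply/eqP; apply/negPn/negP => u0.
  have [_ [_ [_ [_ [_ pos]]]]] := mF1.
  have := pos x u (regular_neq0 (regC Cx)) u0.
  by rewrite -iso// uJ /hess_metric derive0 ltxx.
pose K := kermx (normals x)^T.
have rK y : regular_pt y -> \rank (kermx (normals y)^T) = (k + m - 2)%N.
  by move=> ry; rewrite mxrank_ker mxrank_tr normals_rank.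
have sub : (K *m J <= kermx (normals (Phi x))^T)%MS.
  apply/row_subP => i; apply/sub_kermxP/tang_normals; rewrite row_mul -JE.
  apply: Phi_tang => //; apply/tang_normals/sub_kermxP; exact: row_sub.
have eqr : \rank (K *m J) = \rank (kermx (normals (Phi x))^T).
  by rewrite mxrankMfree// (rK _ (regI Cx)) (rK _ (regC Cx)).
have sub2 : (kermx (normals (Phi x))^T <= K *m J)%MS.
  by have [_ <-] := mxrank_leqif_sup sub; rewrite eqr.
have : (w <= K *m J)%MS.
  by apply: submx_trans sub2; apply/sub_kermxP/tang_normals.
case/submxP => a ->; exists (a *m K); last by rewrite JE mulmxA.
by apply/tang_normals/sub_kermxP; rewrite submxMl.
Qed.

Let a1 x := alpha F1 x. Let b1 x := beta F1 x.
Let a2 x := alpha F2 (Phi x). Let b2 x := beta F2 (Phi x).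

Lemma iso_tang x u w : C x -> tang x w ->
  oform (a2 x) (b2 x) ('D_u Phi x) ('D_w Phi x) = oform (a1 x) (b1 x) u w.
Proof.
move=> Cx tw; have := iso u w Cx.
rewrite (hess_tang _ mF1 iF1 (regC Cx) tw) (hess_tang _ mF2 iF2 (regI Cx)) //.
exact: Phi_tang.
Qed.

Lemma radial_of_oform x v : C x ->
  (forall w, tang x w -> oform (a2 x) (b2 x) v ('D_w Phi x) = 0) ->
  (k != 1%N -> exists c, lsubmx v = c *: lsubmx (Phi x)) /\
  exists c, rsubmx v = c *: rsubmx (Phi x).
Proof.
move=> Cx h; apply: (@oform_radial _ _ _ (a2 x) (b2 x)) => //.
- move=> k1; rewrite gt_eqF//; apply: alpha_gt0 => //; last exact: regI.
  by rewrite ltn_neqAle eq_sym k1.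
- by rewrite gt_eqF//; apply: beta_gt0 => //; exact: regI.
- exact: regI.
- by move=> w /(Phi_tang_onto Cx)[w0 tw0 ->]; apply: h.
Qed.

(** [(e, 0)] is orthogonal to the orbit of [x], so its image is orthogonal to the orbit of [Phi x].
    For [k = 1] every [e] qualifies, because tangent vectors have zero first block. *)
Lemma Phi_radial x (e : 'rV[R]_k) : C x -> (k != 1%N -> exists c, e = c *: lsubmx x) ->
  let v := 'D_(row_mx e 0) Phi x in
  (k != 1%N -> exists c, lsubmx v = c *: lsubmx (Phi x)) /\
  exists c, rsubmx v = c *: rsubmx (Phi x).
Proof.
move=> Cx he v; apply: radial_of_oform => // w tw; rewrite iso_tang//.
rewrite /oform row_mxKl row_mxKr dot0l mulr0 addr0.
have [t1 _] := tw; case: ifP t1 => [_ ->|k1 t1]; first by rewrite dot0r mulr0.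
by have [|c ->] := he; rewrite ?k1// dotZl t1 !mulr0.
Qed.

(** The derivative along [x A] of the push-forward of the field [y |-> y B]. *)
Let Z A B x := 'D_(x *m A) ('D_(x *m B) Phi) x + 'D_(x *m A *m B) Phi x.

(** Metric compatibility. As [alpha] and [beta] are constant on orbits, the isometry identity for
    the fields of [B] and [D] holds on the whole orbit with coefficients frozen at [x], and can be
    differentiated along [x A]. *)
Lemma koszul_metric x A B D : C x -> block_skew A -> block_skew B -> block_skew D ->
  oform (a2 x) (b2 x) (Z A B x) ('D_(x *m D) Phi x) +
  oform (a2 x) (b2 x) ('D_(x *m B) Phi x) (Z A D x) =
  oform (a1 x) (b1 x) (x *m A *m B) (x *m D) + oform (a1 x) (b1 x) (x *m B) (x *m A *m D).
Proof.
move=> Cx sA sB sD.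
have hB := vdiff_lfield oC sPhi B (x *m A) Cx.
have hD := vdiff_lfield oC sPhi D (x *m A) Cx.
have [d2 e2] := vdiff_oform (a2 x) (b2 x) hB hD.
have [d1 e1] := vdiff_oform (a1 x) (b1 x) (vdiff_mulmx B x (x *m A)) (vdiff_mulmx D x (x *m A)).
have E g : block_SO g -> oform (a2 x) (b2 x) (lfield Phi B (x *m g)) (lfield Phi D (x *m g)) =
   oform (a1 x) (b1 x) (x *m g *m B) (x *m g *m D).
  move=> bg; have Cg := CG bg Cx.
  rewrite !(lfieldE oC sPhi _ Cg).
  have := iso_tang (x *m g *m B) Cg (tang_skew (x *m g) sD).
  have [h [bh eh]] := orb bg Cx.
  by rewrite /a1 /b1 /a2 /b2 eh !alpha_inv// !beta_inv.
have id2 : x *m 1%:M = x := mulmx1 x.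
have bs1 : block_SO (1%:M : 'M[R]_(k + m)).
  by exists 1%:M, 1%:M; split; [exact: SOmx1|split; [exact: SOmx1|rewrite -scalar_mx_block]].
have key : 'D_(x *m A) (fun y => oform (a2 x) (b2 x) (lfield Phi B y) (lfield Phi D y)
      - oform (a1 x) (b1 x) (y *m B) (y *m D)) x = 0.
  apply: orbit_derive (regC Cx) _ _ (tang_skew x sA).
    exact: differentiableB d2 d1.
  have E1 := E _ bs1; rewrite id2 in E1.
  by move=> g bg; rewrite (E g bg) E1 !subrr.
move: key; rewrite (deriveB (diff_derivable d2) (diff_derivable d1)) e2 e1.
by rewrite !(lfieldE oC sPhi _ Cx) => /eqP; rewrite subr_eq0 => /eqP.
Qed.

Lemma koszul x A B D : C x -> block_skew A -> block_skew B -> block_skew D ->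
  oform (a2 x) (b2 x) (Z A B x) ('D_(x *m D) Phi x) = oform (a1 x) (b1 x) (x *m A *m B) (x *m D).
Proof.
move=> Cx sA sB sD.
apply: (@koszul_algebra _ _ block_skew
  (fun A B D => oform (a2 x) (b2 x) (Z A B x) ('D_(x *m D) Phi x))
  (fun A B D => oform (a1 x) (b1 x) (x *m A *m B) (x *m D))) => //.
  move=> P Q S sP sQ sS; have h := koszul_metric Cx sP sQ sS.
  by rewrite [X in _ + X = _]oformC [X in _ = _ + X]oformC in h.
move=> P Q S sS; have h := iso_tang (x *m P *m Q - x *m Q *m P) Cx (tang_skew x sS).
(* Absence of torsion: the second-order terms cancel by symmetry, and what remains is the image of a
   vector of the source, to which the isometry applies. *)
have e : 'D_(x *m P *m Q - x *m Q *m P) Phi x = Z P Q x - Z Q P x.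
  rewrite (PhiD (x *m P *m Q) (- (x *m Q *m P)) Cx) -scaleN1r.
  rewrite (PhiZ (-1) (x *m Q *m P) Cx) scaleN1r /Z.
  rewrite (smooth_schwarz (x *m P) (x *m Q) oC sPhi Cx).
  by rewrite opprD addrACA subrr add0r.
by rewrite e oformBl [X in _ = X]oformBl in h.
Qed.

Lemma geodesic_radial x A : C x -> block_skew A ->
  (forall w, tang x w -> oform (a1 x) (b1 x) (x *m A *m A) w = 0) ->
  (k != 1%N -> exists c, lsubmx (Z A A x) = c *: lsubmx (Phi x)) /\
  exists c, rsubmx (Z A A x) = c *: rsubmx (Phi x).
Proof.
move=> Cx sA h; apply: radial_of_oform => // w tw.
have [D sD eD] := tang_exists_skew (regC Cx) tw.
by rewrite eD koszul// -eD h.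
Qed.

End Isometry.

(** * Images of great circles *)

Section CircleODE.
Context {R : realType} {n : nat}.
Implicit Types (G H W : R -> 'rV[R]_n).

Definition vderive G (l : R) (dG : 'rV[R]_n) :=
  forall j, is_derive l 1 (fun t => G t 0 j) (dG 0 j).

Lemma vderive_dot G H l dG dH : vderive G l dG -> vderive H l dH ->
  is_derive l 1 (fun t => dot (G t) (H t)) (dot dG (H l) + dot (G l) dH).
Proof.
move=> hG hH.
have -> : (fun t => dot (G t) (H t)) = \sum_(j < n) ((fun t => G t 0 j) * (fun t => H t 0 j)).
  by apply/funext => t; rewrite fct_sumE.
have h := is_derive_sum (fun j => is_deriveM (hG j) (hH j)).
apply: (is_derive_eq h); rewrite /dot -big_split; apply: eq_bigr => j _.
by rewrite /GRing.scale /= addrC [dG 0 j * _]mulrC.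
Qed.

(** Constant norm makes [W] orthogonal to [G], so radial acceleration keeps [|W|] constant;
    differentiating [<G, W> = 0] then fixes the factor [c] as [- w^2]. For [w = 0] division by zero
    gives 0, in agreement with [W 0 = 0]. *)
Lemma circle_ode G W (N : R) : 0 < N ->
  (forall l, dot (G l) (G l) = N) -> (forall l, vderive G l (W l)) ->
  (forall l, exists2 dW, vderive W l dW & exists c, dW = c *: G l) ->
  let w := enorm (W 0) / enorm (G 0) in
  forall l, G l = cos (w * l) *: G 0 + (sin (w * l) / w) *: W 0.
Proof.
move=> N0 hN hG hW w.
have GW l : dot (G l) (W l) = 0.
  have [_ e] := vderive_dot (hG l) (hG l).
  have E : (fun t => dot (G t) (G t)) = cst N by apply/funext.
  by move: e; rewrite E derive_cst (dotC (W l)) => e; lra.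
have WWd (l : R) : is_derive l 1 (fun t => dot (W t) (W t)) 0.
  have [dW h [c e]] := hW l; have d := vderive_dot h h.
  by apply: (is_derive_eq d); rewrite e dotZl dotZr (dotC (W l)) GW mulr0 addr0.
have WW l : dot (W l) (W l) = w ^+ 2 * N.
  rewrite (is_derive_0_is_cst l 0 WWd) /w expr_div_n !enorm_sqr hN.
  by field; rewrite gt_eqF.
have hW2 l : vderive W l (- w ^+ 2 *: G l).
  have [dW h [c e]] := hW l.
  suff -> : - w ^+ 2 = c by rewrite -e.
  have [_ e2] := vderive_dot (hG l) h.
  have E : (fun t => dot (G t) (W t)) = cst 0 by apply/funext.
  move: e2; rewrite E derive_cst e dotZr hN WW => e2.
  have : (c + w ^+ 2) * N = 0 by lra.
  by move/eqP; rewrite mulf_eq0 (gt_eqF N0) orbF => /eqP; lra.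
have [w0|w0] := eqVneq w 0.
  move=> l; rewrite w0 mul0r cos0 sin0 mul0r scale0r addr0 scale1r.
  have W0 t : W t = 0.
    by apply/eqP; rewrite -dot_eq0 WW w0 expr0n mul0r.
  apply/rowP => j.
  have d0 (t : R) : is_derive t 1 (fun t => G t 0 j) 0 by have := hG t j; rewrite W0 mxE.
  exact: (is_derive_0_is_cst l 0 d0).
move=> l; apply/rowP => j; rewrite !mxE.
have cw t := is_derive_cosM w t; have sw t := is_derive_sinM w t.
pose g (t : R) : R := G t 0 j; pose v (t : R) : R := W t 0 j.
have dg (t : R) : is_derive t 1 g (v t) by exact: hG.
have dv (t : R) : is_derive t 1 v (- w ^+ 2 * g t) by have := hW2 t j; rewrite mxE.
pose c (t : R) : R := cos (w * t); pose s (t : R) : R := sin (w * t).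
(* Two first integrals of [g'' = - w^2 g]: the initial position and velocity, recovered by turning
   back through the angle [w t]. *)
have h1 (t : R) : is_derive t 1 (c * g - (w^-1 *: (s * v))) 0.
  have d := is_deriveB (is_deriveM (cw t) (dg t)) (is_deriveZ w^-1 (is_deriveM (sw t) (dv t))).
  apply: (is_derive_eq d); rewrite /GRing.scale /= -/(c t) -/(s t).
  by rewrite /c /s; field.
have h2 (t : R) : is_derive t 1 (s * g + (w^-1 *: (c * v))) 0.
  have d := is_deriveD (is_deriveM (sw t) (dg t)) (is_deriveZ w^-1 (is_deriveM (cw t) (dv t))).
  apply: (is_derive_eq d); rewrite /GRing.scale /=.
  by field.
have e1 := is_derive_0_is_cst l 0 h1; have e2 := is_derive_0_is_cst l 0 h2.
move: e1 e2; rewrite -![(_ + _ : _ -> _) _]/(_ + _) -![(- _ : _ -> _) _]/(- _).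
rewrite -![(_ *: _ : _ -> _) _]/(_ *: _) -![(_ * _ : _ -> _) _]/(_ * _) /GRing.scale /=.
rewrite /c /s mulr0 cos0 sin0 !mul0r !mul1r !mulr0 subr0 add0r -/(g l) -/(g 0) -/(v 0).
have := cos2Dsin2 (w * l).
move: (cos _) (sin _) (g l) (v l) (g 0) (v 0) => cc ss gl vl g0 v0 cs e1 e2.
have -> : gl = (cc ^+ 2 + ss ^+ 2) * gl by rewrite cs mul1r.
have -> : ss / w * v0 = ss * (w^-1 * v0) by field.
by rewrite -e2 -e1; field.
Qed.

End CircleODE.

Section GeodesicImage.
Context {R : realType} {k m : nat}.
Local Notation V := 'rV[R]_(k + m).
Variables (F1 F2 : V -> R) (C : set V) (Phi : V -> V).
Hypotheses (k0 : (0 < k)%N) (m1 : (1 < m)%N).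
Hypotheses (mF1 : minkowski_norm F1) (mF2 : minkowski_norm F2).
Hypotheses (iF1 : G_invariant_fun F1) (iF2 : G_invariant_fun F2).
Hypotheses (oC : open C) (CG : G_invariant_set C) (sPhi : smooth_on C Phi).
Hypothesis iso : forall x u v, C x ->
  hess_metric F2 (Phi x) ('D_u Phi x) ('D_v Phi x) = hess_metric F1 x u v.
Hypothesis orb : maps_orbits_into_orbits C Phi.
Hypotheses (regC : forall x, C x -> regular_pt x) (regI : forall x, C x -> regular_pt (Phi x)).

(** The blocks of the image have constant norm, as orbits go into orbits, and radial acceleration by
    [geodesic_radial]; [circle_ode] integrates each block. *)
Lemma geodesic_image (e1 e2 : 'rV[R]_k) (f1 f2 : 'rV[R]_m) (a b : R) :
  C (row_mx e1 f1) -> a = 0 \/ (e1 != 0 /\ cpair e1 e2) -> b = 0 \/ (f1 != 0 /\ cpair f1 f2) ->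
  let x := row_mx e1 f1 in let v := 'D_(row_mx (a *: e2) (b *: f2)) Phi x in
  let wl := enorm (lsubmx v) / enorm (lsubmx (Phi x)) in
  let wr := enorm (rsubmx v) / enorm (rsubmx (Phi x)) in
  forall l, (k != 1%N -> lsubmx (Phi (tcur e1 e2 f1 f2 a b l)) =
     cos (wl * l) *: lsubmx (Phi x) + (sin (wl * l) / wl) *: lsubmx v) /\
   rsubmx (Phi (tcur e1 e2 f1 f2 a b l)) =
     cos (wr * l) *: rsubmx (Phi x) + (sin (wr * l) / wr) *: rsubmx v.
Proof.
move=> Cx ha hb x v wl wr.
pose g := tcur e1 e2 f1 f2 a b; pose A := tgen e1 e2 f1 f2 a b.
have g0 : g 0 = x by rewrite /g tcur0.
have go l : exists2 h, block_SO h & g l = x *m h.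
  by have := tcur_orbit ha hb l; rewrite -/g g0.
have Cg l : C (g l) by have [h bh ->] := go l; apply: CG.
have sA : block_skew A.
  exists (a *: skew2 e1 e2), (b *: skew2 f1 f2); split=> //;
  by rewrite linearZ /= skew2_tr scalerN.
pose W l := lfield Phi A (g l).
have W0 : W 0 = v.
  rewrite /W (lfieldE oC sPhi A (Cg 0)) /A /g tcur_gen// tcur0 !mulr0 cos0 sin0.
  by rewrite !scale0r !subr0 !scale1r.
have dG l : vderive (fun t => Phi (g t)) l (W l).
  move=> j; have [d _] := C1v_vdiff (g l *m A) oC (smooth_C1v [::] oC sPhi) (Cg l) j.
  have h := is_derive_chain (tcur_derive ha hb l) d.
  apply: (is_derive_eq h); rewrite /W (lfieldE oC sPhi A (Cg l)).
  by have [_] := C1v_vdiff (g l *m A) oC (smooth_C1v [::] oC sPhi) (Cg l) j.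
have dW l : vderive W l ('D_(g l *m A) ('D_(g l *m A) Phi) (g l) + 'D_(g l *m A *m A) Phi (g l)).
  move=> j; have [d e] := vdiff_lfield oC sPhi A (g l *m A) (Cg l) j.
  have h := is_derive_chain (tcur_derive ha hb l) d.
  by apply: (is_derive_eq h).
have rad l := @geodesic_radial R k m F1 F2 C Phi k0 m1 mF1 mF2 iF1 iF2 oC CG sPhi iso orb
  regC regI (g l) A (Cg l) sA.
have {}rad l : (k != 1%N -> exists c, lsubmx ('D_(g l *m A) ('D_(g l *m A) Phi) (g l)
     + 'D_(g l *m A *m A) Phi (g l)) = c *: lsubmx (Phi (g l))) /\
   exists c, rsubmx ('D_(g l *m A) ('D_(g l *m A) Phi) (g l)
     + 'D_(g l *m A *m A) Phi (g l)) = c *: rsubmx (Phi (g l)).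
  apply: rad => w [t1 t2]; rewrite tcur_gen2// /oform row_mxKl row_mxKr !dotZl t2 !mulr0 addr0.
  by case: ifP t1 => [_ ->|_ ->]; rewrite ?dot0r !mulr0.
have bl (h : R -> V) l dh : vderive h l dh -> vderive (fun t => lsubmx (h t)) l (lsubmx dh).
  move=> hh j; rewrite mxE (_ : (fun t => lsubmx (h t) 0 j) = fun t => h t 0 (lshift m j)).
    exact: hh.
  by apply/funext => y; rewrite mxE.
have br (h : R -> V) l dh : vderive h l dh -> vderive (fun t => rsubmx (h t)) l (rsubmx dh).
  move=> hh j; rewrite mxE (_ : (fun t => rsubmx (h t) 0 j) = fun t => h t 0 (rshift k j)).
    exact: hh.
  by apply/funext => y; rewrite mxE.
have nl l : dot (lsubmx (Phi (g l))) (lsubmx (Phi (g l))) = dot (lsubmx (Phi x)) (lsubmx (Phi x)).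
  by have [h bh ->] := go l; have [h' [bh' ->]] := orb bh Cx; apply: block_SO_dotl.
have nr l : dot (rsubmx (Phi (g l))) (rsubmx (Phi (g l))) = dot (rsubmx (Phi x)) (rsubmx (Phi x)).
  by have [h bh ->] := go l; have [h' [bh' ->]] := orb bh Cx; apply: block_SO_dotr.
have [rl rr] := regI Cx.
move=> l; split=> [k1|].
  have h := circle_ode (dot_gt0 (rl k1)) nl (fun l => bl _ l _ (dG l)) _ l.
  rewrite g0 W0 in h; apply: h => t.
  by exists (lsubmx ('D_(g t *m A) ('D_(g t *m A) Phi) (g t) + 'D_(g t *m A *m A) Phi (g t)));
    [exact: bl (dW t)|exact: (rad t).1].
have h := circle_ode (dot_gt0 rr) nr (fun l => br _ l _ (dG l)) _ l.
rewrite g0 W0 in h; apply: h => t.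
by exists (rsubmx ('D_(g t *m A) ('D_(g t *m A) Phi) (g t) + 'D_(g t *m A *m A) Phi (g t)));
    [exact: br (dW t)|exact: (rad t).2].
Qed.

End GeodesicImage.

(** * Integer arithmetic of torus maps *)

Lemma int_sqr_close (M K u D : int) : M ^+ 2 - K ^+ 2 = D -> 0 <= M -> u < K ->
  D <= u -> - D <= u -> D = 0.
Proof.
rewrite !expr2 => MK M0 KD D1 D2.
(* A square other than [K^2] is at distance at least [2 K - 1] from it, which exceeds [u]. *)
have [e|[lt|lt]] : M = K \/ (M + 1 <= K \/ K + 1 <= M) by lia.
- by rewrite -MK e subrr.
- exfalso; nia.
- exfalso; nia.
Qed.

Lemma int_shift_bound (u v y H : int) : 0 <= u -> 0 <= v -> - H <= v ->
  2 * (u + v + 1) <= y -> u < y + H.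
Proof. by lia. Qed.

Lemma int_mul_eq1 (d e : int) : d * e = 1 -> d = 1 \/ d = -1.
Proof.
move=> h; have := congr1 absz h; rewrite abszM => /eqP.
by rewrite muln_eq1 => /andP[/eqP d1 _]; lia.
Qed.

Lemma int_mul_sqr1 (u v : int) : u * v = 1 \/ u * v = -1 -> u ^+ 2 = 1 /\ v ^+ 2 = 1.
Proof.
have E (x y : int) : x * y = 1 -> x ^+ 2 = 1.
  by move=> /int_mul_eq1[->|->].
case=> h; split.
- exact: E h.
- by apply: (E v u); rewrite mulrC.
- by apply: (E u (- v)); rewrite mulrN h.
- by apply: (E v (- u)); rewrite mulrN mulrC h.
Qed.

Lemma int_sub_unit (u v : int) : u - v = 1 \/ u - v = -1 -> u * v <= 0 -> u = 0 \/ v = 0.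
Proof.
case=> h.
  have -> : v = u - 1 by lia.
  have [|[]] : u <= 0 \/ (u = 1 \/ 2 <= u) by lia.
  - by move=> a b; left; nia.
  - by move=> ->; right.
  - by move=> a b; exfalso; nia.
have -> : v = u + 1 by lia.
have [|[]] : 0 <= u \/ (u = -1 \/ u <= -2) by lia.
- by move=> a b; left; nia.
- by move=> ->; right.
- by move=> a b; exfalso; nia.
Qed.

Section LatticeArithmetic.
Context {R : realType}.

Lemma cosD2pi_int (t : R) (i : int) : cos (t + pi *+ 2 * i%:~R) = cos t.
Proof.
have E (u : R) n : cos (u + pi *+ 2 * n%:R) = cos u.
  by rewrite mulr_natr; exact: periodicn (@cosD2pi R) n u.
case: i => n; first exact: E.
rewrite NegzE -(E _ n.+1) mulrNz; congr cos.
by rewrite mulrN subrK.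
Qed.

Lemma cos_eq1 (t : R) : cos t = 1 -> exists i : int, t = pi *+ 2 * i%:~R.
Proof.
move=> ct; have p0 := @pi_gt0 R; have p20 : 0 < (pi : R) *+ 2 by rewrite pmulrn_lgt0.
pose i := Num.floor (t / (pi *+ 2)); exists i.
pose u := t + pi *+ 2 * (- i)%:~R.
have u1 : cos u = 1 by rewrite /u cosD2pi_int.
have ub : 0 <= u < pi *+ 2.
  have := @real_floor_itv R (t / (pi *+ 2)) (num_real _); rewrite -/i => /andP[a b].
  rewrite ler_pdivlMr// in a; rewrite ltr_pdivrMr// intrD in b.
  rewrite /u mulrNz mulrN subr_ge0 [_ * i%:~R]mulrC a /=.
  by rewrite ltrBlDl; apply: lt_le_trans b _; rewrite mulrDl mul1r mulrC.
suff : u = 0 by rewrite /u mulrNz mulrN => /eqP; rewrite subr_eq0 => /eqP.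
move: ub => /andP[u0 u2]; apply/eqP; rewrite eq_le u0 andbT leNgt; apply/negP => up.
have s0 : 0 < sin (u / 2).
  apply: sin_gt0_pi; rewrite divr_gt0//= ltr_pdivrMr//.
  by move: u2; rewrite mulr2n mulr_natr mulr2n.
have := cos_mulr2n (u / 2); rewrite -[_ *+ 2]mulr_natr divfK// u1.
have := cos2Dsin2 (u / 2); move: (cos _) (sin _) s0 => c s s0 e1 e2.
by rewrite mulr2n in e2; nra.
Qed.

(** Multiplied by [4 p^2], the value becomes [(2 p^2 i + H)^2 + D] with [D] independent of [i]; for
    large [i] this can be a square only if [D = 0]. *)
Lemma square_form_discriminant (p r H : int) :
  (forall i : int, exists n : int, p ^+ 2 * i ^+ 2 + H * i + r ^+ 2 = n ^+ 2) ->
  H ^+ 2 = 4 * p ^+ 2 * r ^+ 2.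
Proof.
move=> h; have [p0|p0] := eqVneq p 0.
  subst p; have [->|H0] := eqVneq H 0; first by rewrite !expr0n /= mulr0 mul0r.
  (* With [p = 0] the value is affine in [i], and this [i] makes it negative. *)
  have [n] := h (- H * (r ^+ 2 + 1)).
  have Hp : 1 <= H ^+ 2 by rewrite -gtz0_ge1 exprn_even_gt0.
  have n0 : 0 <= n ^+ 2 := sqr_ge0 n.
  have r0 : 0 <= r ^+ 2 := sqr_ge0 r.
  move: Hp n0 r0; rewrite !expr2 => Hp n0 r0 e.
  exfalso; nia.
pose D := 4 * p ^+ 2 * r ^+ 2 - H ^+ 2.
suff : D = 0 by rewrite /D => /eqP; rewrite subr_eq0 => /eqP ->.
(* Large enough for [|D| < 2 p^2 i + H]. *)
pose i : int := `|D| + `|H| + 1.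
have [n en] := h i.
pose K := 2 * p ^+ 2 * i + H.
pose M := `|2 * p * n|.
have pp : 1 <= p ^+ 2 by rewrite -gtz0_ge1 exprn_even_gt0.
have KD : `|D| < K.
  rewrite /K; have i0 : 0 <= i by rewrite /i !addr_ge0.
  have b : 2 * i <= 2 * p ^+ 2 * i by rewrite ler_wpM2r// ler_peMr.
  have c : - H <= `|H| by rewrite -normrN ler_norm.
  exact: (int_shift_bound (normr_ge0 D) (normr_ge0 H) c b).
have MK : M ^+ 2 - K ^+ 2 = D.
  rewrite /M -normrX ger0_norm ?sqr_ge0// /K /D exprMn -en; ring.
have M0 : 0 <= M by rewrite /M.
have D1 : D <= `|D| by exact: ler_norm.
have D2 : - D <= `|D| by rewrite -normrN ler_norm.
exact: (int_sqr_close MK M0 KD D1 D2).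
Qed.

(** The values at [(i, 1)] force [h^2 = P Q], so the form is [(p i + r j)^2] for a suitable sign of
    [r]. *)
Lemma square_form_split (P h Q : R) :
  (forall i j : int, exists n : int,
     P * i%:~R ^+ 2 + 2 * h * i%:~R * j%:~R + Q * j%:~R ^+ 2 = n%:~R ^+ 2) ->
  exists p r : int, [/\ P = p%:~R ^+ 2, Q = r%:~R ^+ 2 & h = p%:~R * r%:~R].
Proof.
move=> sq.
have [p ep] := sq 1 0; have [r er] := sq 0 1; have [n en] := sq 1 1.
have {}ep : P = p%:~R ^+ 2 by rewrite -ep /= !expr0n /= expr1n; ring.
have {}er : Q = r%:~R ^+ 2 by rewrite -er /= !expr0n /= expr1n; ring.
pose H : int := n ^+ 2 - p ^+ 2 - r ^+ 2.
have eH : 2 * h = H%:~R.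
  rewrite /H !intrD !mulrNz !rmorphXn /= -en ep er /= expr1n; ring.
have d : H ^+ 2 = 4 * p ^+ 2 * r ^+ 2.
  apply: square_form_discriminant => i; have [n' en'] := sq i 1; exists n'.
  apply: (@intr_inj R); rewrite [RHS]rmorphXn /= -en' eH ep er.
  by clearbody H; rewrite !intrD !intrM; ring.
have {d} : (H - 2 * p * r) * (H + 2 * p * r) == 0.
  by apply/eqP; rewrite -subr_sqr d; ring.
rewrite mulf_eq0 => /orP[/eqP e|/eqP e].
  exists p, r; split=> //.
  have e' : H = 2 * p * r by lia.
  by move: eH; rewrite e' !rmorphM /= => eH; lra.
exists p, (- r); split=> //; first by rewrite mulrNz sqrrN.
have e' : H = - (2 * p * r) by lia.
by move: eH; rewrite e' rmorphN !rmorphM /= mulrNz => eH; lra.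
Qed.

(** [(p, r)] and [(q, s)] are the rows of the map on angles; [A, B] weigh the circles of the target
    and [a, b] those of the source. Orthogonality of the columns gives [(p s) (r q) <= 0], while
    [p s - r q] is 1 or -1; so one of the two products is 0. *)
Lemma torus_isometry_monomial (p r q s : int) (A B a b : R) :
  0 < A -> 0 < B -> 0 < a -> 0 < b ->
  A * p%:~R ^+ 2 + B * q%:~R ^+ 2 = a ->
  A * (p%:~R * r%:~R) + B * (q%:~R * s%:~R) = 0 ->
  A * r%:~R ^+ 2 + B * s%:~R ^+ 2 = b ->
  (forall x y : R, cos (p%:~R * x + r%:~R * y) = 1 -> cos (q%:~R * x + s%:~R * y) = 1 ->
     cos x = 1 /\ cos y = 1) ->
  [/\ r = 0, q = 0, p ^+ 2 = 1 & s ^+ 2 = 1] \/ [/\ p = 0, s = 0, r ^+ 2 = 1 & q ^+ 2 = 1].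
Proof.
move=> A0 B0 a0 b0 E1 E2 E3 inj.
pose d := p * s - r * q.
have dR : d%:~R = p%:~R * s%:~R - r%:~R * q%:~R :> R by rewrite /d intrD mulrNz !intrM.
have d0 : d%:~R != 0 :> R.
  (* Lagrange's identity for the weighted columns: the determinant is not 0. *)
  have L : a * b = A * B * d%:~R ^+ 2 +
      (A * (p%:~R * r%:~R) + B * (q%:~R * s%:~R)) ^+ 2 by rewrite dR -E1 -E3; ring.
  rewrite E2 expr0n addr0 in L.
  by apply/eqP => e; move: L; rewrite e expr0n /= mulr0; nra.
have p20 : (pi : R) *+ 2 != 0 by rewrite gt_eqF// pmulrn_lgt0// pi_gt0.
have dvd (x y : R) : cos (p%:~R * (pi *+ 2 * x) + r%:~R * (pi *+ 2 * y)) = 1 ->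
    cos (q%:~R * (pi *+ 2 * x) + s%:~R * (pi *+ 2 * y)) = 1 ->
    exists i j : int, x = i%:~R /\ y = j%:~R.
  move=> h1 h2; have [/cos_eq1[i ei] /cos_eq1[j ej]] := inj _ _ h1 h2.
  by exists i, j; split; apply: (mulfI p20).
have toint (u v : int) : u%:~R / d%:~R = v%:~R :> R -> u = d * v.
  move=> e; apply: (@intr_inj R); rewrite rmorphM /= -e.
  by field.
(* [2 pi] times a column of the inverse matrix is mapped into the lattice, so by injectivity that
   column is integral. The other column follows likewise. *)
have [i1 [j1 [e1 f1]]] : exists i j : int, s%:~R / d%:~R = i%:~R :> R /\ (- q)%:~R / d%:~R = j%:~R :> R.
  apply: dvd.
    rewrite (_ : _ + _ = pi *+ 2) ?cos2pi//.
    have -> : p%:~R * (pi *+ 2 * (s%:~R / d%:~R)) + r%:~R * (pi *+ 2 * ((- q)%:~R / d%:~R)) =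
      pi *+ 2 * ((p%:~R * s%:~R - r%:~R * q%:~R) / d%:~R) :> R by rewrite mulrNz; ring.
    by rewrite -dR divff// mulr1.
  rewrite (_ : _ + _ = 0) ?cos0// mulrNz; ring.
have [i2 [j2 [e2 f2]]] : exists i j : int, (- r)%:~R / d%:~R = i%:~R :> R /\ p%:~R / d%:~R = j%:~R :> R.
  apply: dvd.
    rewrite (_ : _ + _ = 0) ?cos0// mulrNz; ring.
  rewrite (_ : _ + _ = pi *+ 2) ?cos2pi//.
  have -> : q%:~R * (pi *+ 2 * ((- r)%:~R / d%:~R)) + s%:~R * (pi *+ 2 * (p%:~R / d%:~R)) =
    pi *+ 2 * ((p%:~R * s%:~R - r%:~R * q%:~R) / d%:~R) :> R by rewrite mulrNz; ring.
  by rewrite -dR divff// mulr1.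
move: e1 f1 e2 f2 => /toint e1 /toint f1 /toint e2 /toint f2.
have dz : d != 0 by move: d0; rewrite intr_eq0.
have de : d = p * s - (- r) * (- q) by rewrite /d; ring.
have dd : d * (j2 * i1 - i2 * j1) = 1.
  apply: (mulfI dz); rewrite mulr1 [in RHS]de; clearbody d; rewrite e1 f1 e2 f2; ring.
have d1 : d = 1 \/ d = -1 := int_mul_eq1 dd.
have sgn : p * r * (q * s) <= 0.
  rewrite leNgt; apply/negP => h.
  have hR : 0 < (p%:~R * r%:~R) * (q%:~R * s%:~R) :> R.
    by rewrite -!intrM ltr0z.
  move: hR E2; move: (p%:~R * r%:~R) (q%:~R * s%:~R) => u v uv E2.
  have e : A * u ^+ 2 + B * (u * v) = (A * u + B * v) * u by ring.
  rewrite E2 mul0r in e.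
  have t1 := mulr_gt0 B0 uv; have t2 := mulr_ge0 (ltW A0) (sqr_ge0 u).
  by lra.
have z1 : p * r = 0 -> q * s = 0.
  move=> e; apply: (@intr_inj R); move: E2; rewrite -!intrM e mulr0 add0r => /eqP.
  by rewrite mulf_eq0 gt_eqF//= => /eqP.
have z2 : q * s = 0 -> p * r = 0.
  move=> e; apply: (@intr_inj R); move: E2; rewrite -!intrM e mulr0 addr0 => /eqP.
  by rewrite mulf_eq0 gt_eqF//= => /eqP.
have prod : (p * s) * (r * q) <= 0 by rewrite (_ : _ * _ = p * r * (q * s))//; ring.
have := int_sub_unit d1 prod.
case=> z; [right|left].
  have rq : r * q = 1 \/ r * q = -1 by move: d1; rewrite /d z; clear; move: (r * q) => u; lia.
  have [r1 q1] := int_mul_sqr1 rq.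
  have r0 : r != 0 by apply/eqP => e; move: r1; rewrite e.
  have q0 : q != 0 by apply/eqP => e; move: q1; rewrite e.
  have : p = 0 \/ s = 0 by move/eqP: z; rewrite mulf_eq0 => /orP[/eqP|/eqP]; [left|right].
  case=> e; split=> //.
    by move: z1; rewrite e mul0r => /(_ erefl)/eqP; rewrite mulf_eq0 (negbTE q0) => /eqP.
  by move: z2; rewrite e mulr0 => /(_ erefl)/eqP; rewrite mulf_eq0 (negbTE r0) orbF => /eqP.
have ps : p * s = 1 \/ p * s = -1 by move: d1; rewrite /d z subr0.
have [p1 s1] := int_mul_sqr1 ps.
have p0 : p != 0 by apply/eqP => e; move: p1; rewrite e.
have s0 : s != 0 by apply/eqP => e; move: s1; rewrite e.
have : r = 0 \/ q = 0 by move/eqP: z; rewrite mulf_eq0 => /orP[/eqP|/eqP]; [left|right].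
case=> e; split=> //.
  by move: z1; rewrite e mulr0 => /(_ erefl)/eqP; rewrite mulf_eq0 (negbTE s0) orbF => /eqP.
by move: z2; rewrite e mul0r => /(_ erefl)/eqP; rewrite mulf_eq0 (negbTE p0) => /eqP.
Qed.

End LatticeArithmetic.

(** * Angular speeds in one block, and conformal linear maps *)

Section BlockForms.
Context {R : realType} {n : nat}.
Implicit Types (G X Y : 'rV[R]_n).

(** Pairing the periodicity with [G] gives [cos (2 pi w) = 1], so [w] is an integer and
    [|i X + j Y|^2 / |G|^2] is a square for all integers [i, j]. *)
Lemma block_period G X Y : G != 0 -> dot G X = 0 -> dot G Y = 0 ->
  (forall i j : int, let v := i%:~R *: X + j%:~R *: Y in let w := enorm v / enorm G in
     G = cos (w * (pi *+ 2)) *: G + (sin (w * (pi *+ 2)) / w) *: v) ->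
  exists p r : int, [/\ dot X X = p%:~R ^+ 2 * dot G G, dot Y Y = r%:~R ^+ 2 * dot G G
    & dot X Y = p%:~R * r%:~R * dot G G].
Proof.
move=> G0 GX GY h; have N0 := dot_gt0 G0.
have p20 : (pi : R) *+ 2 != 0 by rewrite gt_eqF// pmulrn_lgt0// pi_gt0.
have [p [r [e1 e2 e3]]] : exists p r : int, [/\ dot X X / dot G G = p%:~R ^+ 2,
    dot Y Y / dot G G = r%:~R ^+ 2 & dot X Y / dot G G = p%:~R * r%:~R].
  apply: square_form_split => i j.
  pose v := i%:~R *: X + j%:~R *: Y; pose w := enorm v / enorm G.
  have hv : G = cos (w * (pi *+ 2)) *: G + (sin (w * (pi *+ 2)) / w) *: v := h i j.
  have := congr1 (dot G) hv; rewrite dotDr !dotZr.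
  have -> : dot G v = 0 by rewrite /v dotDr !dotZr GX GY !mulr0 addr0.
  rewrite mulr0 addr0 => e.
  have /cos_eq1[l el] : cos (w * (pi *+ 2)) = 1.
    by apply: (mulIf (lt0r_neq0 N0)); rewrite mul1r.
  have wl : w = l%:~R by apply: (mulIf p20); rewrite el mulrC.
  exists l; rewrite -wl /w expr_div_n !enorm_sqr /v !dotE (dotC Y X).
  by field; rewrite gt_eqF.
by exists p, r; split; rewrite -?e1 -?e2 -?e3 divfK// gt_eqF.
Qed.

Lemma block_speed G X Y (p r s t : R) : G != 0 ->
  dot X X = p ^+ 2 * dot G G -> dot Y Y = r ^+ 2 * dot G G -> dot X Y = p * r * dot G G ->
  enorm (s *: X + t *: Y) / enorm G = `|p * s + r * t|.
Proof.
move=> G0 e1 e2 e3.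
have -> : enorm (s *: X + t *: Y) = `|p * s + r * t| * enorm G.
  rewrite !enormE -sqrtr_sqr -sqrtrM ?sqr_ge0//; congr Num.sqrt.
  by rewrite !dotE (dotC Y X) e1 e2 e3; ring.
by rewrite mulfK// gt_eqF// enorm_gt0.
Qed.

End BlockForms.

Section SphereLinear.
Context {R : realType} {n q : nat}.

(** The linear map sending [e] to [g] and agreeing with [K] on the orthogonal complement of [e]: the
    point [e] goes to its image, and tangent directions follow the derivative. *)
Definition olin (e : 'rV[R]_n) (g : 'rV[R]_q) (K : 'M[R]_(n, q)) : 'M[R]_(n, q) :=
  (dot e e)^-1 *: (e^T *m g) + (1%:M - (dot e e)^-1 *: (e^T *m e)) *m K.

Lemma olinE e g K f (c s : R) : e != 0 -> cpair e f ->
  (c *: e + s *: f) *m olin e g K = c *: g + s *: (f *m K).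
Proof.
move=> e0 [_ ef]; have ee : dot e e != 0 by rewrite dot_eq0.
have E v : v *m (e^T *m g) = dot v e *: g.
  rewrite mulmxA (_ : v *m e^T = (dot v e)%:M) ?mul_scalar_mx//.
  apply/matrixP => i j; rewrite !ord1 !mxE eqxx mulr1n.
  by apply: eq_bigr => l _; rewrite mxE.
rewrite /olin mulmxDr -scalemxAr E mulmxA mulmxBr mulmx1 -scalemxAr dot_outer.
rewrite !dotE (dotC f e) ef !mulr0 addr0.
rewrite scalerA mulrC mulfK//; congr (_ + _).
by rewrite scalerA mulrC mulfK// addrAC subrr add0r -scalemxAl.
Qed.

(** Scaling extends the hypothesis from one sphere to all vectors, and polarization makes [L L^T]
    scalar. *)
Lemma conformal_sphere (e : 'rV[R]_n) (L : 'M[R]_(n, q)) (N : R) : e != 0 -> 0 < N ->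
  (forall y, dot y y = dot e e -> dot (y *m L) (y *m L) = N) ->
  exists2 a : R, 0 < a & exists2 M : 'M[R]_(n, q), M *m M^T = 1%:M & L = a *: M.
Proof.
move=> e0 N0 h; have e1 := dot_gt0 e0.
pose c := N / dot e e; have c0 : 0 < c by rewrite divr_gt0.
have LL : L *m L^T = c%:M.
  apply: dot_conformal => u; have [->|u0] := eqVneq u 0.
    by rewrite mul0mx !dot0l mulr0.
  have u1 := dot_gt0 u0; pose t := enorm e / enorm u.
  have t2 : t ^+ 2 = dot e e / dot u u by rewrite /t expr_div_n !enorm_sqr.
  clearbody t; have q1 : dot (t *: u) (t *: u) = dot e e.
    by rewrite dotZl dotZr mulrA -expr2 t2 divfK// gt_eqF.
  have := h _ q1; rewrite -scalemxAl dotZl dotZr mulrA -expr2 t2 => q2.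
  by rewrite /c -q2; field; rewrite !gt_eqF.
exists (Num.sqrt c); first by rewrite sqrtr_gt0.
have s0 : Num.sqrt c != 0 by rewrite gt_eqF// sqrtr_gt0.
exists ((Num.sqrt c)^-1 *: L); last by rewrite scalerA mulfV// scale1r.
rewrite linearZ /= -scalemxAl -scalemxAr LL scalerA -invfM -expr2 sqr_sqrtr ?ltW//.
by rewrite -scalemx1 scalerA mulVf ?scale1r// gt_eqF.
Qed.

End SphereLinear.

(** * The isometry on a single orbit *)

Section OrbitMap.
Context {R : realType} {k m : nat}.
Local Notation V := 'rV[R]_(k + m).
Variables (F1 F2 : V -> R) (C : set V) (Phi : V -> V).
Hypotheses (k0 : (0 < k)%N) (m1 : (1 < m)%N).
Hypotheses (mF1 : minkowski_norm F1) (mF2 : minkowski_norm F2).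
Hypotheses (iF1 : G_invariant_fun F1) (iF2 : G_invariant_fun F2).
Hypotheses (oC : open C) (CG : G_invariant_set C) (sPhi : smooth_on C Phi).
Hypothesis iso : forall x u v, C x ->
  hess_metric F2 (Phi x) ('D_u Phi x) ('D_v Phi x) = hess_metric F1 x u v.
Hypothesis orb : maps_orbits_into_orbits C Phi.
Hypotheses (regC : forall x, C x -> regular_pt x) (regI : forall x, C x -> regular_pt (Phi x)).
Hypothesis inj : forall x y, C x -> C y -> Phi x = Phi y -> x = y.

Variables (e1 : 'rV[R]_k) (f1 : 'rV[R]_m).
Let x := row_mx e1 f1.
Hypothesis Cx : C x.
Let KX : 'M[R]_(k, k + m) := usubmx (jac Phi x).
Let KY : 'M[R]_(m, k + m) := dsubmx (jac Phi x).
Let G1 := lsubmx (Phi x).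
Let G2 := rsubmx (Phi x).

Let DE (u : 'rV[R]_k) (v : 'rV[R]_m) : 'D_(row_mx u v) Phi x = u *m KX + v *m KY.
Proof.
rewrite (C1v_jac (row_mx u v) oC (smooth_C1v [::] oC sPhi) Cx).
by rewrite -{1}[jac Phi x]vsubmxK mul_row_col.
Qed.

Let f10 : f1 != 0. Proof. by have [_] := regC Cx; rewrite row_mxKr. Qed.
Let e10 : k != 1%N -> e1 != 0. Proof. by have [] := regC Cx; rewrite row_mxKl. Qed.
Let G20 : G2 != 0. Proof. by have [_] := regI Cx. Qed.
Let G10 : k != 1%N -> G1 != 0. Proof. by have [] := regI Cx. Qed.

Let geo (e2 : 'rV[R]_k) (f2 : 'rV[R]_m) (a b l : R) :
  a = 0 \/ (e1 != 0 /\ cpair e1 e2) -> b = 0 \/ (f1 != 0 /\ cpair f1 f2) ->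
  let v := a *: (e2 *m KX) + b *: (f2 *m KY) in
  let wl := enorm (lsubmx v) / enorm G1 in let wr := enorm (rsubmx v) / enorm G2 in
  (k != 1%N -> lsubmx (Phi (tcur e1 e2 f1 f2 a b l)) =
     cos (wl * l) *: G1 + (sin (wl * l) / wl) *: lsubmx v) /\
   rsubmx (Phi (tcur e1 e2 f1 f2 a b l)) = cos (wr * l) *: G2 + (sin (wr * l) / wr) *: rsubmx v.
Proof.
move=> ha hb.
have := geodesic_image k0 m1 mF1 mF2 iF1 iF2 oC CG sPhi iso orb regC regI Cx ha hb l.
by rewrite /= DE -!scalemxAl.
Qed.

Let tangX e2 : k != 1%N -> cpair e1 e2 -> tang x (row_mx e2 0).
Proof.
by move=> k1 [_ ce]; rewrite /tang !row_mxKl !row_mxKr dot0r (negbTE k1).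
Qed.

Let tangY f2 : cpair f1 f2 -> tang x (row_mx 0 f2).
Proof. by move=> [_ ce]; rewrite /tang !row_mxKl !row_mxKr dot0r ce; case: ifP. Qed.

Let tPhi w : tang x w -> tang (Phi x) ('D_w Phi x).
Proof. by move=> tw; apply: (Phi_tang (C := C)). Qed.

Let it (u w : V) : tang x w ->
  oform (alpha F2 (Phi x)) (beta F2 (Phi x)) ('D_u Phi x) ('D_w Phi x) =
  oform (alpha F1 x) (beta F1 x) u w.
Proof. by move=> tw; apply: (iso_tang (C := C)). Qed.

Let orthX e2 : k != 1%N -> cpair e1 e2 ->
  dot G1 (lsubmx (e2 *m KX)) = 0 /\ dot G2 (rsubmx (e2 *m KX)) = 0.
Proof.
move=> k1 ce; have := tPhi (tangX k1 ce); rewrite DE mul0mx addr0 /tang (negbTE k1).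
by [].
Qed.

Let orthY f2 : cpair f1 f2 ->
  (if k == 1%N then lsubmx (f2 *m KY) = 0 else dot G1 (lsubmx (f2 *m KY)) = 0) /\
  dot G2 (rsubmx (f2 *m KY)) = 0.
Proof. by move=> ce; have := tPhi (tangY ce); rewrite DE mul0mx add0r. Qed.

Let cos_int (i : int) : cos (i%:~R * (pi *+ 2)) = 1 :> R.
Proof. by rewrite -[_ * _]add0r mulrC cosD2pi_int cos0. Qed.

Let sin_of_cos (t : R) : cos t = 1 -> sin t = 0.
Proof. by move=> c; have := cos2Dsin2 t; rewrite c => h; apply/eqP; rewrite -sqrf_eq0; apply/eqP; lra. Qed.

Let tcur_per e2 f2 (i j : int) : tcur e1 e2 f1 f2 i%:~R j%:~R (pi *+ 2) = x.
Proof.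
by rewrite /tcur !cos_int !(sin_of_cos (cos_int _)) !scale0r !addr0 !scale1r.
Qed.

(** The alternatives are the two shapes of a monomial integer matrix: each circle stays in its block
    or the two are exchanged, with angular speed 1 in either case. *)
Lemma torus_type e2 f2 : k != 1%N -> cpair e1 e2 -> cpair f1 f2 ->
  let X := e2 *m KX in let Y := f2 *m KY in
  [/\ lsubmx Y = 0, rsubmx X = 0, dot (lsubmx X) (lsubmx X) = dot G1 G1
    & dot (rsubmx Y) (rsubmx Y) = dot G2 G2] \/
  [/\ lsubmx X = 0, rsubmx Y = 0, dot (lsubmx Y) (lsubmx Y) = dot G1 G1
    & dot (rsubmx X) (rsubmx X) = dot G2 G2].
Proof.
move=> k1 ce cf X Y.
have hg (a b l : R) := @geo e2 f2 a b l (or_intror (conj (e10 k1) ce)) (or_intror (conj f10 cf)).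
have [oX1 oX2] := orthX k1 ce; have [oY1 oY2] := orthY cf; rewrite (negbTE k1) in oY1.
have lD (a b : R) : lsubmx (a *: X + b *: Y) = a *: lsubmx X + b *: lsubmx Y.
  by apply/rowP => i; rewrite !mxE.
have rD (a b : R) : rsubmx (a *: X + b *: Y) = a *: rsubmx X + b *: rsubmx Y.
  by apply/rowP => i; rewrite !mxE.
have [p [r [p1 p2 p3]]] : exists p r : int,
    [/\ dot (lsubmx X) (lsubmx X) = p%:~R ^+ 2 * dot G1 G1,
        dot (lsubmx Y) (lsubmx Y) = r%:~R ^+ 2 * dot G1 G1
      & dot (lsubmx X) (lsubmx Y) = p%:~R * r%:~R * dot G1 G1].
  apply: block_period (G10 k1) oX1 oY1 _ => i j.
  by have [h _] := hg i%:~R j%:~R (pi *+ 2); move: (h k1); rewrite tcur_per lD.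
have [q [u [q1 q2 q3]]] : exists q u : int,
    [/\ dot (rsubmx X) (rsubmx X) = q%:~R ^+ 2 * dot G2 G2,
        dot (rsubmx Y) (rsubmx Y) = u%:~R ^+ 2 * dot G2 G2
      & dot (rsubmx X) (rsubmx Y) = q%:~R * u%:~R * dot G2 G2].
  apply: block_period G20 oX2 oY2 _ => i j.
  by have [_] := hg i%:~R j%:~R (pi *+ 2); rewrite tcur_per rD.
have cosabs (z : R) : cos `|z| = cos z by case: (ger0P z) => _; rewrite ?cosN.
have k2 : (1 < k)%N by rewrite ltn_neqAle eq_sym k1.
have a2 : 0 < alpha F2 (Phi x) by apply: alpha_gt0 => //; exact: regI.
have b2 : 0 < beta F2 (Phi x) by apply: beta_gt0 => //; exact: regI.
have a1 : 0 < alpha F1 x by apply: alpha_gt0 => //; exact: regC.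
have b1 : 0 < beta F1 x by apply: beta_gt0 => //; exact: regC.
have N1 := dot_gt0 (G10 k1); have N2 := dot_gt0 G20.
have EX : 'D_(row_mx e2 0) Phi x = X by rewrite DE mul0mx addr0.
have EY : 'D_(row_mx 0 f2) Phi x = Y by rewrite DE mul0mx add0r.
have iXX := it (row_mx e2 0) (tangX k1 ce).
have iXY := it (row_mx e2 0) (tangY cf).
have iYY := it (row_mx 0 f2) (tangY cf).
rewrite EX /oform !row_mxKl !row_mxKr !dot0l p1 q1 ce.1 mulr0 addr0 in iXX.
rewrite EX EY /oform !row_mxKl !row_mxKr !dot0l !dot0r p3 q3 !mulr0 addr0 in iXY.
rewrite EY /oform !row_mxKl !row_mxKr !dot0l p2 q2 cf.1 mulr0 add0r in iYY.
have := @torus_isometry_monomial R p r q u (alpha F2 (Phi x) * dot G1 G1)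
  (beta F2 (Phi x) * dot G2 G2) (alpha F1 x * dot e1 e1) (beta F1 x * dot f1 f1)
  (mulr_gt0 a2 N1) (mulr_gt0 b2 N2) (mulr_gt0 a1 (dot_gt0 (e10 k1))) (mulr_gt0 b1 (dot_gt0 f10)).
rewrite -iXX -iYY.
move=> /(_ _ _ _ _)[]; first by ring.
- by rewrite -[RHS]iXY; ring.
- by ring.
(* If both image angles are multiples of [2 pi], the curve at time 1 has the same image as [x],
   hence is [x]. *)
- move=> s t c1 c2.
  have ex : tcur e1 e2 f1 f2 s t 1 = x.
    have [g bg eg] := tcur_orbit (or_intror (conj (e10 k1) ce)) (or_intror (conj f10 cf)) 1
      : exists2 g, block_SO g & tcur e1 e2 f1 f2 s t 1 = tcur e1 e2 f1 f2 s t 0 *m g.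
    rewrite tcur0 in eg.
    apply: inj => //; first by rewrite eg; apply: CG.
    have [h1 h2] := hg s t 1; move: h2 (h1 k1).
    rewrite lD rD (block_speed s t (G10 k1) p1 p2 p3) (block_speed s t G20 q1 q2 q3).
    rewrite !mulr1 !cosabs c1 c2 !(sin_of_cos (etrans (cosabs _) c1)).
    rewrite !(sin_of_cos (etrans (cosabs _) c2)) !mul0r !scale0r !addr0 !scale1r => r2 r1.
    by rewrite -[LHS]hsubmxK r1 r2 -[RHS]hsubmxK.
  have cs n (e f : 'rV[R]_n) (z : R) : e != 0 -> cpair e f ->
      cos (z * 1) *: e + sin (z * 1) *: f = e -> cos z = 1.
    move=> e0 [_ ef] /(congr1 (dot e)); rewrite mulr1 dotDr !dotZr ef mulr0 addr0 => h.
    by apply: (mulIf (lt0r_neq0 (dot_gt0 e0))); rewrite h mul1r.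
  by move/eq_row_mx: ex => [h1 h2]; split; [exact: cs (e10 k1) ce h1|exact: cs f10 cf h2].
- move=> [r0 q0 pp uu]; left.
  have sq (z : int) : z ^+ 2 = 1 -> z%:~R ^+ 2 = 1 :> R by move=> h; rewrite -rmorphXn /= h.
  split; [apply/eqP; by rewrite -dot_eq0 p2 r0 expr0n mul0r|apply/eqP; by rewrite -dot_eq0 q1 q0 expr0n mul0r|by rewrite p1 sq// mul1r|by rewrite q2 sq// mul1r].
move=> [r0 q0 pp uu]; right.
have sq (z : int) : z ^+ 2 = 1 -> z%:~R ^+ 2 = 1 :> R by move=> h; rewrite -rmorphXn /= h.
split; [apply/eqP; by rewrite -dot_eq0 p1 r0 expr0n mul0r|apply/eqP; by rewrite -dot_eq0 q2 q0 expr0n mul0r|by rewrite p2 sq// mul1r|by rewrite q1 sq// mul1r].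
Qed.

Let sinc (s : R) : sin `|s| / `|s| * s = sin s.
Proof.
have [->|s0] := eqVneq s 0; first by rewrite mulr0 sin0.
case: (ger0P s) => _; first by rewrite divfK.
by rewrite sinN invrN mulrNN divfK.
Qed.

Let unit_speed n (G X : 'rV[R]_n) (s : R) : G != 0 -> dot X X = dot G G ->
  cos (enorm (s *: X) / enorm G * 1) *: G +
    (sin (enorm (s *: X) / enorm G * 1) / (enorm (s *: X) / enorm G)) *: (s *: X) =
  cos s *: G + sin s *: X.
Proof.
move=> G0 XG; have -> : enorm (s *: X) / enorm G = `|s|.
  have -> : enorm (s *: X) = `|s| * enorm G.
    rewrite !enormE -sqrtr_sqr -sqrtrM ?sqr_ge0//; congr Num.sqrt.
    by rewrite dotZl dotZr XG mulrA -expr2.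
  by rewrite mulfK// gt_eqF// enorm_gt0.
rewrite mulr1 scalerA sinc; congr (_ *: _ + _).
by case: (ger0P s) => _; rewrite ?cosN.
Qed.

Lemma orbit_value e2 f2 (s t : R) : k != 1%N -> cpair e1 e2 -> cpair f1 f2 ->
  let X := e2 *m KX in let Y := f2 *m KY in
  let y := row_mx (cos s *: e1 + sin s *: e2) (cos t *: f1 + sin t *: f2) in
  ([/\ lsubmx Y = 0, rsubmx X = 0, dot (lsubmx X) (lsubmx X) = dot G1 G1
    & dot (rsubmx Y) (rsubmx Y) = dot G2 G2] ->
   lsubmx (Phi y) = cos s *: G1 + sin s *: lsubmx X /\
   rsubmx (Phi y) = cos t *: G2 + sin t *: rsubmx Y) /\
  ([/\ lsubmx X = 0, rsubmx Y = 0, dot (lsubmx Y) (lsubmx Y) = dot G1 G1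
    & dot (rsubmx X) (rsubmx X) = dot G2 G2] ->
   lsubmx (Phi y) = cos t *: G1 + sin t *: lsubmx Y /\
   rsubmx (Phi y) = cos s *: G2 + sin s *: rsubmx X).
Proof.
move=> k1 ce cf X Y y.
have [] := @geo e2 f2 s t 1 (or_intror (conj (e10 k1) ce)) (or_intror (conj f10 cf)).
rewrite {1}/tcur !mulr1 -/y => /(_ k1).
have -> : lsubmx (s *: (e2 *m KX) + t *: (f2 *m KY)) = s *: lsubmx X + t *: lsubmx Y.
  by apply/rowP => i; rewrite !mxE.
have -> : rsubmx (s *: (e2 *m KX) + t *: (f2 *m KY)) = s *: rsubmx X + t *: rsubmx Y.
  by apply/rowP => i; rewrite !mxE.
have -> : tcur e1 e2 f1 f2 s t 1 = y by rewrite /tcur !mulr1.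
move=> h1 h2; split=> -[a1 a2 a3 a4].
  split; [move: h1; rewrite a1 scaler0 addr0 => ->|move: h2; rewrite a2 scaler0 add0r => ->].
    by have := unit_speed s (G10 k1) a3; rewrite mulr1.
  by have := unit_speed t G20 a4; rewrite mulr1.
split; [move: h1; rewrite a1 scaler0 add0r => ->|move: h2; rewrite a2 scaler0 addr0 => ->].
  by have := unit_speed t (G10 k1) a3; rewrite mulr1.
by have := unit_speed s G20 a4; rewrite mulr1.
Qed.

Let polar1 (y : 'rV[R]_k) : k != 1%N -> dot y y = dot e1 e1 ->
  exists s e2, cpair e1 e2 /\ y = cos s *: e1 + sin s *: e2.
Proof. by move=> k1 h; apply: polar => //; [rewrite ltn_neqAle eq_sym k1|exact: e10]. Qed.

Let polar2 (y : 'rV[R]_m) : dot y y = dot f1 f1 ->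
  exists t f2, cpair f1 f2 /\ y = cos t *: f1 + sin t *: f2.
Proof. by move=> h; apply: polar. Qed.

Let same_orbit y : k != 1%N -> dot (lsubmx y) (lsubmx y) = dot e1 e1 ->
  dot (rsubmx y) (rsubmx y) = dot f1 f1 -> exists2 g, block_SO g & y = x *m g.
Proof.
move=> k1 h1 h2.
have k2 : (1 < k)%N by rewrite ltn_neqAle eq_sym k1.
have [A sA eA] := SO_transitive k2 h1.
have [B sB eB] := SO_transitive m1 h2.
exists (block_mx A 0 0 B); first by exists A, B.
by rewrite mul_block_diag row_mxKl row_mxKr -eA -eB hsubmxK.
Qed.

(** Great circles through [e1] and [f1] cover both spheres, so the value and the derivative at [x]
    determine [Phi] on the orbit; [olin] assembles them into matrices. In the second alternative the
    shapes of [L] and [M] force [k = m]. *)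
Lemma orbit_linear : k != 1%N ->
  (exists (L : 'M[R]_k) (M : 'M[R]_m) (a b : R),
    [/\ 0 < a, 0 < b, L *m L^T = 1%:M, M *m M^T = 1%:M &
     forall y, dot (lsubmx y) (lsubmx y) = dot e1 e1 -> dot (rsubmx y) (rsubmx y) = dot f1 f1 ->
      lsubmx (Phi y) = a *: (lsubmx y *m L) /\ rsubmx (Phi y) = b *: (rsubmx y *m M)]) \/
  (exists (L : 'M[R]_(m, k)) (M : 'M[R]_(k, m)) (a b : R),
    [/\ 0 < a, 0 < b, L *m L^T = 1%:M, M *m M^T = 1%:M &
     forall y, dot (lsubmx y) (lsubmx y) = dot e1 e1 -> dot (rsubmx y) (rsubmx y) = dot f1 f1 ->
      lsubmx (Phi y) = a *: (rsubmx y *m L) /\ rsubmx (Phi y) = b *: (lsubmx y *m M)]).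
Proof.
move=> k1; have k2 : (1 < k)%N by rewrite ltn_neqAle eq_sym k1.
have [e0 ce0] := exists_cpair e1 k2; have [f0 cf0] := exists_cpair f1 m1.
have N1 := dot_gt0 (G10 k1); have N2 := dot_gt0 G20.
have nz n (G X : 'rV[R]_n) : 0 < dot G G -> dot X X = dot G G -> X = 0 -> False.
  by move=> g e X0; move: g; rewrite -e X0 dot0l ltxx.
have val y : dot (lsubmx y) (lsubmx y) = dot e1 e1 -> dot (rsubmx y) (rsubmx y) = dot f1 f1 ->
    dot (lsubmx (Phi y)) (lsubmx (Phi y)) = dot G1 G1 /\
    dot (rsubmx (Phi y)) (rsubmx (Phi y)) = dot G2 G2.
  move=> h1 h2; have [g bg ->] := same_orbit k1 h1 h2.
  by have [h [bh ->]] := orb bg Cx; rewrite block_SO_dotl// block_SO_dotr.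
have [S0|W0] := torus_type k1 ce0 cf0; [left|right].
  have S e2 f2 : cpair e1 e2 -> cpair f1 f2 ->
    [/\ lsubmx (f2 *m KY) = 0, rsubmx (e2 *m KX) = 0,
      dot (lsubmx (e2 *m KX)) (lsubmx (e2 *m KX)) = dot G1 G1
    & dot (rsubmx (f2 *m KY)) (rsubmx (f2 *m KY)) = dot G2 G2].
    (* The type is the same for all partners: the mixed pair [(e0, f2)] shares a circle with each of
       the two pairs and cannot agree with both. *)
    move=> ce cf; have [//|W] := torus_type k1 ce cf; exfalso.
    have [S1|W1] := torus_type k1 ce0 cf.
      by case: S1 W => _ _ _ s4 [_ w2 _ _]; exact: nz N2 s4 w2.
    by case: S0 W1 => _ _ s3 _ [w1 _ _ _]; exact: nz N1 s3 w1.
  pose L := olin e1 G1 (lsubmx KX); pose M := olin f1 G2 (rsubmx KY).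
  have H y : dot (lsubmx y) (lsubmx y) = dot e1 e1 -> dot (rsubmx y) (rsubmx y) = dot f1 f1 ->
      lsubmx (Phi y) = lsubmx y *m L /\ rsubmx (Phi y) = rsubmx y *m M.
    move=> h1 h2; have [s [e2 [ce ey]]] := polar1 k1 h1; have [t [f2 [cf fy]]] := polar2 h2.
    have [V1 _] := orbit_value s t k1 ce cf; have := V1 (S _ _ ce cf).
    rewrite -ey -fy hsubmxK => -[-> ->].
    rewrite ey fy !olinE//; last exact: e10.
    by rewrite !mulmx_lsub !mulmx_rsub.
  have [a a0 [L' oL eL]] : exists2 a : R, 0 < a & exists2 L' : 'M[R]_(k, k), L' *m L'^T = 1%:M & L = a *: L'.
    apply: (conformal_sphere (e10 k1) N1) => y h.
    have [h1 h2] : dot (lsubmx (row_mx y f1)) (lsubmx (row_mx y f1)) = dot e1 e1 /\ dot (rsubmx (row_mx y f1)) (rsubmx (row_mx y f1)) = dot f1 f1.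
      by rewrite row_mxKl row_mxKr.
    by have [q _] := H _ h1 h2; have [<- _] := val _ h1 h2; rewrite q row_mxKl.
  have [b b0 [M' oM eM]] : exists2 b : R, 0 < b & exists2 M' : 'M[R]_(m, m), M' *m M'^T = 1%:M & M = b *: M'.
    apply: (conformal_sphere f10 N2) => y h.
    have [h1 h2] : dot (lsubmx (row_mx e1 y)) (lsubmx (row_mx e1 y)) = dot e1 e1 /\ dot (rsubmx (row_mx e1 y)) (rsubmx (row_mx e1 y)) = dot f1 f1.
      by rewrite row_mxKl row_mxKr.
    by have [_ q] := H _ h1 h2; have [_ <-] := val _ h1 h2; rewrite q row_mxKr.
  exists L', M', a, b; split=> // y h1 h2; have [-> ->] := H y h1 h2.
  by rewrite eL eM -!scalemxAr.
have S e2 f2 : cpair e1 e2 -> cpair f1 f2 ->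
  [/\ lsubmx (e2 *m KX) = 0, rsubmx (f2 *m KY) = 0,
    dot (lsubmx (f2 *m KY)) (lsubmx (f2 *m KY)) = dot G1 G1
  & dot (rsubmx (e2 *m KX)) (rsubmx (e2 *m KX)) = dot G2 G2].
  move=> ce cf; have [W|//] := torus_type k1 ce cf; exfalso.
  have [S1|W1] := torus_type k1 ce0 cf.
    by case: S1 W0 => _ s2 _ _ [_ _ _ w4]; exact: nz N2 w4 s2.
  by case: W W1 => s1 _ _ _ [_ _ w3 _]; exact: nz N1 w3 s1.
pose L := olin f1 G1 (lsubmx KY); pose M := olin e1 G2 (rsubmx KX).
have H y : dot (lsubmx y) (lsubmx y) = dot e1 e1 -> dot (rsubmx y) (rsubmx y) = dot f1 f1 ->
    lsubmx (Phi y) = rsubmx y *m L /\ rsubmx (Phi y) = lsubmx y *m M.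
  move=> h1 h2; have [s [e2 [ce ey]]] := polar1 k1 h1; have [t [f2 [cf fy]]] := polar2 h2.
  have [_ V1] := orbit_value s t k1 ce cf; have := V1 (S _ _ ce cf).
  rewrite -ey -fy hsubmxK => -[-> ->].
  rewrite ey fy !olinE//; last exact: e10.
  by rewrite !mulmx_lsub !mulmx_rsub.
have [a a0 [L' oL eL]] : exists2 a : R, 0 < a & exists2 L' : 'M[R]_(m, k), L' *m L'^T = 1%:M & L = a *: L'.
  apply: (conformal_sphere f10 N1) => y h.
  have [h1 h2] : dot (lsubmx (row_mx e1 y)) (lsubmx (row_mx e1 y)) = dot e1 e1 /\ dot (rsubmx (row_mx e1 y)) (rsubmx (row_mx e1 y)) = dot f1 f1.
    by rewrite row_mxKl row_mxKr.
  by have [q _] := H _ h1 h2; have [<- _] := val _ h1 h2; rewrite q row_mxKr.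
have [b b0 [M' oM eM]] : exists2 b : R, 0 < b & exists2 M' : 'M[R]_(k, m), M' *m M'^T = 1%:M & M = b *: M'.
  apply: (conformal_sphere (e10 k1) N2) => y h.
  have [h1 h2] : dot (lsubmx (row_mx y f1)) (lsubmx (row_mx y f1)) = dot e1 e1 /\ dot (rsubmx (row_mx y f1)) (rsubmx (row_mx y f1)) = dot f1 f1.
    by rewrite row_mxKl row_mxKr.
  by have [_ q] := H _ h1 h2; have [_ <-] := val _ h1 h2; rewrite q row_mxKl.
exists L', M', a, b; split=> // y h1 h2; have [-> ->] := H y h1 h2.
by rewrite eL eM -!scalemxAr.
Qed.

(** Only one circle is available. Its image has an integer speed [r], nonzero by the isometry; the
    angle [2 pi / r] closes the image, so by injectivity it is a multiple of [2 pi], and [r] is 1 or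
    -1. *)
Lemma orbit_linear1 : k == 1%N ->
  exists (M : 'M[R]_m) (b : R), [/\ 0 < b, M *m M^T = 1%:M &
     forall y, lsubmx y = e1 -> dot (rsubmx y) (rsubmx y) = dot f1 f1 ->
      rsubmx (Phi y) = b *: (rsubmx y *m M)].
Proof.
move=> k1; have N2 := dot_gt0 G20.
have hg f2 (b l : R) (cf : cpair f1 f2) :
    rsubmx (Phi (row_mx e1 (cos (b * l) *: f1 + sin (b * l) *: f2))) =
    cos (enorm (b *: rsubmx (f2 *m KY)) / enorm G2 * l) *: G2 +
    (sin (enorm (b *: rsubmx (f2 *m KY)) / enorm G2 * l) /
      (enorm (b *: rsubmx (f2 *m KY)) / enorm G2)) *: (b *: rsubmx (f2 *m KY)).
  have [_] := @geo 0 f2 0 b l (or_introl erefl) (or_intror (conj f10 cf)).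
  rewrite /tcur mul0r cos0 sin0 !scale0r addr0 scale1r add0r => ->.
  by have -> : rsubmx (b *: (f2 *m KY)) = b *: rsubmx (f2 *m KY) by apply/rowP => i; rewrite !mxE.
have speed f2 : cpair f1 f2 -> dot (rsubmx (f2 *m KY)) (rsubmx (f2 *m KY)) = dot G2 G2.
  move=> cf; have [oY1 oY2] := orthY cf; rewrite k1 in oY1.
  pose Y := rsubmx (f2 *m KY).
  have [_ [r [_ r2 _]]] : exists p r : int, [/\ dot (0 : 'rV[R]_m) 0 = p%:~R ^+ 2 * dot G2 G2,
      dot Y Y = r%:~R ^+ 2 * dot G2 G2 & dot 0 Y = p%:~R * r%:~R * dot G2 G2].
    apply: block_period G20 (dot0r _) oY2 _ => i j; have := hg f2 j%:~R (pi *+ 2) cf.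
    by rewrite cos_int (sin_of_cos (cos_int _)) scale0r addr0 scale1r scaler0 add0r.
  have b2 : 0 < beta F2 (Phi x) by apply: beta_gt0 => //; exact: regI.
  have b1 : 0 < beta F1 x by apply: beta_gt0 => //; exact: regC.
  have EY : 'D_(row_mx 0 f2) Phi x = f2 *m KY by rewrite DE mul0mx add0r.
  have iYY := it (row_mx 0 f2) (tangY cf).
  rewrite EY /oform oY1 !row_mxKl !row_mxKr !dot0l -/Y r2 cf.1 !mulr0 !add0r in iYY.
  have r0 : r != 0.
    apply/eqP => r0; move: iYY; rewrite r0 expr0n mul0r mulr0 => h.
    by have := mulr_gt0 b1 (dot_gt0 f10); rewrite -h ltxx.
  have rR : r%:~R != 0 :> R by rewrite intr_eq0.
  pose t : R := pi *+ 2 / r%:~R.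
  have ct : cos t = 1.
    have wt : enorm (t *: Y) / enorm G2 = `|pi *+ 2|.
      have := @block_speed R m G2 Y 0 r%:~R 0 t 0 G20 r2.
      rewrite scale0r addr0 mul0r addr0 => -> //; last by rewrite dot0r mulr0 mul0r.
        by rewrite /t mulrC divfK.
      by rewrite dot0l expr0n mul0r.
    have cw : cos `|pi *+ 2 : R| = 1 by rewrite ger0_norm ?cos2pi// mulrn_wge0// pi_ge0.
    have ey : row_mx e1 (cos t *: f1 + sin t *: f2) = x.
      have [g bg eg] : exists2 g, block_SO g & row_mx e1 (cos t *: f1 + sin t *: f2) = x *m g.
        exists (block_mx 1%:M 0 0 (rotm f1 f2 t)).
          by exists 1%:M, (rotm f1 f2 t); split; [exact: SOmx1|split=> //; exact: rotm_SO].
        by rewrite mul_block_diag row_mxKl row_mxKr mulmx1 rotm_e.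
      apply: inj => //; first by rewrite eg; apply: CG.
      rewrite -[LHS]hsubmxK -[RHS]hsubmxK; congr row_mx.
        by rewrite eg; have [h [bh ->]] := orb bg Cx; apply: block_SO_l1.
      have := hg f2 t 1 cf; rewrite wt !mulr1 cw (sin_of_cos cw) mul0r scale0r addr0 scale1r.
      by [].
    move/eq_row_mx: ey => [_ /(congr1 (dot f1))]; rewrite dotDr !dotZr cf.2 mulr0 addr0 => h.
    by apply: (mulIf (lt0r_neq0 (dot_gt0 f10))); rewrite h mul1r.
  have p20 : (pi : R) *+ 2 != 0 by rewrite gt_eqF// pmulrn_lgt0// pi_gt0.
  have [i ei] := cos_eq1 ct.
  have ri : r * i = 1.
    apply: (@intr_inj R); rewrite intrM; apply: (mulfI p20).
    by rewrite mulrCA -ei /t mulr1 mulrC divfK.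
  by rewrite -/Y r2 -rmorphXn /= (int_mul_sqr1 (or_introl ri)).1 mul1r.
pose M := olin f1 G2 (rsubmx KY).
have H y : lsubmx y = e1 -> dot (rsubmx y) (rsubmx y) = dot f1 f1 -> rsubmx (Phi y) = rsubmx y *m M.
  move=> h1 h2; have [t [f2 [cf fy]]] := polar2 h2.
  have := hg f2 t 1 cf; rewrite (unit_speed t G20 (speed f2 cf)) mulr1 -fy -h1 hsubmxK => ->.
  by rewrite fy olinE// mulmx_rsub.
have [b b0 [M' oM eM]] : exists2 b : R, 0 < b & exists2 M' : 'M[R]_(m, m), M' *m M'^T = 1%:M & M = b *: M'.
  apply: (conformal_sphere f10 N2) => y h.
  have [B sB eB] := SO_transitive m1 h.
  have h1 : lsubmx (row_mx e1 y) = e1 by rewrite row_mxKl.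
  have h2 : dot (rsubmx (row_mx e1 y)) (rsubmx (row_mx e1 y)) = dot f1 f1 by rewrite row_mxKr.
  have := H _ h1 h2; rewrite row_mxKr => <-.
  have -> : row_mx e1 y = x *m block_mx 1%:M 0 0 B.
    by rewrite mul_block_diag row_mxKl row_mxKr mulmx1 eB.
  have bg : block_SO (block_mx 1%:M 0 0 B : 'M[R]_(k + m)).
    by exists 1%:M, B; split; [exact: SOmx1|].
  by have [h' [bh ->]] := orb bg Cx; rewrite block_SO_dotr.
exists M', b; split=> // y h1 h2; rewrite H// eM -scalemxAr //.
Qed.

End OrbitMap.

(** From [G' = c G] follows [|G|' = c |G|], so [G / |G|] has derivative 0. *)
Lemma direction_constant (R : realType) n (G : R -> 'rV[R]_n) (a b : R) : a <= b ->
  (forall T, a <= T <= b -> G T != 0 /\ exists2 dG, vderive G T dG & exists c, dG = c *: G T) ->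
  exists2 c : R, 0 < c & G b = c *: G a.
Proof.
move=> ab h.
have Ga : G a != 0 by have [] := h a; rewrite ?lexx.
have Gb : G b != 0 by have [] := h b; rewrite ?lexx ?ab.
pose N T := Num.sqrt (dot (G T) (G T)).
have N0 T : G T != 0 -> 0 < N T by move=> g; rewrite sqrtr_gt0 dot_gt0.
have d j T : a <= T <= b -> is_derive T 1 ((fun t => G t 0 j) * (fun t => (N t)^-1)) 0.
  move=> /h[g [dG hG [c e]]].
  have dd := vderive_dot hG hG; rewrite e dotZl dotZr in dd.
  have ds := @is_derive1_comp R Num.sqrt (fun t => dot (G t) (G t)) T _ _
    (is_derive1_sqrt (dot_gt0 g)) dd.
  have nz : N T != 0 by rewrite gt_eqF// N0.
  have dN : is_derive T 1 N (c * N T).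
    apply: (is_derive_eq ds); rewrite -/(N T).
    have -> : dot (G T) (G T) = N T ^+ 2 by rewrite sqr_sqrtr// dot_ge0.
    by field.
  have dV := DeriveDef (derivableV nz (@ex_derive _ _ _ _ _ _ _ dN))
    (deriveV nz (@ex_derive _ _ _ _ _ _ _ dN)).
  have dM := is_deriveM (hG j) dV.
  apply: (is_derive_eq dM); rewrite (@derive_val _ _ _ _ _ _ _ dN) e mxE /GRing.scale /=.
  by field.
have E j : G b 0 j * (N b)^-1 = G a 0 j * (N a)^-1.
  have c : {within `[a, b], continuous ((fun t => G t 0 j) * (fun t => (N t)^-1))}.
    apply: derivable_within_continuous => T; rewrite in_itv /= => /(d j) dT.
    exact: (@ex_derive _ _ _ _ _ _ _ dT).
  have d' (T : R) : T \in `]a, b[%R ->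
      is_derive T 1 ((fun t => G t 0 j) * (fun t => (N t)^-1)) ((cst 0 : R -> R) T).
    by rewrite in_itv /= => /andP[t1 t2]; apply: d; rewrite !ltW.
  have [T _] := MVT_segment ab d' c; rewrite /= mul0r => /eqP; rewrite subr_eq0 => /eqP.
  by [].
exists (N b / N a); first by rewrite divr_gt0// N0.
by apply/rowP => j; rewrite mxE mulrAC -mulrA -E mulrCA mulfV ?mulr1// gt_eqF// N0.
Qed.

(** * From one orbit to another *)

Section Transport.
Context {R : realType} {k m : nat}.
Local Notation V := 'rV[R]_(k + m).
Variables (F1 F2 : V -> R) (C : set V) (Phi : V -> V).
Hypotheses (k0 : (0 < k)%N) (m1 : (1 < m)%N).
Hypotheses (mF1 : minkowski_norm F1) (mF2 : minkowski_norm F2).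
Hypotheses (iF1 : G_invariant_fun F1) (iF2 : G_invariant_fun F2).
Hypotheses (oC : open C) (CG : G_invariant_set C) (sPhi : smooth_on C Phi).
Hypothesis iso : forall x u v, C x ->
  hess_metric F2 (Phi x) ('D_u Phi x) ('D_v Phi x) = hess_metric F1 x u v.
Hypothesis orb : maps_orbits_into_orbits C Phi.
Hypotheses (regC : forall x, C x -> regular_pt x) (regI : forall x, C x -> regular_pt (Phi x)).
Hypothesis inj : forall x y, C x -> C y -> Phi x = Phi y -> x = y.
Hypothesis conC : conic C.
Hypothesis hom : forall (l : R) x, 0 < l -> C x -> Phi (l *: x) = l *: Phi x.
Hypothesis cC : connected C.

(* The cotangent of the polar angle: it parametrizes the orbits in [C] up to scaling. *)
Definition slope (x : V) : R :=
  (if k == 1%N then \sum_i lsubmx x 0 i else enorm (lsubmx x)) / enorm (rsubmx x).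

(** For [k = 1] the first vector is fixed, because [slope] carries the sign of [x_1]. *)
Definition uframe (e : 'rV[R]_k) (f : 'rV[R]_m) :=
  dot f f = 1 /\ if k == 1%N then e = const_mx 1 else dot e e = 1.

Let k2 : k != 1%N -> (1 < k)%N. Proof. by move=> k1; rewrite ltn_neqAle eq_sym k1. Qed.

(** For any frame, the line [T |-> (T e, f)] meets the orbit of [x], up to a positive factor, at
    [T = slope x]. *)
Lemma scaled_frame x e f : C x -> uframe e f -> exists2 g, block_SO g &
  enorm (rsubmx x) *: row_mx (slope x *: e) f = x *m g.
Proof.
move=> Cx [f1 e1]; have [x1 x2] := regC Cx; have r0 := enorm_gt0 x2.
have rs : enorm (rsubmx x) * slope x = if k == 1%N then \sum_i lsubmx x 0 i else enorm (lsubmx x).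
  by rewrite /slope mulrC divfK// gt_eqF.
have [B sB eB] : exists2 B, SOmx B & enorm (rsubmx x) *: f = rsubmx x *m B.
  by apply: SO_transitive => //; rewrite dotZl dotZr f1 mulr1 -expr2 enorm_sqr.
have [A sA eA] : exists2 A, SOmx A & enorm (rsubmx x) *: (slope x *: e) = lsubmx x *m A.
  rewrite scalerA rs; case: ifP e1 => [k1 e1|k1 e1].
    exists 1%:M; first exact: SOmx1.
    apply/rowP => i; rewrite mulmx1 e1 !mxE mulr1 (bigD1 i)//= big1 ?addr0 ?mxE// => j ji.
    by case/eqP: ji; apply/val_inj; move/eqP: k1; case: (i) (j) => [a ?] [b ?] /=; lia.
  by apply: SO_transitive; rewrite ?k2 ?k1// dotZl dotZr e1 mulr1 -expr2 enorm_sqr.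
exists (block_mx A 0 0 B); first by exists A, B.
by rewrite mul_block_diag scale_row_mx eA eB.
Qed.

Lemma line_in_C x e f : C x -> uframe e f -> C (row_mx (slope x *: e) f).
Proof.
move=> Cx ef; have [g bg eg] := scaled_frame Cx ef.
have r0 := enorm_gt0 (regC Cx).2.
have -> : row_mx (slope x *: e) f = (enorm (rsubmx x))^-1 *: (x *m g).
  by rewrite -eg scalerA mulVf ?scale1r// gt_eqF.
by apply: conC; [rewrite invr_gt0|apply: CG].
Qed.

Lemma slope_continuous x : C x -> {for x, continuous slope}.
Proof.
move=> Cx; have [x1 x2] := regC Cx.
have vid := vdiff_mulmx (1%:M : 'M[R]_(k + m)) x 0.
have [dl _] := vdiff_dotl vid vid; have [dr _] := vdiff_dotr vid vid.
have cl := differentiable_continuous dl; have cr := differentiable_continuous dr.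
have cs (h : V -> R) : {for x, continuous h} -> {for x, continuous (fun y => Num.sqrt (h y))}.
  by move=> ch; apply: (cvg_comp _ _ ch (@sqrt_continuous R _)).
have E : slope = (fun y => (if k == 1%N then \sum_i lsubmx y 0 i else
    Num.sqrt (dot (lsubmx (y *m 1%:M)) (lsubmx (y *m 1%:M))))) *
    (fun y => (Num.sqrt (dot (rsubmx (y *m 1%:M)) (rsubmx (y *m 1%:M))))^-1).
  by apply/funext => y; rewrite /slope !enormE -[RHS]/(_ * _) mulmx1.
rewrite E; apply: (@continuousM R); last first.
  by apply: continuousV; [rewrite mulmx1 gt_eqF// sqrtr_gt0 dot_gt0|exact: cs].
case: (k == 1%N); last exact: cs.
have -> : (fun y : V => \sum_i lsubmx y 0 i) = \sum_i (fun y : V => y 0 (lshift m i)).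
  by apply/funext => y; rewrite fct_sumE; apply: eq_bigr => i _; rewrite mxE.
apply: differentiable_continuous; apply: differentiable_sum => i.
exact: differentiable_coord.
Qed.

(** Here the connectedness of [C] enters: its image under [slope] is an interval. *)
Lemma slope_interval x0 x T : C x0 -> C x -> slope x0 <= T <= slope x ->
  exists2 y, C y & slope y = T.
Proof.
move=> C0 Cx hT.
have cI : connected (slope @` C).
  apply: connected_continuous_connected => //.
  by apply: continuous_in_subspaceT => y /set_mem Cy; apply: slope_continuous.
have /connected_intervalP iI := cI.
have [y Cy e] : (slope @` C) T.
  by apply: (iI (slope x0) (slope x)) hT; [exists x0|exists x].
by exists y.
Qed.

(** The segment of the line [(T e, f)] between the two slopes lies in [C]. Along it the derivative
    of each block is radial by [Phi_radial], and [direction_constant] applies. *)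
Lemma transport x0 x e f : C x0 -> C x -> uframe e f -> slope x0 <= slope x ->
  let z0 := row_mx (slope x0 *: e) f in let z := row_mx (slope x *: e) f in
  (exists2 c : R, 0 < c & rsubmx (Phi z) = c *: rsubmx (Phi z0)) /\
  (k != 1%N -> exists2 c : R, 0 < c & lsubmx (Phi z) = c *: lsubmx (Phi z0)).
Proof.
move=> C0 Cx ef le z0 z.
have line T : slope x0 <= T <= slope x -> C (row_mx (T *: e) f).
  by move=> hT; have [y Cy <-] := slope_interval C0 Cx hT; apply: line_in_C.
have rad T (hT : slope x0 <= T <= slope x) :
  let v := 'D_(row_mx e 0) Phi (row_mx (T *: e) f) in
  (k != 1%N -> exists c, lsubmx v = c *: lsubmx (Phi (row_mx (T *: e) f))) /\
  exists c, rsubmx v = c *: rsubmx (Phi (row_mx (T *: e) f)).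
  apply: (Phi_radial k0 m1 mF1 mF2 iF1 iF2 oC sPhi iso orb regC regI (line T hT)) => k1.
  have [/(_ k1)] := regC (line T hT); rewrite row_mxKl => Te _.
  have T0 : T != 0 by apply: contra Te => /eqP ->; rewrite scale0r.
  by exists T^-1; rewrite scalerA mulVf// scale1r.
have der T (hT : slope x0 <= T <= slope x) :
    vderive (fun t => Phi (row_mx (t *: e) f)) T ('D_(row_mx e 0) Phi (row_mx (T *: e) f)).
  move=> j; have c1 := smooth_C1v [::] oC sPhi.
  have E t : row_mx (t *: e) f = row_mx 0 f + t *: row_mx e 0.
    by rewrite scale_row_mx scaler0 add_row_mx add0r addr0.
  have CT : C (row_mx 0 f + T *: row_mx e 0) by rewrite -E; apply: line.
  have dd := (c1.2 j _ CT (row_mx e 0)).1.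
  have := is_derive_line dd.
  rewrite (derive_coord j (c1.1 _ CT (row_mx e 0))) -E.
  by rewrite (_ : (fun s => Phi (row_mx 0 f + s *: row_mx e 0) 0 j) =
    (fun s => Phi (row_mx (s *: e) f) 0 j))//; apply/funext => t; rewrite E.
have bl (h : R -> V) l dh : vderive h l dh -> vderive (fun t => lsubmx (h t)) l (lsubmx dh).
  move=> hh j; rewrite mxE (_ : (fun t => lsubmx (h t) 0 j) = fun t => h t 0 (lshift m j)).
    exact: hh.
  by apply/funext => y; rewrite mxE.
have br (h : R -> V) l dh : vderive h l dh -> vderive (fun t => rsubmx (h t)) l (rsubmx dh).
  move=> hh j; rewrite mxE (_ : (fun t => rsubmx (h t) 0 j) = fun t => h t 0 (rshift k j)).
    exact: hh.
  by apply/funext => y; rewrite mxE.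
split=> [|k1].
  apply: (direction_constant (G := fun t => rsubmx (Phi (row_mx (t *: e) f))) le) => T hT.
  split; first exact: (regI (line T hT)).2.
  by eexists; [exact: br (der T hT)|exact: (rad T hT).2].
apply: (direction_constant (G := fun t => lsubmx (Phi (row_mx (t *: e) f))) le) => T hT.
split; first exact: (regI (line T hT)).1.
by eexists; [exact: bl (der T hT)|exact: (rad T hT).1].
Qed.

Lemma transport_sym x0 x e f : C x0 -> C x -> uframe e f ->
  let z0 := row_mx (slope x0 *: e) f in let z := row_mx (slope x *: e) f in
  (exists2 c : R, 0 < c & rsubmx (Phi z) = c *: rsubmx (Phi z0)) /\
  (k != 1%N -> exists2 c : R, 0 < c & lsubmx (Phi z) = c *: lsubmx (Phi z0)).
Proof.
move=> C0 Cx ef z0 z; have [le|/ltW le] := leP (slope x0) (slope x); first exact: transport.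
have [h1 h2] := transport Cx C0 ef le.
have flip n (u v : 'rV[R]_n) : (exists2 c : R, 0 < c & u = c *: v) -> exists2 c : R, 0 < c & v = c *: u.
  move=> [c c0 ->]; exists c^-1; first by rewrite invr_gt0.
  by rewrite scalerA mulVf ?scale1r// gt_eqF.
by split=> [|k1]; apply: flip; [exact: h1|exact: h2].
Qed.

Lemma frame_of x : C x -> exists e f, uframe e f /\
  x = enorm (rsubmx x) *: row_mx (slope x *: e) f.
Proof.
move=> Cx; have [x1 x2] := regC Cx; have r0 := enorm_gt0 x2.
exists (if k == 1%N then const_mx 1 else (enorm (lsubmx x))^-1 *: lsubmx x),
  ((enorm (rsubmx x))^-1 *: rsubmx x).
have nrm n (v : 'rV[R]_n) : v != 0 -> dot ((enorm v)^-1 *: v) ((enorm v)^-1 *: v) = 1.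
  by move=> v0; have := enorm_gt0 v0 => p; rewrite dotZl dotZr -enorm_sqr; field; rewrite gt_eqF.
split; first by split; [exact: nrm|case: (boolP (k == 1%N)) => // k1; apply: nrm; exact: x1].
have Er : enorm (rsubmx x) * (enorm (rsubmx x))^-1 = 1 by rewrite mulfV// gt_eqF.
rewrite scale_row_mx [_ *: (_^-1 *: rsubmx x)]scalerA Er scale1r scalerA.
have -> : enorm (rsubmx x) * slope x = if k == 1%N then \sum_i lsubmx x 0 i else enorm (lsubmx x).
  by rewrite /slope mulrC divfK// gt_eqF.
rewrite -{1}[x]hsubmxK; congr row_mx; case: (boolP (k == 1%N)) => k1; last first.
  by rewrite scalerA mulfV ?scale1r// gt_eqF// enorm_gt0// x1.
apply/rowP => i; rewrite [RHS]mxE [const_mx _ _ _]mxE mulr1 (bigD1 i)//= big1 ?addr0// => j ji.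
by case/eqP: ji; apply/val_inj; move/eqP: k1; case: (i) (j) => [a ?] [b ?] /=; lia.
Qed.

(* Reduces the direction of [Phi x] to the orbit of a fixed base point. *)
Lemma base_point x0 x : C x0 -> C x -> exists y, [/\ C y,
    exists2 g, block_SO g & y = x0 *m g,
    exists2 c : R, 0 < c & rsubmx y = c *: rsubmx x,
    k != 1%N -> exists2 c : R, 0 < c & lsubmx y = c *: lsubmx x &
    (exists2 c : R, 0 < c & rsubmx (Phi x) = c *: rsubmx (Phi y)) /\
    (k != 1%N -> exists2 c : R, 0 < c & lsubmx (Phi x) = c *: lsubmx (Phi y))].
Proof.
move=> C0 Cx; have [e [f [ef ex]]] := frame_of Cx.
have [g bg eg] := scaled_frame C0 ef.
have [h1 h2] := transport_sym C0 Cx ef.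
have r := enorm_gt0 (regC Cx).2; have r0 := enorm_gt0 (regC C0).2.
exists (x0 *m g); have Cy : C (x0 *m g) by apply: CG.
have sl y : C y -> k != 1%N -> 0 < slope y.
  move=> Cy' k1; rewrite /slope (negbTE k1) divr_gt0// enorm_gt0//; [exact: (regC Cy').1|exact: (regC Cy').2].
have Pz0 : Phi (x0 *m g) = enorm (rsubmx x0) *: Phi (row_mx (slope x0 *: e) f).
  by rewrite -eg hom//; apply: line_in_C.
have Pz : Phi x = enorm (rsubmx x) *: Phi (row_mx (slope x *: e) f).
  by rewrite {1}ex hom//; apply: line_in_C.
have lsubZ (c : R) (v : V) : lsubmx (c *: v) = c *: lsubmx v by apply/rowP => i; rewrite !mxE.
have rsubZ (c : R) (v : V) : rsubmx (c *: v) = c *: rsubmx v by apply/rowP => i; rewrite !mxE.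
have rx : rsubmx x = enorm (rsubmx x) *: f by rewrite {1}ex rsubZ row_mxKr.
have lx : lsubmx x = (enorm (rsubmx x) * slope x) *: e by rewrite {1}ex lsubZ row_mxKl scalerA.
have ef' : f = (enorm (rsubmx x))^-1 *: rsubmx x.
  by apply: (scalerI (lt0r_neq0 r)); rewrite scalerA mulfV ?gt_eqF// scale1r -rx.
have ee' : k != 1%N -> e = (enorm (rsubmx x) * slope x)^-1 *: lsubmx x.
  move=> k1; have p := mulr_gt0 r (sl _ Cx k1).
  by apply: (scalerI (lt0r_neq0 p)); rewrite scalerA mulfV ?gt_eqF// scale1r -lx.
clear rx lx.
split=> //; first by exists g.
- exists (enorm (rsubmx x0) / enorm (rsubmx x)); first by rewrite divr_gt0.
  by rewrite -eg rsubZ row_mxKr {1}ef' scalerA.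
- move=> k1; exists (enorm (rsubmx x0) * slope x0 / (enorm (rsubmx x) * slope x)).
    by rewrite divr_gt0// mulr_gt0// sl.
  by rewrite -eg lsubZ row_mxKl {1}(ee' k1) !scalerA.
split=> [|k1].
  have [c c0 ec] := h1; exists (enorm (rsubmx x) * c / enorm (rsubmx x0)).
    by rewrite divr_gt0// mulr_gt0.
  by rewrite Pz Pz0 !rsubZ ec !scalerA divfK// gt_eqF.
have [c c0 ec] := h2 k1; exists (enorm (rsubmx x) * c / enorm (rsubmx x0)).
  by rewrite divr_gt0// mulr_gt0.
by rewrite Pz Pz0 !lsubZ ec !scalerA divfK// gt_eqF.
Qed.

End Transport.

(** * One orthogonal map for all orbits *)

Section Alignment.
Context {R : realType} {k m : nat}.
Local Notation V := 'rV[R]_(k + m).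
Variables (F1 F2 : V -> R) (C : set V) (Phi : V -> V).
Hypotheses (k0 : (0 < k)%N) (m1 : (1 < m)%N).
Hypotheses (mF1 : minkowski_norm F1) (mF2 : minkowski_norm F2).
Hypotheses (iF1 : G_invariant_fun F1) (iF2 : G_invariant_fun F2).
Hypotheses (oC : open C) (CG : G_invariant_set C) (sPhi : smooth_on C Phi).
Hypothesis iso : forall x u v, C x ->
  hess_metric F2 (Phi x) ('D_u Phi x) ('D_v Phi x) = hess_metric F1 x u v.
Hypothesis orb : maps_orbits_into_orbits C Phi.
Hypotheses (regC : forall x, C x -> regular_pt x) (regI : forall x, C x -> regular_pt (Phi x)).
Hypothesis inj : forall x y, C x -> C y -> Phi x = Phi y -> x = y.
Hypothesis conC : conic C.
Hypothesis hom : forall (l : R) x, 0 < l -> C x -> Phi (l *: x) = l *: Phi x.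
Hypothesis cC : connected C.

(* [Psi] acts on each orbit only through the two block radii. *)
Definition orbitwise_radial (Psi : V -> V) := forall x, C x ->
  [/\ exists2 b : R, 0 < b & rsubmx (Psi x) = b *: rsubmx x,
      k != 1%N -> exists2 a : R, 0 < a & lsubmx (Psi x) = a *: lsubmx x &
      forall g, block_SO g ->
        enorm (rsubmx (Psi (x *m g))) = enorm (rsubmx (Psi x)) /\
        if k == 1%N then lsubmx (Psi (x *m g)) = lsubmx (Psi x)
        else enorm (lsubmx (Psi (x *m g))) = enorm (lsubmx (Psi x))].

Let orth_back n p (M : 'M[R]_(n, p)) u v (c : R) : M *m M^T = 1%:M -> v = c *: (u *m M) ->
  v *m M^T = c *: u /\ enorm (v *m M^T) = enorm v.
Proof.
move=> oM ->; rewrite -scalemxAl -mulmxA oM mulmx1; split=> //.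
by rewrite !enormE !dotE [dot (u *m M) _]dot_mulmx -mulmxA oM mulmx1.
Qed.

Let orbl x g : C x -> block_SO g -> enorm (lsubmx (Phi (x *m g))) = enorm (lsubmx (Phi x)).
Proof.
by move=> Cx bg; have [h [bh ->]] := orb bg Cx; rewrite !enormE block_SO_dotl.
Qed.

Let orbr x g : C x -> block_SO g -> enorm (rsubmx (Phi (x *m g))) = enorm (rsubmx (Phi x)).
Proof.
by move=> Cx bg; have [h [bh ->]] := orb bg Cx; rewrite !enormE block_SO_dotr.
Qed.

(** [P] comes from the orbit of [x0]. For any other [x], [base_point] gives a point of that orbit
    with the same block directions, before and after [Phi], so [P^T] brings the blocks of [Phi x]
    back to the directions of [x]. *)
Lemma alignment x0 : C x0 ->
  exists2 P : 'M[R]_(k + m), P *m P^T = 1%:M & orbitwise_radial (fun x => Phi x *m P^T).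
Proof.
move=> C0.
have C0' : C (row_mx (lsubmx x0) (rsubmx x0)) by rewrite hsubmxK.
have bp x : C x -> _ := fun Cx => base_point k0 m1 mF1 mF2 iF1 iF2 oC CG sPhi iso orb regC regI
  conC hom cC C0 Cx.
have [k1|k1] := eqVneq k 1%N.
  have k1' : k == 1%N by rewrite k1.
  have [M [b [b0 oM H]]] := orbit_linear1 k0 m1 mF1 mF2 iF1 iF2 oC CG sPhi iso orb regC regI
    inj C0' k1'.
  (* For [k = 1] the first coordinate of the image is left alone: being constant on orbits, it is a
     matter of [rho] and [theta]. *)
  exists (block_mx 1%:M 0 0 M).
    rewrite tr_block_mx !trmx0 trmx1 mulmx_block !mulmx0 !mul0mx !addr0 !add0r mulmx1 oM.
    by rewrite -scalar_mx_block.
  have G x : C x -> exists2 c : R, 0 < c & rsubmx (Phi x) = c *: (rsubmx x *m M).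
    move=> Cx; have [y [Cy [g bg ey] [c c0 er] _ [[d d0 ed] _]]] := bp x Cx.
    exists (d * b * c); first by rewrite !mulr_gt0.
    rewrite ed H ?ey; first by rewrite -ey er -scalemxAl !scalerA.
      by rewrite block_SO_l1.
    by rewrite block_SO_dotr.
  have E (v : V) : v *m (block_mx 1%:M 0 0 M)^T = row_mx (lsubmx v) (rsubmx v *m M^T).
    by rewrite tr_block_mx !trmx0 trmx1 mul_block_diag mulmx1.
  move=> x Cx; have [c c0 ec] := G x Cx; have [h1 h2] := orth_back oM ec.
  split.
  - by exists c; rewrite // E row_mxKr.
  - by rewrite k1'.
  move=> g bg; have [c' _ ec'] := G _ (CG bg Cx); have [_ h2'] := orth_back oM ec'.
  rewrite !E !row_mxKr !row_mxKl k1' h2 h2' orbr//; split=> //.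
  by have [h [bh ->]] := orb bg Cx; rewrite block_SO_l1.
have := orbit_linear k0 m1 mF1 mF2 iF1 iF2 oC CG sPhi iso orb regC regI inj C0' k1.
case=> [[L [M [a [b [a0 b0 oL oM H]]]]]|[L [M [a [b [a0 b0 oL oM H]]]]]].
  exists (block_mx L 0 0 M).
    rewrite tr_block_mx !trmx0 mulmx_block !mulmx0 !mul0mx !addr0 !add0r oL oM.
    by rewrite -scalar_mx_block.
  have G x : C x -> (exists2 c : R, 0 < c & lsubmx (Phi x) = c *: (lsubmx x *m L)) /\
      exists2 c : R, 0 < c & rsubmx (Phi x) = c *: (rsubmx x *m M).
    move=> Cx; have [y [Cy [g bg ey] [c c0 er] /(_ k1)[c' c'0 el] [[d d0 ed] /(_ k1)[d' d'0 ed']]]] := bp x Cx.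
    have n1 : dot (lsubmx y) (lsubmx y) = dot (lsubmx x0) (lsubmx x0) by rewrite ey block_SO_dotl.
    have n2 : dot (rsubmx y) (rsubmx y) = dot (rsubmx x0) (rsubmx x0) by rewrite ey block_SO_dotr.
    have [H1 H2] := H y n1 n2.
    split; [exists (d' * a * c')|exists (d * b * c)]; rewrite ?mulr_gt0//.
      by rewrite ed' H1 el -scalemxAl !scalerA.
    by rewrite ed H2 er -scalemxAl !scalerA.
  have E (v : V) : v *m (block_mx L 0 0 M)^T = row_mx (lsubmx v *m L^T) (rsubmx v *m M^T).
    by rewrite tr_block_mx !trmx0 mul_block_diag.
  move=> x Cx; have [[c c0 ec] [d d0 ed]] := G x Cx.
  have [h1 h2] := orth_back oL ec; have [h3 h4] := orth_back oM ed.
  split.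
  - by exists d; rewrite // E row_mxKr.
  - by exists c; rewrite // E row_mxKl.
  move=> g bg; have [[c' _ ec'] [d' _ ed']] := G _ (CG bg Cx).
  have [_ h2'] := orth_back oL ec'; have [_ h4'] := orth_back oM ed'.
  by rewrite !E !row_mxKr !row_mxKl (negbTE k1) h2 h2' h4 h4' orbl// orbr.
(* The exchange: [M] carries the first block into the second, [L] the second into the first. *)
exists (block_mx 0 M L 0).
  rewrite tr_block_mx !trmx0 mulmx_block !mulmx0 !mul0mx !addr0 !add0r oL oM.
  by rewrite -scalar_mx_block.
have G x : C x -> (exists2 c : R, 0 < c & lsubmx (Phi x) = c *: (rsubmx x *m L)) /\
    exists2 c : R, 0 < c & rsubmx (Phi x) = c *: (lsubmx x *m M).
  move=> Cx; have [y [Cy [g bg ey] [c c0 er] /(_ k1)[c' c'0 el] [[d d0 ed] /(_ k1)[d' d'0 ed']]]] := bp x Cx.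
  have n1 : dot (lsubmx y) (lsubmx y) = dot (lsubmx x0) (lsubmx x0) by rewrite ey block_SO_dotl.
  have n2 : dot (rsubmx y) (rsubmx y) = dot (rsubmx x0) (rsubmx x0) by rewrite ey block_SO_dotr.
  have [H1 H2] := H y n1 n2.
  split; [exists (d' * a * c)|exists (d * b * c')]; rewrite ?mulr_gt0//.
    by rewrite ed' H1 er -scalemxAl !scalerA.
  by rewrite ed H2 el -scalemxAl !scalerA.
have E (v : V) : v *m (block_mx 0 M L 0)^T = row_mx (rsubmx v *m M^T) (lsubmx v *m L^T).
  by rewrite tr_block_mx !trmx0 -{1}[v]hsubmxK mul_row_block !mulmx0 addr0 add0r.
move=> x Cx; have [[c c0 ec] [d d0 ed]] := G x Cx.
have [h1 h2] := orth_back oL ec; have [h3 h4] := orth_back oM ed.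
split.
- by exists c; rewrite // E row_mxKr.
- by exists d; rewrite // E row_mxKl.
move=> g bg; have [[c' _ ec'] [d' _ ed']] := G _ (CG bg Cx).
have [_ h2'] := orth_back oL ec'; have [_ h4'] := orth_back oM ed'.
by rewrite !E !row_mxKr !row_mxKl (negbTE k1) h2 h2' h4 h4' orbl// orbr.
Qed.

End Alignment.

(** * Composition with a linear map *)

Section LinearChange.
Context {R : realType}.

Lemma rV_continuous (T : topologicalType) p (f : T -> 'rV[R]_p) (x : T) :
  (forall j, {for x, continuous (fun y => f y 0 j)}) -> {for x, continuous f}.
Proof.
move=> h; apply/cvgrPdist_le => /= e e0; near=> y.
rewrite /Num.Def.normr/= mx_normrE (bigmax_le _ (ltW e0))//= => -[i j] _.
rewrite !mxE ord1 /=; move: j; near: y; apply: filter_forall => /= j.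
have /cvgrPdist_le/(_ e e0) := h j.
exact.
Unshelve. all: by end_near. Qed.

Lemma mulmx_continuous n p (P : 'M[R]_(n, p)) : continuous (fun y : 'rV[R]_n => y *m P).
Proof.
move=> x; apply: rV_continuous => j; apply: differentiable_continuous.
exact: (vdiff_mulmx P x 0 j).1.
Qed.

Lemma iderive_mulmx n p (W : normedModType R) (P : 'M[R]_(n, p)) (f : 'rV[R]_p -> W) vs :
  iderive (fun y => f (y *m P)) vs = fun y => iderive f [seq v *m P | v <- vs] (y *m P).
Proof.
elim: vs => [|v vs IH] //=; apply/funext => y.
by rewrite IH derive_mulmx.
Qed.

Lemma smooth_mulmx n p (W : normedModType R) (P : 'M[R]_(n, p)) (f : 'rV[R]_p -> W)
    (U : set 'rV[R]_p) (U' : set 'rV[R]_n) : smooth_on U f -> (forall y, U' y -> U (y *m P)) ->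
  smooth_on U' (fun y => f (y *m P)).
Proof.
move=> sf hU vs x U'x; have [c d] := sf [seq v *m P | v <- vs] _ (hU _ U'x).
rewrite iderive_mulmx; split.
  exact: (cvg_comp _ _ (@mulmx_continuous _ _ P x) c).
by move=> v; apply: derivable_mulmx.
Qed.

Lemma is_derive_mulmxr n p q (Q : 'M[R]_(p, q)) (f : 'rV[R]_n -> 'rV[R]_p) x v :
  derivable f x v -> is_derive x v (fun y => f y *m Q) ('D_v f x *m Q).
Proof.
move=> d; have dj j : is_derive x v (fun y => (f y *m Q) 0 j) (('D_v f x *m Q) 0 j).
  have -> : (fun y => (f y *m Q) 0 j) = \sum_(i < p) (Q i j *: (fun y => f y 0 i)).
    by apply/funext => y; rewrite fct_sumE mxE; apply: eq_bigr => i _; rewrite mulrC.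
  have di i : is_derive x v (fun y => f y 0 i) (('D_v f x) 0 i).
    by split; [exact: (derivable_mxP _ _ _).1|exact: derive_coord].
  have h := is_derive_sum (fun i => is_deriveZ (Q i j) (di i)).
  by apply: (is_derive_eq h); rewrite mxE; apply: eq_bigr => i _; rewrite mulrC.
have dd : derivable (fun y => f y *m Q) x v.
  by apply/derivable_mxP => i j; rewrite ord1; have [] := dj j.
split=> //; apply/rowP => j; rewrite -(derive_coord j dd).
by have [_ ->] := dj j.
Qed.

Lemma smooth_mulmxr n p q (Q : 'M[R]_(p, q)) (f : 'rV[R]_n -> 'rV[R]_p) (U : set 'rV[R]_n) :
  open U -> smooth_on U f -> smooth_on U (fun y => f y *m Q).
Proof.
move=> oU sf.
have E vs x : U x -> iderive (fun y => f y *m Q) vs x = iderive f vs x *m Q.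
  elim: vs x => [|v vs IH] x Ux //=.
  have N : \forall y \near x, iderive (fun y => f y *m Q) vs y = iderive f vs y *m Q.
    have : nbhs x U by apply: open_nbhs_nbhs.
    by apply: filterS => y; apply: IH.
  rewrite (near_eq_derive _ N).
  by have [_ ->] := is_derive_mulmxr Q ((sf vs x Ux).2 v).
move=> vs x Ux; have [c d] := sf vs x Ux.
have N : \forall y \near x, iderive f vs y *m Q = iderive (fun y => f y *m Q) vs y.
  have : nbhs x U by apply: open_nbhs_nbhs.
  by apply: filterS => y Uy; rewrite E.
split.
  apply: near_eq_continuous N _.
  exact: (cvg_comp _ _ c (@mulmx_continuous _ _ Q _)).
move=> v; apply: near_eq_derivable N _.
by have [] := is_derive_mulmxr Q (d v).
Qed.

Variables k m : nat.
Local Notation V := 'rV[R]_(k + m).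

Lemma hess_mulmx (F : V -> R) (P : 'M[R]_(k + m)) x u v :
  hess_metric (fun y => F (y *m P)) x u v = hess_metric F (x *m P) (u *m P) (v *m P).
Proof.
have E : 'D_v (energy (fun y => F (y *m P))) = (fun y => 'D_(v *m P) (energy F) (y *m P)).
  by apply/funext => y; exact: (derive_mulmx P (energy F) y v).
rewrite /hess_metric E.
exact: (derive_mulmx P ('D_(v *m P) (energy F)) x u).
Qed.

Lemma unitmx_neq0 (P : 'M[R]_(k + m)) (x : V) : P \in unitmx -> x != 0 -> x *m P != 0.
Proof.
move=> uP; apply: contra => /eqP e; apply/eqP.
by rewrite -[x](mulmxK uP) e mul0mx.
Qed.

Lemma minkowski_mulmx (F : V -> R) (P : 'M[R]_(k + m)) : P \in unitmx ->
  minkowski_norm F -> minkowski_norm (fun x => F (x *m P)).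
Proof.
move=> uP [c [F0 [sF [Fp [Fh Fg]]]]]; split.
  by move=> x; apply: (cvg_comp _ _ (@mulmx_continuous _ _ P x) (c _)).
split; first by move=> x; apply: F0.
split.
  apply: smooth_mulmx sF _ => y /eqP y0; apply/eqP; exact: unitmx_neq0.
split; first by move=> x x0; apply: Fp; apply: unitmx_neq0.
split; first by move=> l x l0; rewrite -scalemxAl Fh.
by move=> x v x0 v0; rewrite hess_mulmx; apply: Fg; apply: unitmx_neq0.
Qed.

Lemma isometry_mulmx (F1 F2 : V -> R) (C : set V) (Phi : V -> V) (P : 'M[R]_(k + m)) :
  P *m P^T = 1%:M -> local_hessian_isometry F1 F2 C Phi ->
  local_hessian_isometry F1 (fun x => F2 (x *m P)) C (fun x => Phi x *m P^T).
Proof.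
move=> oP [oC [conC [oI [conI [hom [[sPhi [gi [sgi [gK1 gK2]]]] iso]]]]]].
have oP' : P^T *m P = 1%:M by apply: mulmx1C.
have QP (v : V) : v *m P^T *m P = v by rewrite -mulmxA oP' mulmx1.
have PQ (v : V) : v *m P *m P^T = v by rewrite -mulmxA oP mulmx1.
(* As a preimage under a linear map, the new image is open and inherits the inverse of [Phi]. *)
have IE : (fun x => Phi x *m P^T) @` C = (fun y => y *m P) @^-1` (Phi @` C).
  apply/seteqP; split=> [y [x Cx <-]|y [x Cx e]] /=; first by exists x; rewrite ?QP.
  by exists x; rewrite // e PQ.
have sPhi2 := smooth_mulmxr P^T oC sPhi.
split; first exact: oC.
split; first exact: conC.
split.
  rewrite IE; apply: open_comp; last exact: oI.
  by move=> y _; apply: mulmx_continuous.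
split.
  move=> l y l0 [x Cx <-]; exists (l *: x); first exact: conC.
  by rewrite hom// scalemxAl.
split; first by move=> l x l0 Cx; rewrite hom// scalemxAl.
split.
  split; first exact: sPhi2.
  exists (fun y => gi (y *m P)); split.
    by apply: smooth_mulmx sgi _ => y; rewrite IE.
  split; first by move=> x Cx; rewrite QP gK1.
  by move=> y; rewrite IE /= => /gK2 ->; rewrite PQ.
move=> x u v Cx; have d w := (sPhi [::] x Cx).2 w.
have [_ eu] := is_derive_mulmxr P^T (d u); have [_ ev] := is_derive_mulmxr P^T (d v).
by rewrite eu ev hess_mulmx !QP iso.
Qed.

End LinearChange.

(** * Spherical coordinates *)

Section Spherical.
Context {R : realType} {k m : nat}.
Local Notation V := 'rV[R]_(k + m).

(** [|v|^2] is [h^2] plus the squared norm of the second block, which is not 0; so [h / |v|] lies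
    strictly between -1 and 1, and [acos] of it strictly between 0 and [pi]. *)
Lemma spherical_coords (v : V) : (0 < k)%N -> regular_pt v ->
  let h := if k == 1%N then \sum_i lsubmx v 0 i else enorm (lsubmx v) in
  [/\ 0 < enorm v, enorm v * cos (sph_t v) = h, enorm v * sin (sph_t v) = enorm (rsubmx v) &
      if k == 1%N then 0 < sph_t v < pi else 0 < sph_t v < pi / 2].
Proof.
move=> k0 rv h; have [v1 v2] := rv; have r0 := enorm_gt0 (regular_neq0 rv).
have q0 := enorm_gt0 v2.
have h2 : h ^+ 2 = dot (lsubmx v) (lsubmx v).
  rewrite /h; case: (boolP (k == 1%N)) => k1; last by rewrite enorm_sqr.
  have E (i : 'I_k) : \sum_i lsubmx v 0 i = lsubmx v 0 i.
    rewrite (bigD1 i)//= big1 ?addr0// => j ji.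
    by case/eqP: ji; apply/val_inj; move/eqP: k1; case: (i) (j) => [a ?] [b ?] /=; lia.
  rewrite (E (Ordinal k0)) /dot (bigD1 (Ordinal k0))//= big1 ?addr0; first by rewrite expr2.
  move=> j ji; case/eqP: ji; apply/val_inj; move/eqP: k1; case: (j) => [b ?] /=; lia.
have rr : enorm v ^+ 2 = h ^+ 2 + enorm (rsubmx v) ^+ 2.
  by rewrite h2 !enorm_sqr -{1 2}[v]hsubmxK dot_row_mx.
have st : sph_t v = acos (h / enorm v) by rewrite /sph_t /h; case: ifP.
pose c := h / enorm v; have ch : enorm v * c = h by rewrite /c mulrC divfK// gt_eqF.
have c2 : c ^+ 2 < 1.
  by rewrite /c expr_div_n ltr_pdivrMr ?exprn_gt0// mul1r rr ltrDl exprn_gt0.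
have cb : -1 < c < 1 by apply/andP; split; nra.
have cb' : -1 <= c <= 1 by case/andP: cb => ? ?; rewrite !ltW.
have cc : cos (acos c) = c by apply: acosK; rewrite in_itv.
have ss : enorm v * sin (acos c) = enorm (rsubmx v).
  rewrite sin_acos// -{1}[enorm v]ger0_norm ?ltW// -sqrtr_sqr -sqrtrM ?sqr_ge0//.
  rewrite mulrBr mulr1 -exprMn ch rr addrAC subrr add0r sqrtr_sqr ger0_norm// ltW//.
rewrite st -/c; split=> //; first by rewrite cc.
have t0 : 0 < acos c by apply: acos_gt0; case/andP: cb => ? ->; rewrite ltW.
have tp : acos c < pi by apply: acos_ltpi; case/andP: cb => -> ?; rewrite ltW.
case: (boolP (k == 1%N)) => k1; first by rewrite t0.
(* For [k > 1] the cosine is a positive quotient of norms, which excludes angles from [pi / 2]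
   on. *)
rewrite t0 /= ltNge; apply/negP => hp.
have c0 : 0 < c by rewrite /c /h (negbTE k1) divr_gt0// enorm_gt0// v1.
have : 0 <= cos (pi - acos c).
  by apply: cos_ge0_pihalf; have := @pi_gt0 R; move: hp tp => hp tp p0; apply/andP; split; lra.
rewrite addrC cosDpi cosN cc; lra.
Qed.

(** [rho] and [theta] have to be functions of the coordinates alone, so they are read at [base r t],
    a representative of the orbit with these coordinates. Norm and angle of the image are constant
    on orbits, and homogeneity frees the angle from [r]. *)
Lemma orbitwise_radial_spherical (C : set V) (Psi : V -> V) : (0 < k)%N -> (1 < m)%N ->
  (forall x, C x -> regular_pt x) -> (forall x, C x -> Psi x != 0) -> conic C ->
  G_invariant_set C ->
  (forall (l : R) x, 0 < l -> C x -> Psi (l *: x) = l *: Psi x) ->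
  orbitwise_radial C Psi -> spherical_form C Psi.
Proof.
move=> k0 m1 regC nzP conC CG hom rad.
have m0 : (0 < m)%N by apply: ltnW.
pose e0 : 'rV[R]_k := if k == 1%N then const_mx 1 else delta_mx 0 (Ordinal k0).
pose f0 : 'rV[R]_m := delta_mx 0 (Ordinal m0).
have dd n (i : 'I_n) : dot (delta_mx 0 i : 'rV[R]_n) (delta_mx 0 i) = 1.
  by rewrite dot_delta mxE !eqxx.
pose base (r t : R) : V := row_mx ((r * cos t) *: e0) ((r * sin t) *: f0).
exists (fun r t => enorm (Psi (base r t))), (fun t => sph_t (Psi (base 1 t))).
move=> x Cx r t.
have regP : regular_pt (Psi x).
  have [[b b0 eb] la _] := rad x Cx; have [x1 x2] := regC x Cx; split.
    move=> k1; have [a a0 ->] := la k1.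
    by rewrite scaler_eq0 negb_or gt_eqF// x1.
  by rewrite eb scaler_eq0 negb_or gt_eqF.
have [r0 rc rs _] := spherical_coords k0 (regC x Cx).
have [p0 pc ps pb] := spherical_coords k0 regP.
rewrite -/r -/t in r0 rc rs.
have [g bg eg] : exists2 g, block_SO g & base r t = x *m g.
  have [B sB eB] : exists2 B, SOmx B & (r * sin t) *: f0 = rsubmx x *m B.
    by apply: SO_transitive => //; rewrite rs dotZl dotZr dd mulr1 -expr2 enorm_sqr.
  have [A sA eA] : exists2 A, SOmx A & (r * cos t) *: e0 = lsubmx x *m A.
    rewrite rc /e0; case: (boolP (k == 1%N)) => k1.
      exists 1%:M; first exact: SOmx1.
      apply/rowP => i; rewrite mulmx1 [LHS]mxE [const_mx _ _ _]mxE mulr1.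
      rewrite (bigD1 i)//= big1 ?addr0// => j ji.
      by case/eqP: ji; apply/val_inj; move/eqP: k1; case: (i) (j) => [a ?] [b ?] /=; lia.
    apply: SO_transitive; first by rewrite ltn_neqAle eq_sym k1.
    by rewrite dotZl dotZr dd mulr1 -expr2 enorm_sqr.
  exists (block_mx A 0 0 B); first by exists A, B.
  by rewrite mul_block_diag -eA -eB.
have [[b b0 eb] la inv] := rad x Cx; have [ir il] := inv g bg.
have nE : enorm (Psi (base r t)) = enorm (Psi x).
  rewrite eg; have S (v : V) : enorm v = Num.sqrt (enorm (lsubmx v) ^+ 2 + enorm (rsubmx v) ^+ 2).
    by rewrite enormE !enorm_sqr -{1 2}[v]hsubmxK dot_row_mx.
  rewrite S [RHS]S ir; case: (boolP (k == 1%N)) il => _ -> //.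
have tE : sph_t (Psi (base 1 t)) = sph_t (Psi x).
  have -> : base 1 t = r^-1 *: (x *m g).
    rewrite -eg /base scale_row_mx !scalerA !mul1r !mulrA mulVf ?gt_eqF// !mul1r //.
  rewrite hom ?invr_gt0//; last exact: CG.
  have nE' : enorm (Psi (x *m g)) = enorm (Psi x) by rewrite -eg.
  have ri0 : 0 < r^-1 by rewrite invr_gt0.
  have Z (v : V) : lsubmx (r^-1 *: v) = r^-1 *: lsubmx v by apply/rowP => i; rewrite !mxE.
  have div (u w : R) : r^-1 * u / (r^-1 * w) = u / w.
    by rewrite -mulf_div mulfV ?mul1r// gt_eqF.
  rewrite /sph_t Z; case: (boolP (k == 1%N)) il => k1 il.
    have -> : \sum_i (r^-1 *: lsubmx (Psi (x *m g))) 0 i = r^-1 * \sum_i lsubmx (Psi x) 0 i.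
      by rewrite il mulr_sumr; apply: eq_bigr => i _; rewrite mxE.
    by rewrite enormZ ?ltW// div nE'.
  by rewrite !enormZ ?ltW// div nE' il.
rewrite nE tE; split=> //; split; first exact: pb.
rewrite scale_row_mx -[LHS]hsubmxK; congr row_mx; last first.
  rewrite scalerA mulrA ps eb enormZ ?ltW// mulfK// gt_eqF// enorm_gt0//.
  exact: (regC x Cx).2.
case: (boolP (k == 1%N)) pc => k1 pc.
  rewrite scalerA pc; apply/rowP => i; rewrite [RHS]mxE [const_mx _ _ _]mxE mulr1.
  rewrite (bigD1 i)//= big1 ?addr0// => j ji.
  by case/eqP: ji; apply/val_inj; move/eqP: k1; case: (i) (j) => [a ?] [b' ?] /=; lia.
have [a a0 ea] := la k1.
rewrite scalerA mulrA pc ea enormZ ?ltW// mulfK// gt_eqF// enorm_gt0//.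
exact: (regC x Cx).1.
Qed.

End Spherical.
(* n = k + m; 1 <= k <= n/2 is 1 <= k <= m. *)
Theorem theorem3p4 (R : realType) (k m : nat)
  (hn : (3 <= k + m)%N) (hk1 : (1 <= k)%N) (hkm : (k <= m)%N)
  (F1 F2 : 'rV[R]_(k + m) -> R)
  (hF1 : minkowski_norm F1) (hF2 : minkowski_norm F2)
  (hF1G : G_invariant_fun F1) (hF2G : G_invariant_fun F2)
  (C : set 'rV[R]_(k + m)) (Phi : 'rV[R]_(k + m) -> 'rV[R]_(k + m))
  (hCconn : connected C) (hCG : G_invariant_set C)
  (hCV1 : C `&` @Vprime R k m = set0)
  (hCV2 : (1 < k)%N -> C `&` @Vsecond R k m = set0)
  (hImV1 : (Phi @` C) `&` @Vprime R k m = set0)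
  (hImV2 : (1 < k)%N -> (Phi @` C) `&` @Vsecond R k m = set0)
  (hPhi : local_hessian_isometry F1 F2 C Phi)
  (hOrb : maps_orbits_into_orbits C Phi) :
  exists (P : 'M[R]_(k + m)) (Phi2 : 'rV[R]_(k + m) -> 'rV[R]_(k + m)),
    P \in unitmx /\
    minkowski_norm (fun x => F2 (x *m P)) /\
    local_hessian_isometry F1 (fun x => F2 (x *m P)) C Phi2 /\
    spherical_form C Phi2 /\
    (forall x, C x -> Phi x = Phi2 x *m P).
Proof.
have m1 : (1 < m)%N by lia.
have [oC [conC [_ [_ [hom [[sPhi [gi [_ [gK _]]]] iso]]]]]] := hPhi.
have reg (D : set 'rV[R]_(k + m)) : D `&` @Vprime R k m = set0 ->
    ((1 < k)%N -> D `&` @Vsecond R k m = set0) -> forall x, D x -> regular_pt x.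
  move=> h1 h2 x Dx; split=> [k1|]; apply/eqP => e.
    have kk : (1 < k)%N by rewrite ltn_neqAle eq_sym k1.
    by have : (D `&` @Vsecond R k m) x by []; rewrite h2.
  by have : (D `&` @Vprime R k m) x by []; rewrite h1.
have regC := reg C hCV1 hCV2.
have regI x : C x -> regular_pt (Phi x) by move=> Cx; apply: (reg _ hImV1 hImV2); exists x.
have inj x y : C x -> C y -> Phi x = Phi y -> x = y.
  by move=> Cx Cy e; rewrite -(gK x Cx) e gK.
have [P oP sP] : exists2 P : 'M[R]_(k + m), P *m P^T = 1%:M &
    spherical_form C (fun x => Phi x *m P^T).
  (* The empty set has no base point to start from, and there the spherical form holds vacuously. *)
  have [C0|/set0P[x0 Cx0]] := eqVneq C set0.
    exists 1%:M; first by rewrite trmx1 mulmx1.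
    by exists (fun _ _ => 0), (fun _ => 0) => x; rewrite C0.
  have [P oP rP] := alignment hk1 m1 hF1 hF2 hF1G hF2G oC hCG sPhi iso hOrb regC regI inj
    conC hom hCconn Cx0.
  exists P; first exact: oP.
  apply: (orbitwise_radial_spherical hk1 m1 regC _ conC hCG _ rP).
    move=> x Cx; apply: unitmx_neq0; last exact: regular_neq0 (regI x Cx).
    by have [_] := mulmx1_unit oP.
  by move=> l x l0 Cx; rewrite hom// scalemxAl.
have [uP _] := mulmx1_unit oP.
(* The linear factor is [x |-> x P], whose inverse is given by [P^T]. *)
exists P, (fun x => Phi x *m P^T); split; first exact: uP.
split; first exact: minkowski_mulmx.
split; first exact: isometry_mulmx.
split; first exact: sP.
by move=> x _; rewrite -mulmxA (mulmx1C oP) mulmx1.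
Qed.
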